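(* Let $C\subset\mathbb{P}^2(\overline{\mathbb{Q}})$ be the line $x_0+x_1+x_2=0$ and set $\eta=\frac{2\,\zeta(3)}{3\,\zeta(2)}$, where $\zeta$ is the Riemann zeta function. Let $(W_\ell)_{\ell\ge1}$ be a strict sequence of nonempty finite subsets of $(\overline{\mathbb{Q}}^\times)^2$ of nontrivial torsion points. Then for each $\varepsilon>0$ we have that \[ \lim_{\ell\to+\infty}\frac{\#\{\omega\in W_\ell\mid|\mathrm{h}(C\cap\omega C)-\eta|<\varepsilon\}}{\#W_\ell}=1. \] Moreover, \[ \lim_{\ell\to+\infty}\frac{1}{\#W_\ell}\sum_{\omega\in W_\ell}\mathrm{h}(C\cap\omega C)=\eta. \]
   Context: $\overline{\mathbb{Q}}$ is an algebraic closure of $\mathbb{Q}$. A torsion point $\omega=(\omega_1,\omega_2)$ of $(\overline{\mathbb{Q}}^\times)^2$ is a pair of roots of unity; it is nontrivial if it differs from $(1,1)$. A sequence $(E_\ell)_{\ell\ge1}$ of nonempty finite subsets of $(\overline{\mathbb{Q}}^\times)^2$ is strict if for every proper algebraic subgroup $H\subsetneq(\overline{\mathbb{Q}}^\times)^2$ we have $\lim_{\ell\to+\infty}\#(E_\ell\cap H)/\#E_\ell=0$. The torus acts on $\mathbb{P}^2(\overline{\mathbb{Q}})$ by $\omega\,[\xi_0:\xi_1:\xi_2]=[\xi_0:\omega_1\xi_1:\omega_2\xi_2]$, so that $\omega C$ is the line $x_0+\omega_1^{-1}x_1+\omega_2^{-1}x_2=0$. For $\omega$ a nontrivial torsion point,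 $C\cap\omega C$ consists of the single point $[\omega_2^{-1}-\omega_1^{-1}:1-\omega_2^{-1}:\omega_1^{-1}-1]$, and $\mathrm{h}(C\cap\omega C)$ denotes the height of this point. The (canonical) height of $\xi=[\xi_0:\dots:\xi_n]\in\mathbb{P}^n(\overline{\mathbb{Q}})$ is \[ \mathrm{h}(\xi)=\sum_{v}\sum_{w\mid v}\frac{[K_w:\mathbb{Q}_v]}{[K:\mathbb{Q}]}\log\max(|\xi_0|_w,\dots,|\xi_n|_w), \] where $K$ is any number field containing all $\xi_i$, $v$ ranges over the places of $\mathbb{Q}$ (with the usual Archimedean absolute value and the usual $p$-adic absolute values), $w$ ranges over the places of $K$ above $v$, and $|\cdot|_w$ is the absolute value in the class of $w$ extending $|\cdot|_v$. It depends neither on $K$ nor on the choice of homogeneous coordinates. *)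

(* Defs.v *)
From HB Require Import structures.
From mathcomp Require Import all_boot all_order all_algebra all_field.
From mathcomp Require Import finmap.
From mathcomp Require Import all_classical all_reals all_analysis.
From mathcomp Require Import ring.

Set Implicit Arguments.
Unset Strict Implicit.
Unset Printing Implicit Defensive.

Import Order.TTheory GRing.Theory Num.Theory.
Import numFieldNormedType.Exports.

Local Open Scope classical_set_scope.
Local Open Scope ring_scope.

Section AbsoluteValues.
Variable R : realType.

Definition absolute_value (K : fieldType) (w : K -> R) : Prop :=
  [/\ forall x, 0 <= w x,
      forall x, w x = 0 <-> x = 0,
      forall x y, w (x * y) = w x * w y
    & forall x y, w (x + y) <= w x + w y].

Definition archimedean_abs (q : rat) : R := `|ratr q|.

Definition padic_abs (p : nat) (q : rat) : R :=
  if q == 0 then 0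
  else (p%:R : R) ^ ((logn p `|denq q|%N)%:Z - (logn p `|numq q|%N)%:Z).

(* A place of Q is represented by its usual absolute value. *)
Definition rat_places : set (rat -> R) :=
  [set v | v = archimedean_abs \/ exists2 p : nat, prime p & v = padic_abs p].

(* Each place w | v contains exactly one absolute value that extends |.|_v;
   the places above v are represented by these absolute values. *)
Definition places_above (K : fieldExtType rat) (v : rat -> R) : set (K -> R) :=
  [set w | absolute_value w /\ forall q : rat, w q%:A = v q].

Definition cauchy_seq (V : zmodType) (a : V -> R) (u : nat -> V) : Prop :=
  forall e : R, 0 < e ->
    exists N, forall m n, (N <= m)%N -> (N <= n)%N -> a (u m - u n) < e.

Definition null_seq (V : zmodType) (a : V -> R) (u : nat -> V) : Prop :=
  forall e : R, 0 < e -> exists N, forall n, (N <= n)%N -> a (u n) < e.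

(* [K_w : Q_v] = d, where the completion K_w is the ring of w-Cauchy sequences
   of K modulo null sequences, and likewise for Q_v.  The families b and c are
   representatives, so the two clauses on b say that its classes generate K_w
   over Q_v and are linearly independent over Q_v. *)
Definition is_local_degree (K : fieldExtType rat) (v : rat -> R) (w : K -> R)
    (d : nat) : Prop :=
  exists b : 'I_d -> nat -> K,
    [/\ forall j, cauchy_seq w (b j),
        forall x : nat -> K, cauchy_seq w x ->
          exists2 c : 'I_d -> nat -> rat, forall j, cauchy_seq v (c j) &
            null_seq w (fun n => x n - \sum_j c j n *: b j n)
      & forall c : 'I_d -> nat -> rat, (forall j, cauchy_seq v (c j)) ->
          null_seq w (fun n => \sum_j c j n *: b j n) ->
          forall j, null_seq v (c j)].

Definition local_degree (K : fieldExtType rat) (v : rat -> R) (w : K -> R) :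
  nat := xget 0%N [set d | is_local_degree v w d].

Definition number_field_height (K : fieldExtType rat) (n : nat)
    (x : 'rV[K]_n.+1) : R :=
  \sum_(v \in rat_places) \sum_(w \in (places_above v : set (K -> R)))
    (local_degree v w)%:R / (\dim {:K})%:R *
    ln (\big[Num.max/0]_(i < n.+1) w (x 0 i)).

End AbsoluteValues.

Lemma coordinate_field (n : nat) (xi : 'rV[algC]_n.+1) :
  {K : fieldExtType rat & {iota : {rmorphism K -> algC} &
    {x : 'rV[K]_n.+1 | map_mx iota x = xi
       & <<1 & [seq x ord0 i | i <- enum 'I_n.+1]>>%VS = fullv}}}.
Proof.
have [K [iota [s sE sgen]]] :=
  num_field_exists [seq xi 0 i | i <- enum 'I_n.+1].
have szs : size s = n.+1.
  by rewrite -(size_map iota) sE size_map size_enum_ord.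
exists K, iota, (\row_i s`_i).
  apply/rowP => i; rewrite !mxE -(nth_map _ 0) ?szs // sE.
  by rewrite (nth_map i) ?size_enum_ord// nth_ord_enum.
rewrite -sgen; congr (<<1 & _>>%VS).
apply: (@eq_from_nth _ 0); first by rewrite size_map size_enum_ord szs.
move=> k; rewrite size_map size_enum_ord => kn.
by rewrite (nth_map ord0) ?size_enum_ord// mxE nth_enum_ord.
Qed.

(* The height of [xi_0 : ... : xi_n], computed over K = Q(xi_0, ..., xi_n). *)
Definition height (R : realType) (n : nat) (xi : 'rV[algC]_n.+1) : R :=
  number_field_height R
    (s2val (projT2 (projT2 (coordinate_field xi)))).

Definition torus : set (algC * algC) := [set z | z.1 != 0 /\ z.2 != 0].

Definition torsion_point (z : algC * algC) : Prop :=
  (exists2 n : nat, (0 < n)%N & z.1 ^+ n = 1) /\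
  (exists2 n : nat, (0 < n)%N & z.2 ^+ n = 1).

(* A Zariski closed subset of the torus is the trace on it of the common zeros
   of a set of polynomials; p.[y%:P].[x] is the value at (x, y) of the bivariate
   polynomial p. *)
Definition algebraic_subgroup (H : set (algC * algC)) : Prop :=
  [/\ exists S : set {poly {poly algC}},
        H = torus `&` [set z | forall p, S p -> p.[z.2%:P].[z.1] = 0],
      H (1, 1),
      forall z t, H z -> H t -> H (z.1 * t.1, z.2 * t.2)
    & forall z, H z -> H (z.1^-1, z.2^-1)].

Definition fraction (R : realType) (A : {fset (algC * algC)})
    (P : set (algC * algC)) : R :=
  #|` [fset z in A | z \in P]%fset|%:R / #|` A|%:R.

Definition strict_sequence (R : realType)
    (E : nat -> {fset (algC * algC)}) : Prop :=
  forall H, algebraic_subgroup H -> H != torus ->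
    (fun l => fraction R (E l) H) @ \oo --> (0 : R).

(* Subsets of the projective plane are given by their nonzero homogeneous
   coordinate vectors. *)
Definition line_C : set 'rV[algC]_3 :=
  [set x | x != 0 :> 'rV[algC]_3 /\ x 0 0 + x 0 1 + x 0 2 = 0].

Definition row3 (a b c : algC) : 'rV[algC]_3 := \row_i [:: a; b; c]`_i.

Definition torus_act (z : algC * algC) (x : 'rV[algC]_3) : 'rV[algC]_3 :=
  row3 (x 0 0) (z.1 * x 0 1) (z.2 * x 0 2).

Definition intersection_point (z : algC * algC) : 'rV[algC]_3 :=
  row3 (z.2^-1 - z.1^-1) (1 - z.2^-1) (z.1^-1 - 1).

Lemma row3E (a b c : algC) : (row3 a b c 0 0 = a) * (row3 a b c 0 1 = b) *
  (row3 a b c 0 2 = c).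
Proof. by rewrite !mxE. Qed.

Lemma row3P (x y : 'rV[algC]_3) :
  x 0 0 = y 0 0 -> x 0 1 = y 0 1 -> x 0 2 = y 0 2 -> x = y.
Proof.
move=> h0 h1 h2; apply/rowP => -[[|[|[|//]]] hi].
- by move: h0; congr (x _ _ = y _ _); apply: val_inj.
- by move: h1; congr (x _ _ = y _ _); apply: val_inj.
- by move: h2; congr (x _ _ = y _ _); apply: val_inj.
Qed.

Lemma line_C_capE (z : algC * algC) : torus z -> z != (1, 1) ->
  line_C `&` (torus_act z @` line_C) =
  [set c *: intersection_point z | c in [set c | c != 0]].
Proof.
case: z => z1 z2 [/= z1n0 z2n0] zn1; apply/seteqP; split => x /=.
  move=> [[xn0 xC] [y [yn0 yC] yx]]; move: xn0 xC; rewrite -yx /torus_act.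
  set p := intersection_point _; rewrite !row3E /= => wn0 wC.
  suff [c wE] : exists c : algC, row3 (y 0 0) (z1 * y 0 1) (z2 * y 0 2) = c *: p.
    have cn0 : c != 0.
      by apply/eqP => c0; case/eqP: wn0; rewrite wE c0 scale0r.
    by exists c.
  have y0E : y 0 0 = - y 0 1 - y 0 2
    by move/eqP: yC; rewrite -addrA addr_eq0 opprD => /eqP.
  have rel : (1 - z1) * y 0 1 = (z2 - 1) * y 0 2.
    apply/eqP; rewrite -subr_eq0 -oppr_eq0 -[X in _ == X]wC y0E.
    by apply/eqP; ring.
  have [z11|z1n1] := eqVneq z1 1.
    have z2n1 : z2 - 1 != 0.
      by apply: contraNneq zn1 => /eqP; rewrite subr_eq0 z11 => /eqP ->.
    have y20 : y 0 2 = 0.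
      apply/eqP; move/eqP: rel; rewrite z11 subrr mul0r eq_sym mulf_eq0.
      by rewrite (negPf z2n1).
    exists (y 0 1 / (1 - z2^-1)).
    have h : 1 - z2^-1 != 0 by rewrite subr_eq0 eq_sym invr_eq1 -subr_eq0.
    by apply: row3P; rewrite [RHS]mxE !row3E /= ?y0E ?y20 z11 ?invr1;
      field; rewrite ?z2n0 ?z2n1.
  have z1n1' : 1 - z1 != 0 by rewrite subr_eq0 eq_sym.
  exists (z2 * y 0 2 / (z1^-1 - 1)).
  have y1E : y 0 1 = (z2 - 1) * y 0 2 / (1 - z1).
    by rewrite -rel mulrAC divff // mul1r.
  by apply: row3P; rewrite [RHS]mxE !row3E /= ?y0E ?y1E;
    field; rewrite ?z1n0 ?z2n0 ?mulN1r ?z1n1'.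
move=> [c cn0 <-]; set p := intersection_point _.
have pn0 : p != 0 :> 'rV[algC]_3.
  apply: contra_neq zn1 => /rowP p0; move: (p0 1) (p0 2).
  rewrite [p]/(row3 _ _ _) !row3E /= !mxE => /eqP; rewrite subr_eq0 eq_sym.
  by rewrite invr_eq1 => /eqP -> /eqP; rewrite subr_eq0 invr_eq1 => /eqP ->.
have pE := row3E (z2^-1 - z1^-1) (1 - z2^-1) (z1^-1 - 1).
have cpn0 : c *: p != 0 :> 'rV[algC]_3 by rewrite scaler_eq0 negb_or cn0.
split; first by split => //; rewrite !mxE /=; ring.
pose y := torus_act (z1^-1, z2^-1) (c *: p).
have yE : torus_act (z1, z2) y = c *: p.
  by apply: row3P; rewrite !row3E //= mulVKf.
exists y => //; split.
  apply: contra_neq cpn0 => y0; rewrite -yE y0.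
  by apply: row3P; rewrite !row3E !mxE ?mulr0.
by rewrite /y /torus_act !row3E !mxE /=; field; rewrite z1n0 z2n0.
Qed.

(* h(C \cap zC): by line_C_capE, intersection_point z is a vector of homogeneous
   coordinates of the only point of C \cap zC. *)
Definition height_C_cap (R : realType) (z : algC * algC) : R :=
  height R (intersection_point z).

Definition zeta (R : realType) (s : nat) : R :=
  limn (series (fun k => (k.+1%:R : R) ^- s)).

Definition eta (R : realType) : R := 2 * zeta R 3 / (3 * zeta R 2).

(* Main.v *)
From HB Require Import structures.
Require Import Defs.
From mathcomp Require Import all_boot all_order all_algebra all_field.
From mathcomp Require Import finmap.
From mathcomp Require Import all_classical all_reals all_analysis.
From mathcomp Require Import complex.
From mathcomp Require Import zify ring lra.

(** Let z1^a, z2^a (a prime to d) be the conjugates of a torsion point of order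
    d.  The archimedean part of h(C \cap zC) is the mean over a of
    F(x, y) = ln max(|1-x|, |1-y|, |x-y|) at (z1^a, z2^a), and the finite places
    contribute at most ln d / phi(d), since 1 - zeta_d is a unit unless d is a
    prime power.  If z avoids finitely many subgroups z1^i z2^j = z1^k z2^l, the
    conjugates are equidistributed in the unit torus.  The logarithmic
    singularity of F is removed by comparing F with
    F_r(x, y) = ln max(|1-rx|, |1-ry|, |y-rx|): the excess of F_r over F is at
    most that of ln |1-rx| over ln |1-x|, whose mean is nonnegative because
    the norm of 1 - z1 is a positive integer.  On the grid of 6M-th roots of
    unity F_r depends only on max(|g|, |h|, |g-h|), where |g| is the distance
    from g to 0 modulo 6M; the resulting weighted cosine sums have a closed form,
    and summing them against the series of ln |1 - r e^(it)| yields
    4 zeta(3) / pi^2 = eta as M tends to infinity and r to 1. *)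

Set Implicit Arguments.
Unset Strict Implicit.
Unset Printing Implicit Defensive.

Import Order.TTheory GRing.Theory Num.Theory.
Import numFieldNormedType.Exports.

Local Open Scope classical_set_scope.
Local Open Scope ring_scope.

(** * Sums over the residues prime to d *)

(** The height is defined through all absolute values of K that extend one of Q, with local degrees
    chosen by [xget], so the places that contribute have to be determined by hand. At a p-adic place
    only the value of w at 1 - zt matters: it squeezes the local term to 0 unless d is a power of p,
    and in that totally ramified case the powers of 1 - zt give both the unique place and its
    degree. Both directions of the comparison of F with F_r rest on one identity on the unit circle,
    |1 - x|^2 + (1 - r)^2 / r = |1 - r x|^2 / r. Its additive constant does not depend on x, so it
    passes to the maximum of the three chords. The grid has modulus N = 6M because the number of
    grid points at hexagonal distance at most t changes its formula at t = N / 3, and t runs up to N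
    / 2. The order of the choices is forced: the bounds on F_r and its Lipschitz constant
    deteriorate as r tends to 1, so r is fixed first, then the finite set of subgroups to avoid, and
    the grid is refined independently of the torsion point. *)

Section BigCoprime.
Variables (T : Type) (idx : T) (op : Monoid.com_law idx).

Lemma big_nat_mul_split p m (f : nat -> T) :
  \big[op/idx]_(0 <= a < p * m) f a =
  \big[op/idx]_(0 <= c < m) \big[op/idx]_(0 <= t < p) f (c + m * t)%N.
Proof.
elim: p => [|p IH].
  by rewrite mul0n big_nil big1 // => c _; rewrite big_nil.
rewrite mulSnr (big_cat_nat _ (n := (p * m)%N)) ?leq_addr //= IH.
rewrite -{1}[(p * m)%N]add0n [X in op _ X]big_addn addKn.
rewrite -big_split /=; apply: eq_bigr => c _.
by rewrite big_nat_recr //= [(m * p)%N]mulnC.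
Qed.

Lemma big_nat_mult p m (f : nat -> T) : (0 < p)%N ->
  \big[op/idx]_(0 <= a < p * m | (p %| a)%N) f a =
  \big[op/idx]_(0 <= c < m) f (p * c)%N.
Proof.
case: p => // p _; elim: m => [|m IH]; first by rewrite muln0 !big_nil.
rewrite big_nat_recr //= -IH mulnS addnC.
rewrite (big_cat_nat _ (n := (p.+1 * m)%N)) ?leq_addr //=; congr (op _ _).
rewrite -{1}[(p.+1 * m)%N]add0n big_addn addKn big_mkcond big_nat_recl // /=.
rewrite add0n dvdn_mulr //= big_nat_cond big1 ?Monoid.mulm1 //.
move=> i; rewrite andbT dvdn_addl ?dvdn_mulr // => /andP[_ h1].
by case: ifP => // /dvdn_leq => /(_ isT); lia.
Qed.

Lemma coprime_modn_eq d a b : a = b %[mod d] -> coprime a d = coprime b d.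
Proof. by move=> h; rewrite -coprime_modl h coprime_modl. Qed.

Lemma big_coprime_pdvd p m (f : nat -> T) : prime p -> (p %| m)%N ->
  \big[op/idx]_(0 <= a < p * m | coprime a (p * m)) f a =
  \big[op/idx]_(0 <= c < m | coprime c m)
    \big[op/idx]_(0 <= t < p) f (c + m * t)%N.
Proof.
move=> pp pm; rewrite big_mkcond big_nat_mul_split [RHS]big_mkcond.
apply: eq_bigr => c _; rewrite -big_mkcond /=.
under eq_bigl => t.
  rewrite coprimeMr [coprime _ m](@coprime_modn_eq m _ c); last first.
    by rewrite addnC mulnC modnMDl.
  have -> : coprime (c + m * t) p && coprime c m = coprime c m.
    case: (boolP (coprime c m)) => cm; rewrite ?andbF // andbT.
    rewrite (@coprime_modn_eq p _ c); first exact: coprime_dvdr cm.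
    by case/dvdnP: pm => q ->; rewrite addnC mulnAC modnMDl.
  over.
by case: ifP => _ //; rewrite big_pred0.
Qed.

(** Here the fibres over the units modulo m also contain the multiples p a with a prime to m; the
    second factor on the left restores them. With the previous lemma this drives the inductions that
    strip one prime from the modulus. *)
Lemma big_coprime_pndvd p m (f : nat -> T) : prime p -> ~~ (p %| m)%N ->
  op (\big[op/idx]_(0 <= a < p * m | coprime a (p * m)) f a)
     (\big[op/idx]_(0 <= a < m | coprime a m) f (p * a)%N) =
  \big[op/idx]_(0 <= c < m | coprime c m)
    \big[op/idx]_(0 <= t < p) f (c + m * t)%N.
Proof.
move=> pp pm.
have h : \big[op/idx]_(0 <= a < p * m | coprime a m) f a =
    \big[op/idx]_(0 <= c < m | coprime c m)
      \big[op/idx]_(0 <= t < p) f (c + m * t)%N.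
  rewrite big_mkcond big_nat_mul_split [RHS]big_mkcond.
  apply: eq_bigr => c _; rewrite -big_mkcond /=.
  under eq_bigl => t.
    rewrite (@coprime_modn_eq m _ c); last by rewrite addnC mulnC modnMDl.
    over.
  by case: ifP => _ //; rewrite big_pred0.
rewrite -h [RHS](bigID (fun a => p %| a)%N) [LHS]Monoid.mulmC; apply: (congr2 op).
  transitivity (\big[op/idx]_(0 <= c < m)
      if coprime (p * c) m then f (p * c)%N else idx).
    rewrite big_mkcond; apply: eq_bigr => a _.
    by rewrite /= coprimeMl (prime_coprime m pp) pm.
  rewrite -(@big_nat_mult p m (fun a => if coprime a m then f a else idx))
    ?prime_gt0 //.
  rewrite [RHS]big_mkcond [LHS]big_mkcond; apply: eq_bigr => a _.
  by rewrite andbC; case: (p %| a)%N.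
apply: eq_bigl => a; rewrite coprimeMr andbC.
by rewrite [coprime a p]coprime_sym (prime_coprime a pp).
Qed.

End BigCoprime.

(** For d = 1 the residue 0 is prime to d, so the sum has one term, in agreement with totient 1 =
    1. *)
Definition usum (V : nmodType) d (f : nat -> V) : V :=
  \sum_(0 <= a < d | coprime a d) f a.

Lemma usum_perm (V : nmodType) b m (f : nat -> V) : coprime b m ->
  (forall a, f (a %% m)%N = f a) -> usum m (fun a => f (b * a)%N) = usum m f.
Proof.
case: m => [|m] bm fp; first by rewrite /usum !big_nil.
rewrite /usum !big_mkord.
pose h (a : 'I_m.+1) : 'I_m.+1 := inord ((b * a) %% m.+1).
have hE a : h a = ((b * a) %% m.+1)%N :> nat by rewrite inordK // ltn_mod.
have h_inj : injective h.
  move=> a a' /(congr1 val); rewrite /= !hE => /eqP.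
  wlog aa : a a' / (a <= a')%N.
    move=> H; case/orP: (leq_total a a') => l; first exact: H.
    by rewrite eq_sym => /(H _ _ l).
  rewrite eq_sym eqn_mod_dvd ?leq_mul2l ?aa ?orbT // -mulnBr.
  rewrite Gauss_dvdr 1?coprime_sym // => /dvdn_leq hh.
  by apply: val_inj => /=; have := ltn_ord a'; case: (posnP (a' - a)); lia.
rewrite [RHS](reindex_inj h_inj) /=; apply: eq_big => [a|a _].
  by rewrite hE coprime_modl coprimeMl bm.
by rewrite hE fp.
Qed.

Lemma totient_usum n : totient n = usum n (fun=> 1%N).
Proof.
rewrite totient_count_coprime /usum [RHS]big_mkcond; apply: eq_bigr => a _.
by rewrite coprime_sym; case: coprime.
Qed.

Lemma totient_pdvd p m : prime p -> (p %| m)%N ->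
  totient (p * m) = (p * totient m)%N.
Proof.
move=> pp pm; rewrite !totient_usum /usum big_coprime_pdvd // big_distrr /=.
by apply: eq_bigr => c _; rewrite sum_nat_const_nat subn0.
Qed.

Lemma totient_pndvd p m : prime p -> ~~ (p %| m)%N ->
  totient (p * m) = (p.-1 * totient m)%N.
Proof.
by move=> pp pm; rewrite totient_coprime ?prime_coprime // totient_prime.
Qed.

(** Reduction maps the units modulo d onto the units modulo e with fibres of equal size. Multiplying
    out avoids dividing in V. The induction removes from d a prime of d / e. *)
Lemma usum_fiber (V : zmodType) d e (f : nat -> V) : (0 < d)%N -> (e %| d)%N ->
  (forall a, f (a %% e)%N = f a) ->
  usum d f *+ totient e = usum e f *+ totient d.
Proof.
move=> d0 ed fp; move: ed d0.
have [n] := ubnP d; elim: n d => // n IH d dn ed d0.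
have [->//|de] := eqVneq d e.
have e0 : (0 < e)%N by apply: dvdn_gt0 ed.
have k1 : (1 < d %/ e)%N.
  by case/dvdnP: ed de d0 => -[|[|k]] ->; rewrite ?mul0n // ?mul1n ?eqxx // mulnK.
pose p := pdiv (d %/ e); have pp : prime p by apply: pdiv_prime.
have [q qE] := dvdnP (pdiv_dvd (d %/ e)).
have dE : d = (p * (q * e))%N by rewrite -{1}(divnK ed) qE mulnCA mulnA.
set m := (q * e)%N in dE.
have em : (e %| m)%N by rewrite dvdn_mull.
have m0 : (0 < m)%N by move: d0; rewrite dE muln_gt0 => /andP[].
have mn : (m < n)%N.
  by rewrite -ltnS (leq_trans _ dn) // ltnS dE ltn_Pmull ?prime_gt1.
have fm c t : f (c + m * t)%N = f c.
  rewrite -(fp (c + m * t)%N) -[in RHS]fp.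
  by case/dvdnP: em => k ->; rewrite addnC mulnAC modnMDl.
have Em : \sum_(0 <= c < m | coprime c m) \sum_(0 <= t < p) f (c + m * t)%N =
    usum m f *+ p.
  rewrite -sumrMnl; apply: eq_bigr => c _.
  under eq_bigr => t _ do rewrite fm.
  by rewrite big_const_nat subn0 -Monoid.iteropE; elim: (p) => //= k ->; rewrite mulrS.
have [pm|pm] := boolP (p %| m)%N.
  by rewrite dE /usum big_coprime_pdvd // Em totient_pdvd // mulrnAC IH // -mulrnA mulnC.
(* The correction term is one more copy of [usum m f], which leaves p - 1 of the p copies, as in the
   totient. *)
have perm : usum m (fun a => f (p * a)%N) = usum m f.
  apply: usum_perm; first by rewrite prime_coprime.
  move=> a; rewrite -(fp a) -[LHS]fp; congr f.
  by case/dvdnP: em => k ->; rewrite modn_dvdm ?dvdn_mull.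
have /eqP : usum (p * m) f + usum m (fun a => f (p * a)%N) = _ :=
  big_coprime_pndvd +%R f pp pm.
rewrite Em perm -dE.
rewrite -{1}(prednK (prime_gt0 pp)) mulrSr (inj_eq (addIr _)) => /eqP ->.
by rewrite dE totient_pndvd // mulrnAC IH // -mulrnA mulnC.
Qed.

(** A new odd prime costs nothing because p <= (p - 1)^2, and neither does a repeated prime. Only a
    first factor 2 leaves the totient unchanged, hence the extra factor 2 for even e. *)
Lemma totient_sqr_ge e : (0 < e)%N -> (e <= (2 - odd e) * totient e ^ 2)%N.
Proof.
have [n] := ubnP e; elim: n e => // n IH e en e0.
have [->//|e1] := eqVneq e 1%N.
have pp : prime (pdiv e) by apply: pdiv_prime; lia.
move: (pdiv e) pp (pdiv_dvd e) => p pp /dvdnP[m eE].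
have p1 := prime_gt1 pp.
have m0 : (0 < m)%N by lia.
have := IH m _ m0; rewrite -ltnS (leq_trans _ en) // => [/(_ isT) h|]; last by nia.
rewrite eE mulnC oddM.
have [pm|pm] := boolP (p %| m)%N.
  rewrite totient_pdvd // andbC.
  have -> : odd m && odd p = odd m.
    by case/dvdnP: pm => q ->; rewrite oddM -andbA andbb.
  rewrite expnMn; nia.
rewrite totient_pndvd // expnMn.
have [p2|p2] := eqVneq p 2%N.
  by move: pm h; rewrite p2 dvdn2 negbK => ->; rewrite /= ; nia.
have -> : odd p by move: (even_prime pp) => [/eqP|]; rewrite ?(negPf p2).
rewrite /=; have : (p <= p.-1 ^ 2)%N by case: p p1 p2 {pp pm eE} => [|[|[|k]]] //=; nia.
by move: (2 - odd m)%N h => k; move: (totient m) => t; nia.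
Qed.

(** The sum is the Moebius function of e: a squared prime makes every fibre sum vanish, and a simple
    prime changes the sign. *)
Lemma usum_prim_root (F : fieldType) e (y : F) : (0 < e)%N ->
  e.-primitive_root y -> usum e (fun a => y ^+ a) \in [:: 0; 1; -1].
Proof.
have [n] := ubnP e; elim: n e y => // n IH e y en e0 ye.
have [e1|e1] := eqVneq e 1%N.
  rewrite /usum e1 big_mkcond big_nat1 /= expr0 !inE eqxx orbT //.
have pp : prime (pdiv e) by apply: pdiv_prime; lia.
move: (pdiv e) pp (pdiv_dvd e) => p pp /dvdnP[m eE].
have p1 := prime_gt1 pp.
have m0 : (0 < m)%N by lia.
have E : \sum_(0 <= c < m | coprime c m) \sum_(0 <= t < p) y ^+ (c + m * t) = 0.
  rewrite big1 // => c _; under eq_bigr => t _ do rewrite exprD exprM.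
  rewrite -mulr_sumr big_mkord; apply/eqP; rewrite mulf_eq0; apply/orP; right.
  have yp : (y ^+ m) ^+ p = 1 by rewrite -exprM -eE prim_expr_order.
  have yn : y ^+ m != 1.
    apply/negP => /eqP h; have := prim_order_dvd ye m; rewrite h eqxx.
    by move/dvdn_leq => /(_ m0); nia.
  move: (subrX1 (y ^+ m) p); rewrite yp subrr => /esym/eqP.
  by rewrite mulf_eq0 subr_eq0 (negPf yn).
have ymp : m.-primitive_root (y ^+ p).
  by have := dvdn_prim_root ye (m := m); rewrite {2}eE mulKn //; apply; rewrite eE dvdn_mulr.
have [pm|pm] := boolP (p %| m)%N.
  by rewrite eE mulnC /usum big_coprime_pdvd // E inE eqxx.
have := big_coprime_pndvd +%R (fun a => y ^+ a) pp pm.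
rewrite /= E mulnC -eE => /eqP.
rewrite addr_eq0 /usum => /eqP ->.
under eq_bigr => a _ do rewrite exprM.
have mn : (m < n)%N by nia.
have := IH m (y ^+ p) mn m0 ymp; rewrite /usum !inE => /or3P[] /eqP ->.
- by rewrite oppr0 eqxx.
- by rewrite eqxx !orbT.
- by rewrite opprK eqxx orbT.
Qed.

Lemma prod_prim_root1 (F : fieldType) p (y x : F) : (0 < p)%N ->
  p.-primitive_root y -> \prod_(0 <= t < p) (1 - x * y ^+ t) = 1 - x ^+ p.
Proof.
move=> p0 yp; have [->|x0] := eqVneq x 0.
  by rewrite expr0n eqn0Ngt p0 subr0 big1 // => t _; rewrite mul0r subr0.
have := congr1 (fun q => q.[x^-1]) (factor_Xn_sub_1 yp).
rewrite horner_prod !hornerE => h.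
have -> : 1 - x ^+ p = x ^+ p * (x^-1 ^+ p - 1).
  by rewrite mulrBr mulr1 -exprMn divff // expr1n.
rewrite -h.
have -> : x ^+ p = \prod_(0 <= t < p) x by rewrite prodr_const_nat subn0.
rewrite -big_split /=; apply: eq_bigr => t _.
by rewrite !hornerE mulrBr divff.
Qed.

(** The product is the value at 1 of the e-th cyclotomic polynomial. *)
Lemma prod_coprime_prim_root (F : fieldType) e (y : F) : (1 < e)%N ->
    e.-primitive_root y ->
  exists2 q : nat, \prod_(0 <= a < e | coprime a e) (1 - y ^+ a) = q%:R
    & q = 1%N \/ prime q /\ exists k, e = (q ^ k.+1)%N.
Proof.
have [n] := ubnP e; elim: n e y => // n IH e y en e1 ye.
have pp : prime (pdiv e) by apply: pdiv_prime.
move: (pdiv e) pp (pdiv_dvd e) => p pp /dvdnP[m eE].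
have p1 := prime_gt1 pp; have p0 := prime_gt0 pp.
have m0 : (0 < m)%N by lia.
have yn a : coprime a e -> 1 - y ^+ a != 0.
  move=> ae; rewrite subr_eq0 eq_sym -(prim_order_dvd ye).
  by apply: contraL ae => /gcdn_idPr; rewrite /coprime => ->; lia.
have ymp : m.-primitive_root (y ^+ p).
  by have := dvdn_prim_root ye (m := m); rewrite {2}eE mulKn //; apply; rewrite eE dvdn_mulr.
have ymm : p.-primitive_root (y ^+ m).
  by have := dvdn_prim_root ye (m := p); rewrite {2}eE mulnK //; apply; rewrite eE dvdn_mull.
have E c : \prod_(0 <= t < p) (1 - y ^+ (c + m * t)) = 1 - (y ^+ p) ^+ c.
  under eq_bigr => t _ do rewrite exprD exprM.
  by rewrite (prod_prim_root1 _ p0 ymm) -exprM mulnC exprM.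
(* For e = p the product is the value of 1 + X + ... + X^(p-1) at 1, which is p. *)
have [m1|m1] := eqVneq m 1%N.
  exists p; last by right; split => //; exists 0%N; rewrite eE m1 mul1n.
  have ep : e = p by rewrite eE m1 mul1n.
  move: ye; rewrite ep => yp.
  have X1 : ('X - 1 : {poly F}) != 0 by rewrite -polyC1 polyXsubC_eq0.
  have := factor_Xn_sub_1 yp; rewrite -{1}(prednK p0) big_nat_recl // expr0.
  rewrite polyC1 subrX1 => /(mulfI X1) /(congr1 (fun q => q.[1])).
  rewrite horner_sum horner_prod.
  under [RHS]eq_bigr => i _ do rewrite hornerXn expr1n.
  rewrite sumr_const card_ord => <-.
  rewrite -{1}(prednK p0) big_mkcond big_nat_recl //.
  rewrite [coprime 0 p]/coprime gcd0n [p == _]gtn_eqF // Monoid.mul1m.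
  rewrite big_nat [RHS]big_nat; apply: eq_bigr => i /andP[_ ip].
  rewrite !hornerE -/(coprime _ _) coprime_sym prime_coprime // gtnNdvd //; lia.
have m2 : (1 < m)%N by lia.
have [pm|pm] := boolP (p %| m)%N.
  have [q Eq h] := IH m (y ^+ p) ltac:(nia) m2 ymp.
  exists q.
    rewrite -Eq eE mulnC (big_coprime_pdvd *%R) //.
    by apply: eq_bigr => c _; rewrite E.
  case: h => [->|[pq [k mE]]]; [by left|right; split => //].
  exists k.+1; rewrite eE expnS mulnC; congr (_ * _)%N; last by [].
  move: pm; rewrite mE Euclid_dvdX // => /andP[].
  by rewrite dvdn_prime2 // => /eqP.
(* The fibre product and the correction term are the same nonzero product over the units modulo m,
   so they cancel and leave 1. *)
exists 1%N; last by left.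
have := big_coprime_pndvd *%R (fun a => 1 - y ^+ a) pp pm.
under [X in _ = X -> _]eq_bigr => c _ do rewrite E.
under [X in _ * X = _ -> _]eq_bigr => c _ do rewrite exprM.
rewrite -[X in _ = X -> _]mul1r mulnC -eE => /mulIf -> //.
rewrite prodf_seq_neq0; apply/allP => c _; apply/implyP => cm.
rewrite -exprM subr_eq0 eq_sym -(prim_order_dvd ye) eE mulnC dvdn_pmul2l //.
by apply: contraL cm => /gcdn_idPr; rewrite /coprime => ->; lia.
Qed.

(** * Absolute values and local degrees *)

(* Gaussian elimination over the field S/N, carried out on representatives:
   n equations in m > n unknowns have a nontrivial solution modulo N. *)
Lemma kernel_mod_ideal (A : comPzRingType) (S N : A -> Prop) :
    S 0 -> S 1 -> (forall x y, S x -> S y -> S (x - y)) ->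
    (forall x y, S x -> S y -> S (x * y)) ->
    N 0 -> (forall x y, N x -> N y -> N (x - y)) ->
    (forall x y, S x -> N y -> N (x * y)) -> ~ N 1 ->
    (forall x, S x -> ~ N x -> exists2 u, S u & N (1 - u * x)) ->
  forall n m (M : 'I_m -> 'I_n -> A), (n < m)%N -> (forall j i, S (M j i)) ->
  exists c : 'I_m -> A, [/\ forall j, S (c j), exists j, ~ N (c j) &
    forall i, N (\sum_j c j * M j i)].
Proof.
move=> S0 S1 SB SM N0 NB NM N1 inv.
have SN x : S x -> S (- x) by move=> h; rewrite -[- x]sub0r; exact: SB.
have SD x y : S x -> S y -> S (x + y).
  by move=> hx hy; rewrite -[y]opprK; apply: (SB) => //; exact: SN.
have NN x : N x -> N (- x) by move=> h; rewrite -[- x]sub0r; exact: NB.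
have ND x y : N x -> N y -> N (x + y).
  by move=> hx hy; rewrite -[y]opprK; apply: NB => //; exact: NN.
elim=> [|n IH] m M nm SMM.
  case: m nm M SMM => // m _ M _; exists (fun=> 1); split => [j //||[]//].
  by exists ord0.
have [allN|] := pselect (forall j, N (M j ord_max)).
  have [c [Sc cN cM]] := IH m (fun j i => M j (lift ord_max i)) (ltnW nm)
    (fun j i => SMM _ _).
  exists c; split => // i; have [->|[k ->]] : i = ord_max \/ exists k, i = lift ord_max k.
    by case: (unliftP ord_max i) => [k ->|->]; [right; exists k|left].
  - by apply: (big_ind N) => // j _; apply: (NM).
  - exact: cM.
move=> /asboolP; rewrite asbool_neg => /existsp_asboolPn [j0 j0N].
case: m nm M SMM j0 j0N => // m nm M SMM j0 j0N.
have [u Su uN] := inv _ (SMM j0 ord_max) j0N.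
(* The unknown j0 is eliminated with the pivot [M j0 ord_max], whose inverse modulo N is u; - t
   below is the value that the last equation then forces on it. *)
pose M' j i := M (lift j0 j) (lift ord_max i) -
  M (lift j0 j) ord_max * u * M j0 (lift ord_max i).
have SM' j i : S (M' j i) by apply: (SB) => //; apply: (SM) => //; apply: (SM).
have [c' [Sc' [k kN] cM]] := IH m M' nm SM'.
pose t := \sum_j c' j * (M (lift j0 j) ord_max * u).
have St : S t by apply: (big_ind S) => // j _; apply: (SM) => //; apply: (SM).
exists (fun j => if unlift j0 j is Some k then c' k else - t); split.
- by move=> j; case: unliftP => // *; exact: SN.
- by exists (lift j0 k); rewrite liftK.
move=> i; rewrite (bigD1_ord j0) //= unlift_none mulNr mulr_suml addrC.
under eq_bigr => j _ do rewrite liftK.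
rewrite -sumrB.
have [->|[l ->]] : i = ord_max \/ exists l, i = lift ord_max l.
  by case: (unliftP ord_max i) => [l ->|->]; [right; exists l|left].
- apply: (big_ind N) => // j _.
  have -> : c' j * M (lift j0 j) ord_max - c' j * (M (lift j0 j) ord_max * u) * M j0 ord_max
     = (c' j * M (lift j0 j) ord_max) * (1 - u * M j0 ord_max) by ring.
  by apply: (NM) => //; apply: (SM).
- rewrite (eq_bigr (fun j => c' j * M' j l)); last first.
    by move=> j _; rewrite /M'; ring.
  exact: cM.
Qed.

Section CauchySequences.
Variables (R : realType).

Lemma absB (K : fieldType) (w : K -> R) : absolute_value w ->
  forall x y, w (x - y) <= w x + w y.
Proof.
move=> [w0 w00 wM wD] x y; rewrite (le_trans (wD _ _)) // lerD2l.
rewrite -mulN1r wM -[leRHS]mul1r ler_wpM2r //.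
have : w (-1) ^+ 2 = 1.
  rewrite expr2 -wM mulrNN mulr1; apply: (@mulfI _ (w 1)).
    by apply/eqP => /w00 /eqP; rewrite oner_eq0.
  by rewrite -wM !mulr1.
by move/eqP; rewrite sqrp_eq1 // => /eqP ->.
Qed.

Variables (K : fieldType) (w : K -> R).
Hypothesis wP : absolute_value w.

Lemma abs_ge0 x : 0 <= w x. Proof. by have [] := wP. Qed.
Lemma absM x y : w (x * y) = w x * w y. Proof. by have [] := wP. Qed.
Lemma absD x y : w (x + y) <= w x + w y. Proof. by have [] := wP. Qed.
Lemma abs_eq0 x : (w x == 0) = (x == 0).
Proof. by have [_ h _ _] := wP; apply/eqP/eqP => /h. Qed.
Lemma abs0 : w 0 = 0. Proof. by apply/eqP; rewrite abs_eq0. Qed.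
Lemma abs1 : w 1 = 1.
Proof.
by apply: (@mulfI _ (w 1)); rewrite ?abs_eq0 ?oner_eq0 // -absM !mulr1.
Qed.
Lemma absN x : w (- x) = w x.
Proof.
have h y : w (- y) <= w y by rewrite -[- y]sub0r (le_trans (absB wP _ _)) // abs0 add0r.
by apply/eqP; rewrite eq_le h /= -{1}[x]opprK h.
Qed.
Lemma absX x n : w (x ^+ n) = w x ^+ n.
Proof. by elim: n => [|n IH]; rewrite ?expr0 ?abs1 // !exprS absM IH. Qed.
Lemma absV x : w x^-1 = (w x)^-1.
Proof.
have [->|x0] := eqVneq x 0; first by rewrite invr0 abs0 invr0.
by apply: (@mulfI _ (w x)); rewrite ?abs_eq0 // -absM !divff ?abs1 ?abs_eq0.
Qed.
Lemma abs_sum (I : Type) (r : seq I) (P : pred I) (F : I -> K) :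
  w (\sum_(i <- r | P i) F i) <= \sum_(i <- r | P i) w (F i).
Proof.
elim/big_ind2: _ => [|x1 y1 x2 y2 h1 h2|//]; first by rewrite abs0.
by rewrite (le_trans (absD _ _)) // lerD.
Qed.
Lemma abs_prod (I : Type) (r : seq I) (P : pred I) (F : I -> K) :
  w (\prod_(i <- r | P i) F i) = \prod_(i <- r | P i) w (F i).
Proof.
by elim/big_rec2: _ => [|i y x _ <-]; rewrite ?abs1 // absM.
Qed.
Lemma abs_gt0 x : (0 < w x) = (x != 0).
Proof. by rewrite lt_def abs_ge0 andbT abs_eq0. Qed.
Lemma abs_dist x y : `|w x - w y| <= w (x - y).
Proof.
rewrite ler_norml lerNl opprB; apply/andP; split.
  by rewrite lerBlDr -{1}[y](subrK x) (le_trans (absD _ _)) // -opprB absN.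
by rewrite lerBlDr -{1}[x](subrK y) absD.
Qed.

Let S := cauchy_seq w.
Let N := null_seq w.

Lemma cauchy_cst x : cauchy_seq w (fun=> x).
Proof. by move=> e e0; exists 0%N => m n _ _; rewrite subrr abs0. Qed.

Lemma cauchy_bounded x : cauchy_seq w x -> exists2 B, 0 < B & forall n, w (x n) <= B.
Proof.
move=> /(_ 1 ltr01) [n0 h].
exists (1 + \sum_(i < n0.+1) w (x i)).
  by rewrite ltr_wpDr // sumr_ge0 // => i _; exact: abs_ge0.
move=> n; have [nn|nn] := leqP n0 n.
  rewrite -[x n](subrK (x n0)) (le_trans (absD _ _)) // lerD //.
    by rewrite ltW // h.
  by rewrite big_ord_recr /= lerDr sumr_ge0 // => i _; exact: abs_ge0.
have nn' : (n < n0.+1)%N by lia.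
rewrite (bigD1 (Ordinal nn')) //= addrCA lerDl addr_ge0 // sumr_ge0 // => i _.
exact: abs_ge0.
Qed.

Lemma nullB x y : null_seq w x -> null_seq w y -> null_seq w (fun n => x n - y n).
Proof.
move=> hx hy e e0; have e2 : 0 < e / 2 by rewrite divr_gt0.
have [n1 h1] := hx _ e2; have [n2 h2] := hy _ e2.
exists (maxn n1 n2) => n; rewrite geq_max => /andP[l1 l2].
rewrite (le_lt_trans (absB wP _ _)) // [e](splitr e) ltrD //; [exact: h1|exact: h2].
Qed.

Lemma null0 : null_seq w (fun=> 0).
Proof. by move=> e e0; exists 0%N => n _; rewrite abs0. Qed.

Lemma nullD x y : null_seq w x -> null_seq w y -> null_seq w (fun n => x n + y n).
Proof.
move=> hx hy; have h := nullB hx (nullB null0 hy).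
by move=> e /h[n0 H]; exists n0 => n /H; rewrite sub0r opprK.
Qed.

Lemma null_sum (I : Type) (r : seq I) (x : I -> nat -> K) :
  (forall i, null_seq w (x i)) -> null_seq w (fun n => \sum_(i <- r) x i n).
Proof.
move=> h; elim: r => [|i r IH].
  by move=> e e0; exists 0%N => n _; rewrite big_nil abs0.
have H := nullD (h i) IH.
by move=> e /H[n0 h0]; exists n0 => n /h0; rewrite big_cons.
Qed.

Lemma null_mul_bounded B x y : (forall n, w (x n) <= B) -> null_seq w y ->
  null_seq w (fun n => x n * y n).
Proof.
move=> hB hy e e0.
have B0 : 0 <= B by apply: le_trans (hB 0%N); exact: abs_ge0.
have [|n0 h] := hy (e / (B + 1)); first by rewrite divr_gt0 // ltr_wpDl.
exists n0 => n /h; rewrite absM => hn.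
have B1 : 0 < B + 1 by rewrite ltr_wpDl.
apply: (@le_lt_trans _ _ ((B + 1) * w (y n))).
  by rewrite ler_wpM2r ?abs_ge0 // (le_trans (hB n)) // lerDl.
by rewrite mulrC -ltr_pdivlMr.
Qed.

Lemma null_mul x y : cauchy_seq w x -> null_seq w y ->
  null_seq w (fun n => x n * y n).
Proof. by move=> /cauchy_bounded[B _ hB]; apply: null_mul_bounded hB. Qed.

Lemma cauchyB x y : cauchy_seq w x -> cauchy_seq w y ->
  cauchy_seq w (fun n => x n - y n).
Proof.
move=> hx hy e e0; have e2 : 0 < e / 2 by rewrite divr_gt0.
have [n1 h1] := hx _ e2; have [n2 h2] := hy _ e2.
exists (maxn n1 n2) => m n; rewrite !geq_max => /andP[l1 l2] /andP[l3 l4].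
have -> : x m - y m - (x n - y n) = (x m - x n) - (y m - y n) by ring.
rewrite (le_lt_trans (absB wP _ _)) // [e](splitr e) ltrD //; [exact: h1|exact: h2].
Qed.

Lemma cauchyM x y : cauchy_seq w x -> cauchy_seq w y ->
  cauchy_seq w (fun n => x n * y n).
Proof.
move=> hx hy e e0.
have [B B0 hB] := cauchy_bounded hx; have [C C0 hC] := cauchy_bounded hy.
have [|n1 h1] := hx (e / 2 / C); first by rewrite !divr_gt0.
have [|n2 h2] := hy (e / 2 / B); first by rewrite !divr_gt0.
exists (maxn n1 n2) => m n; rewrite !geq_max => /andP[l1 l2] /andP[l3 l4].
have -> : x m * y m - x n * y n = (x m - x n) * y m + x n * (y m - y n) by ring.
rewrite (le_lt_trans (absD _ _)) // [e](splitr e) ltr_leD // absM.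
  have := h1 _ _ l1 l3; rewrite ltr_pdivlMr // => h.
  apply: le_lt_trans h.
  by rewrite ler_wpM2l ?abs_ge0.
have := h2 _ _ l2 l4; rewrite ltr_pdivlMr // => /ltW; apply: le_trans.
by rewrite mulrC ler_wpM2l ?abs_ge0.
Qed.

(** A Cauchy sequence that is not null is eventually bounded away from 0, so termwise inversion
    works up to finitely many terms. This makes Cauchy modulo null sequences a field, as
    [kernel_mod_ideal] requires. *)
Lemma cauchy_inv x : cauchy_seq w x -> ~ null_seq w x ->
  exists2 u, cauchy_seq w u & null_seq w (fun n => 1 - u n * x n).
Proof.
move=> hx xN.
have [e e0 [n0 hn0]] : exists2 e, 0 < e & exists n0, forall n, (n0 <= n)%N -> e <= w (x n).
  apply: contrapT => H; apply: xN => e e0.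
  have e2 : 0 < e / 2 by rewrite divr_gt0.
  have [n1 h1] := hx _ e2; exists n1 => n nn.
  rewrite ltNge; apply/negP => en; apply: H; exists (e / 2) => //.
  exists n1 => m mm; rewrite leNgt; apply/negP => xm.
  move: en; apply/negP; rewrite -ltNge -[x n](subrK (x m)).
  rewrite (le_lt_trans (absD _ _)) // [e](splitr e) ltrD //; exact: h1.
exists (fun n => (x n)^-1); last first.
  move=> d d0; exists n0 => n nn; rewrite mulVf ?subrr ?abs0 //.
  by rewrite -abs_gt0 (lt_le_trans e0) // hn0.
move=> d d0; have [|n1 h1] := hx (d * (e * e)); first by rewrite !mulr_gt0.
exists (maxn n0 n1) => m n; rewrite !geq_max => /andP[l1 l2] /andP[l3 l4].
have xm := hn0 _ l1; have xn := hn0 _ l3.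
have xm0 : x m != 0 by rewrite -abs_gt0 (lt_le_trans e0).
have xn0 : x n != 0 by rewrite -abs_gt0 (lt_le_trans e0).
have -> : (x m)^-1 - (x n)^-1 = (x n - x m) / (x m * x n).
  by field; rewrite xm0 xn0.
rewrite absM absV ltr_pdivrMr ?abs_gt0 ?mulf_neq0 // (lt_le_trans (h1 _ _ l4 l2)) //.
by rewrite ler_wpM2l ?(ltW d0) // absM ler_pM // ltW.
Qed.

End CauchySequences.

(** Invariance of dimension over Q_v: if d1 < d2, the coordinates of the e j in the generators b
    give d1 equations in d2 unknowns, and a nontrivial solution contradicts the independence of
    e. *)
Lemma local_degree_le (R : realType) (K : fieldExtType rat) (v : rat -> R)
    (w : K -> R) d1 d2 : absolute_value v -> absolute_value w ->
    (forall q : rat, w q%:A = v q) ->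
  is_local_degree v w d1 -> is_local_degree v w d2 -> (d2 <= d1)%N.
Proof.
move=> vP wP wv [b [bC bgen _]] [e [eC _ eindep]].
rewrite leqNgt; apply/negP => dd.
pose Q j (c : 'I_d1 -> nat -> rat) := (forall i, cauchy_seq v (c i)) /\
    null_seq w (fun n => e j n - \sum_i c i n *: b i n).
have /choice[M MP] : forall j, exists c, Q j c.
  by move=> j; have [c c1 c2] := bgen _ (eC j); exists c.
have wZ q x : w (q *: x) = v q * w x.
  by rewrite -[q *: x]mulr_algl (absM wP) wv.
have [|||||||||c [cC [j0 cN] cM]] :=
  @kernel_mod_ideal (nat -> rat) (cauchy_seq v) (null_seq v) _ _ _ _ _ _ _ _ _ d1 d2 M dd (fun j => (MP j).1).
- exact: cauchy_cst.
- exact: cauchy_cst.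
- by move=> x y; exact: cauchyB.
- by move=> x y; exact: cauchyM.
- exact: null0.
- by move=> x y; exact: nullB.
- by move=> x y; exact: null_mul.
- by move=> /(_ 1 ltr01)[n /(_ n (leqnn n))]; rewrite (abs1 vP) ltxx.
- by move=> x; exact: cauchy_inv.
apply: cN; apply: eindep => // {j0}.
(* The relation between the e j is the sum of the errors of their expansions (H1) and of the b i
   with null coefficients (H2). *)
have H1 : null_seq w (fun n => \sum_j (c j n)%:A * (e j n - \sum_i M j i n *: b i n)).
  apply: null_sum => // j; have [B _ hB] := cauchy_bounded vP (cC j).
  by apply: (null_mul_bounded wP (B := B)) (MP j).2 => n; rewrite wv.
have H2 : null_seq w (fun n => \sum_i b i n * ((\sum_j c j * M j i) n)%:A).
  apply: null_sum => // i; apply: null_mul => //.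
  by move=> eps e0; have [n0 h] := cM i _ e0; exists n0 => n /h; rewrite wv.
move=> eps e0; have [n0 h] := nullD wP H1 H2 e0; exists n0 => n /h.
congr (w _ < _).
rewrite [X in _ + X](eq_bigr (fun i => \sum_j (c j n)%:A * (M j i n *: b i n))).
  rewrite exchange_big -big_split /=; apply: eq_bigr => j _.
  by rewrite -mulr_sumr -mulrDr subrK mulr_algl.
move=> i _; have -> : (\sum_j c j * M j i) n = \sum_j c j n * M j i n.
  by rewrite fct_sumE.
rewrite mulrC scaler_suml mulr_suml; apply: eq_bigr => j _.
by rewrite !mulr_algl scalerA.
Qed.

(** It therefore suffices to exhibit one basis of K_w to know the value chosen by [xget]. *)
Lemma local_degree_unique (R : realType) (K : fieldExtType rat) (v : rat -> R)
    (w : K -> R) d : absolute_value v -> absolute_value w ->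
    (forall q : rat, w q%:A = v q) ->
  is_local_degree v w d -> local_degree v w = d.
Proof.
move=> vP wP wv h; rewrite /local_degree.
have h' : is_local_degree v w (xget 0%N [set d | is_local_degree v w d]).
  by apply: (xgetI _ h).
by apply/eqP; rewrite eqn_leq; apply/andP; split;
  apply: (local_degree_le vP wP wv).
Qed.

(** As z^d = 1, some cyclotomic polynomial of index k dividing d vanishes at z; then z^k = 1, so d
    divides k. *)
Lemma root_Cyclotomic (C : numFieldType) d (z : C) : d.-primitive_root z ->
  (map_poly intr 'Phi_d).[z] = 0.
Proof.
move=> zd; have d0 := prim_order_gt0 zd.
have ev n : (0 < n)%N -> \prod_(k <- divisors n) (map_poly intr 'Phi_k).[z] = z ^+ n - 1.
  move=> n0; have := congr1 (fun p : {poly int} => (map_poly intr p).[z]) (prod_Cyclotomic n0).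
  by rewrite /= rmorph_prod horner_prod rmorphB /= map_polyXn rmorph1 !hornerE.
have := ev d d0; rewrite (prim_expr_order zd) subrr => /eqP.
rewrite prodf_seq_eq0 => /hasP[k]; rewrite -dvdn_divisors //= => kd /eqP zk.
have k0 : (0 < k)%N by apply: dvdn_gt0 kd.
suff dk : (d %| k)%N by have -> : d = k by apply/eqP; rewrite eqn_dvd dk kd.
rewrite (prim_order_dvd zd) -subr_eq0 -ev // prodf_seq_eq0.
by apply/hasP; exists k; rewrite ?zk ?eqxx // -dvdn_divisors.
Qed.

(** * Places of cyclotomic fields *)

Section CyclotomicField.
Variables (K : fieldExtType rat) (iota : {rmorphism K -> algC}) (d : nat) (zt : K).
Hypothesis ztP : d.-primitive_root zt.
Hypothesis genK : <<1; zt>>%VS = fullv.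

Let d0 : (0 < d)%N := prim_order_gt0 ztP.
Let PhiQ : {poly rat} := map_poly intr 'Phi_d.

Lemma horner_alg_onto (x : K) : exists p : {poly rat}, x = horner_alg zt p.
Proof.
have /Fadjoin1_polyP[p ->] : x \in <<1; zt>>%VS by rewrite genK memvf.
by exists p.
Qed.

(** The cyclotomic polynomial is the minimal polynomial of zt; this is imported from [algC] through
    iota. *)
Lemma dvd_Cyclotomic (p : {poly rat}) : horner_alg zt p = 0 -> PhiQ %| p.
Proof.
move=> h; have ztC : d.-primitive_root (iota zt) by rewrite fmorph_primitive_root.
have [q [qE qm] qdv] := minCpolyP (iota zt).
have -> : PhiQ = q.
  apply: (map_inj_poly (f := (ratr : rat -> algC))); [exact: fmorph_inj|exact: rmorph0|].
  rewrite -qE (minCpoly_cyclotomic ztC) -(Cintr_Cyclotomic ztC) /PhiQ -map_poly_comp.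
  by apply: eq_map_poly => a; rewrite /= rmorph_int.
rewrite -qdv /root; apply/eqP.
transitivity (iota (horner_alg zt p)); last by rewrite h rmorph0.
rewrite /horner_alg /horner_morph -horner_map -map_poly_comp; congr _.[_].
by apply: eq_map_poly => a; rewrite /= alg_num_field fmorph_rat.
Qed.

Lemma horner_alg_eq (p q : {poly rat}) (C : numFieldType) (z : C) :
  d.-primitive_root z -> horner_alg zt p = horner_alg zt q ->
  (map_poly ratr p).[z] = (map_poly ratr q).[z].
Proof.
move=> zP /eqP; rewrite -subr_eq0 -rmorphB => /eqP /dvd_Cyclotomic /dvdpP[r rE].
apply/eqP; rewrite -subr_eq0 -hornerN -hornerD -rmorphB /= rE rmorphM /= hornerM.
suff -> : (map_poly ratr PhiQ).[z] = 0 by rewrite mulr0.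
rewrite -(root_Cyclotomic zP) /PhiQ -map_poly_comp; congr _.[_].
by apply: eq_map_poly => a; rewrite /= ratr_int.
Qed.

Lemma size_PhiQ : size PhiQ = (totient d).+1.
Proof. by rewrite size_map_poly_id0 ?size_Cyclotomic // (monicP (Cyclotomic_monic d)) oner_eq0. Qed.

Lemma horner_alg_PhiQ : horner_alg zt PhiQ = 0.
Proof.
have ztC : d.-primitive_root (iota zt) by rewrite fmorph_primitive_root.
apply: (fmorph_inj iota); rewrite rmorph0 -(root_Cyclotomic ztC).
rewrite /horner_alg /horner_morph -horner_map -map_poly_comp /PhiQ -map_poly_comp.
congr _.[_]; apply: eq_map_poly => a.
by rewrite /= alg_num_field fmorph_rat ratr_int.
Qed.

Lemma horner_alg_small (x : K) :
  exists2 p : {poly rat}, x = horner_alg zt p & (size p <= totient d)%N.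
Proof.
have [p ->] := horner_alg_onto x; exists (p %% PhiQ).
  rewrite {1}(divp_eq p PhiQ) rmorphD rmorphM /= horner_alg_PhiQ mulr0 add0r //.
by rewrite -ltnS -size_PhiQ ltn_modp -size_poly_gt0 size_PhiQ.
Qed.

Lemma dim_cyclotomic : \dim {:K} = totient d.
Proof.
rewrite -genK dim_Fadjoin dimv1 muln1.
apply/eqP; rewrite -eqSS -size_minPoly -size_PhiQ eqn_leq; apply/andP; split.
  rewrite -[X in (_ <= X)%N](size_map_poly (in_alg K)); apply: dvdp_leq.
    by rewrite map_poly_eq0 -size_poly_gt0 size_PhiQ.
  apply: minPoly_dvdp; last by apply/eqP; exact: horner_alg_PhiQ.
  by apply/polyOver1P; exists PhiQ.
have /polyOver1P[r rE] := minPolyOver 1 zt.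
rewrite rE size_map_poly; apply: dvdp_leq.
  by rewrite -(map_poly_eq0 (in_alg K)) -rE monic_neq0 // monic_minPoly.
by apply: dvd_Cyclotomic; rewrite /horner_alg /horner_morph -rE minPolyxx.
Qed.

Section Embedding.
Variables (C : numFieldType) (z : C).
Hypothesis zP : d.-primitive_root z.

(** An arbitrary polynomial p with x = p(zt) is chosen; [embE] shows that the value p(z) does not
    depend on it. *)
Definition emb (x : K) : C := (map_poly ratr (sval (cid (horner_alg_onto x)))).[z].

Lemma embE p : emb (horner_alg zt p) = (map_poly ratr p).[z].
Proof. by rewrite /emb; case: cid => q /= h; apply: horner_alg_eq. Qed.

Lemma embM : {morph emb : x y / x * y}.
Proof.
move=> x y; have [p ->] := horner_alg_onto x; have [q ->] := horner_alg_onto y.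
by rewrite -rmorphM !embE rmorphM hornerM.
Qed.

Lemma embB : {morph emb : x y / x - y}.
Proof.
move=> x y; have [p ->] := horner_alg_onto x; have [q ->] := horner_alg_onto y.
by rewrite -rmorphB !embE rmorphB hornerD hornerN.
Qed.

Lemma embZ (q : rat) : emb q%:A = ratr q.
Proof. by rewrite -(@horner_algC _ _ zt) embE map_polyC hornerC. Qed.

Lemma emb_zt : emb zt = z.
Proof. by rewrite -[in LHS](@horner_algX _ _ zt) embE map_polyX hornerX. Qed.

Lemma emb1 : emb 1 = 1.
Proof. by rewrite -[1]scale1r embZ rmorph1. Qed.

Lemma cyclotomic_embedding : exists f : {rmorphism K -> C}, f zt = z.
Proof.
pose fA := GRing.isZmodMorphism.Build K C emb embB.
pose fM := GRing.isMonoidMorphism.Build K C emb (conj emb1 embM).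
pose f : {rmorphism K -> C} := HB.pack emb fA fM.
by exists f; exact: emb_zt.
Qed.

End Embedding.
End CyclotomicField.

(** * Elementary inequalities and the complex modulus *)

Lemma le_sum_term (R : numDomainType) (I : finType) (F : I -> R) i :
  (forall j, 0 <= F j) -> F i <= \sum_j F j.
Proof. by move=> h; rewrite (bigD1 i) //= lerDl sumr_ge0. Qed.

Lemma pos_lower (R : realDomainType) (T : eqType) (s : seq T) (e : T -> R) :
  (forall a, 0 < e a) -> exists2 eps, 0 < eps & forall a, a \in s -> eps <= e a.
Proof.
move=> e0; elim: s => [|a s [eps eps0 IH]]; first by exists 1.
exists (Num.min (e a) eps); first by rewrite lt_min e0.
move=> b; rewrite inE => /predU1P[->|/IH h]; first by rewrite ge_min lexx.
by rewrite ge_min h orbT.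
Qed.

Lemma prod_const_size (R : pzSemiRingType) (T : Type) (s : seq T) (M : R) :
  \prod_(a <- s) M = M ^+ size s.
Proof. by elim: s => [|a s IH]; rewrite ?big_nil ?expr0 // big_cons IH exprS. Qed.

Lemma prod_one_small (R : realDomainType) (T : eqType) (s : seq T) (F : T -> R) M dl b :
    b \in s -> 1 <= M -> (forall a, a \in s -> 0 <= F a <= M) -> F b <= dl ->
  \prod_(a <- s) F a <= dl * M ^+ size s.
Proof.
move=> bs M1 hF Fb; have M0 : 0 <= M by apply: le_trans M1.
have /andP[Fb0 _] := hF _ bs.
rewrite (big_rem b) //= ler_pM //.
  by rewrite big_seq prodr_ge0 // => a /mem_rem /hF /andP[].
apply: (@le_trans _ _ (M ^+ (size s).-1)); last by rewrite ler_weXn2l // leq_pred.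
rewrite -(size_rem bs) -prod_const_size.
by rewrite big_seq [leRHS]big_seq ler_prod // => a /mem_rem /hF.
Qed.

Lemma bernoulli_ineq (R : realDomainType) (t : R) k : 0 <= t -> 1 + k%:R * t <= (1 + t) ^+ k.
Proof.
move=> t0; elim: k => [|k IH]; first by rewrite mul0r addr0.
rewrite exprS (le_trans _ (ler_wpM2l _ IH)) ?addr_ge0 // -natr1.
have : 0 <= t * (k%:R * t) by rewrite !mulr_ge0.
lra.
Qed.

(** If u > v > 0, then (u / v)^k outgrows every constant by Bernoulli's inequality; for v = 0 the
    case k = 1 is already absurd. *)
Lemma le_of_pow_bound (R : realType) (u v A B : R) : 0 <= u -> 0 <= v -> 0 < A ->
  (forall k, u ^+ k * A <= B * v ^+ k) -> u <= v.
Proof.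
move=> u0 v0 A0 h; rewrite leNgt; apply/negP => vu.
have [v00|vn] := eqVneq v 0.
  have := h 1%N; rewrite v00 !expr1 mulr0 leNgt; apply/negP/negPn.
  by rewrite mulr_gt0 // -v00.
have vp : 0 < v by rewrite lt_def vn v0.
pose t := u / v - 1.
have t0 : 0 < t by rewrite /t subr_gt0 ltr_pdivlMr // mul1r.
have [k kP] : exists k : nat, B / A / t < k%:R 
  by exists (Num.bound `|B / A / t|); rewrite (le_lt_trans (ler_norm _)) // archi_boundP.
have := h k; rewrite -ler_pdivrMr ?exprn_gt0 // mulrAC -expr_div_n.
have -> : u / v = 1 + t by rewrite /t; ring.
rewrite -ler_pdivlMr // leNgt; apply/negP/negPn.
rewrite (lt_le_trans _ (bernoulli_ineq k (ltW t0))) //.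
by move: kP; rewrite ltr_pdivrMr //; lra.
Qed.

Section ComplexModulus.
Variable R : realType.
Implicit Types x y : R[i].

(** The norm of R[i] takes its values in R[i]; this is the same modulus as an element of R, as
    [absolute_value] expects. *)
Definition nc (x : R[i]) : R := Normc.normc x.

Lemma ncE x : (nc x)%:C%C = `|x|.
Proof. by case: x => a b; rewrite /nc normc_def. Qed.

Lemma nc_abs : absolute_value nc.
Proof.
split.
- by move=> x; rewrite -lecR ncE normr_ge0.
- move=> x; split=> [/(congr1 (real_complex R))|->]; last exact: Normc.normc0.
  by rewrite ncE => /normr0_eq0.
- exact: Normc.normcM.
- exact: le_normcD.
Qed.

Lemma nc_real (r : R) : nc r%:C%C = `|r|.
Proof. by apply: complexI; rewrite ncE normc_def /= expr0n addr0 sqrtr_sqr. Qed.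

Lemma nc_ratr (q : rat) : nc (ratr q) = `|ratr q|.
Proof. by rewrite -(fmorph_rat (real_complex R)) nc_real. Qed.

Lemma nc_conj x : nc x^*%C = nc x.
Proof. by apply: complexI; rewrite !ncE normcJ. Qed.

Lemma nc_sqr x : (nc x ^+ 2)%:C%C = x * x^*%C.
Proof. by rewrite rmorphXn /= ncE sqr_normc. Qed.

Lemma nc_Re x : `|complex.Re x| <= nc x.
Proof. by rewrite -lecR ncE normc_ge_Re. Qed.

Lemma nc_Im x : `|complex.Im x| <= nc x.
Proof.
have := nc_Re (x * 'i%C); rewrite ReiNIm normrN => /le_trans; apply.
rewrite (absM nc_abs) [nc 'i%C](_ : _ = 1) ?mulr1 //.
by rewrite /nc /= expr0n add0r expr1n sqrtr1.
Qed.

Lemma nc_unity_root x n : (0 < n)%N -> x ^+ n = 1 -> nc x = 1.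
Proof.
move=> n0 /(congr1 nc); rewrite (absX nc_abs) (abs1 nc_abs) => /eqP.
by rewrite pexpr_eq1 ?(abs_ge0 nc_abs) // => /eqP.
Qed.

Lemma conj_unity_root x n : (0 < n)%N -> x ^+ n = 1 -> x^*%C = x^-1.
Proof.
move=> n0 xn; have x0 : x != 0.
  by apply/eqP => x0; move/eqP: xn; rewrite x0 expr0n eqn0Ngt n0 eq_sym oner_eq0.
apply: (mulfI x0); rewrite divff // -nc_sqr (nc_unity_root n0 xn) expr1n //.
Qed.

End ComplexModulus.

(** * The archimedean places of a cyclotomic field *)

Section Archimedean.
Variables (R : realType) (K : fieldExtType rat) (iota : {rmorphism K -> algC}).
Variables (d : nat) (zt : K).
Hypothesis ztP : d.-primitive_root zt.
Hypothesis genK : <<1; zt>>%VS = fullv.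
Variables (z : R[i]) (sg : nat -> {rmorphism K -> R[i]}).
Hypothesis zP : d.-primitive_root z.
Hypothesis sgE : forall a, coprime a d -> sg a zt = z ^+ a.

Let d0 : (0 < d)%N := prim_order_gt0 ztP.
Let n := totient d.

Lemma sg_alg a (q : rat) : sg a q%:A = ratr q.
Proof. by rewrite alg_num_field fmorph_rat. Qed.

Definition conj_abs a (x : K) : R := nc (sg a x).

Lemma conj_abs_abs a : absolute_value (conj_abs a).
Proof.
split.
- by move=> x; exact: (abs_ge0 (nc_abs R)).
- move=> x; split.
    by move=> /eqP; rewrite (abs_eq0 (nc_abs R)) fmorph_eq0 => /eqP.
  by move=> ->; rewrite /conj_abs rmorph0 (abs0 (nc_abs R)).
- by move=> x y; rewrite /conj_abs rmorphM (absM (nc_abs R)).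
- by move=> x y; rewrite /conj_abs rmorphD (absD (nc_abs R)).
Qed.

Lemma conj_abs_alg a (q : rat) : conj_abs a q%:A = archimedean_abs R q.
Proof. by rewrite /conj_abs sg_alg nc_ratr. Qed.

Lemma zaX a : (z ^+ a) ^+ d = 1.
Proof. by rewrite exprAC (prim_expr_order zP) expr1n. Qed.

Let I := [seq a <- index_iota 0 d | coprime a d].

Lemma size_I : size I = n.
Proof.
rewrite /I size_filter /n totient_usum /usum -sum1_count //.
Qed.

Lemma mem_I a : (a \in I) = (a < d)%N && coprime a d.
Proof. by rewrite mem_filter mem_index_iota andbC. Qed.

Lemma uniq_I : uniq I.
Proof. exact/filter_uniq/iota_uniq. Qed.

(** The conjugates of p(zt) are the values of p at n distinct points z^a, so the coefficients are
    recovered by the inverse of a Vandermonde matrix. *)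
Lemma coef_bound : exists2 B : R, 0 < B & forall p : {poly rat}, (size p <= n)%N ->
  forall i, `|ratr p`_i| <= B * \sum_(a <- I) conj_abs a (horner_alg zt p).
Proof.
pose v : 'rV[R[i]]_n := \row_(j < n) z ^+ nth 0%N I j.
pose V := Vandermonde n v.
have Vu : V \in unitmx.
  rewrite unitmxE unitfE det_Vandermonde; apply/prodf_neq0 => i _.
  apply/prodf_neq0 => j ij; rewrite !mxE subr_eq0 (eq_prim_root_expr zP).
  have lt k : (k < n)%N -> (nth 0%N I k < d)%N.
    by move=> kn; have := mem_nth 0%N (s := I); rewrite size_I => /(_ k kn);
       rewrite mem_I => /andP[].
  rewrite !modn_small ?lt // nth_uniq ?size_I ?uniq_I //.
  by rewrite gtn_eqF.
pose B := 1 + \sum_i \sum_j nc (invmx V i j).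
have Bij i j : nc (invmx V i j) <= B.
  have h k l : 0 <= nc (invmx V k l) by rewrite (abs_ge0 (nc_abs R)).
  apply: (@le_trans _ _ (\sum_j nc (invmx V i j))); first exact: (le_sum_term (F := fun j => nc (invmx V i j))).
  rewrite /B ler_wpDl //.
  by apply: (le_sum_term (F := fun i => \sum_j nc (invmx V i j))) => k; rewrite sumr_ge0.
have B0 : 0 < B.
  rewrite /B ltr_wpDr // sumr_ge0 // => k _; rewrite sumr_ge0 // => l _.
  by rewrite (abs_ge0 (nc_abs R)).
exists B => // p pn i.
have [ni|ni] := leqP n i.
  rewrite nth_default ?(leq_trans pn) // rmorph0 normr0 mulr_ge0 ?(ltW B0) //.
  by rewrite sumr_ge0 // => a _; rewrite (abs_ge0 (conj_abs_abs a)).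
have E : \row_(i < n) (ratr p`_i : R[i]) =
    (\row_(j < n) sg (nth 0%N I j) (horner_alg zt p)) *m invmx V.
  apply: (canRL (mulmxK Vu)); apply/rowP => j; rewrite !mxE.
  have cj : coprime (nth 0%N I j) d.
    by have := mem_nth 0%N (s := I); rewrite size_I => /(_ j (ltn_ord j)); rewrite mem_I => /andP[].
  rewrite /horner_alg /horner_morph (horner_coef_wide _ (n := n)) ?size_map_poly //.
  rewrite rmorph_sum; apply: eq_bigr => k _; rewrite !mxE rmorphM coef_map.
  by rewrite sg_alg rmorphXn sgE.
have := congr1 (fun M : 'rV_n => nc (M 0 (Ordinal ni))) E.
rewrite !mxE /= nc_ratr => ->.
rewrite (le_trans (abs_sum (nc_abs R) _ _ _)) //.
rewrite mulr_sumr (big_nth 0%N) size_I big_mkord; apply: ler_sum => j _.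
by rewrite !mxE (absM (nc_abs R)) mulrC ler_wpM2r ?(abs_ge0 (nc_abs R)).
Qed.

Variable w : K -> R.
Hypothesis wP : absolute_value w.
Hypothesis wQ : forall q : rat, w q%:A = archimedean_abs R q.

Lemma w_zt : w zt = 1.
Proof.
have /(congr1 w) := prim_expr_order ztP; rewrite (absX wP) (abs1 wP) => /eqP.
by rewrite pexpr_eq1 ?(abs_ge0 wP) // => /eqP.
Qed.

(** As w zt = 1, the triangle inequality bounds w x by the absolute values of the coefficients of x.
    So w is dominated by all the conjugates together; the rest of the section singles out one of
    them. *)
Lemma w_bound : exists2 B : R, 0 < B & forall x, w x <= B * \sum_(a <- I) conj_abs a x.
Proof.
have [B B0 hB] := coef_bound; exists (n%:R * B) => [|x].
  by rewrite mulr_gt0 // ltr0n totient_gt0.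
have [p xE pn] := horner_alg_small iota ztP genK x.
rewrite {1}xE /horner_alg /horner_morph (horner_coef_wide _ (n := n)) ?size_map_poly //.
rewrite (le_trans (abs_sum wP _ _ _)) // -[X in X%:R * _](card_ord n) -sum1_card.
rewrite natr_sum -mulrA mulr_suml; apply: ler_sum => i _; rewrite mul1r.
rewrite coef_map (absM wP) (absX wP) w_zt expr1n mulr1 wQ xE.
exact: hB.
Qed.


(** The conjugates c a of theta are real, so they can be approached by rationals, and c a determines
    z^a up to complex conjugation, that is, as far as [conj_abs] can see. *)
Let theta : K := zt + zt^-1.
Let c a : R := 2 * complex.Re (z ^+ a).

Lemma sg_horner a p : coprime a d -> sg a (horner_alg zt p) = (map_poly ratr p).[z ^+ a].
Proof.
move=> ad; rewrite /horner_alg /horner_morph -(horner_map (sg a)) -map_poly_comp sgE //.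
by congr _.[_]; apply: eq_map_poly => q; rewrite /= sg_alg.
Qed.

Lemma sg_theta a : coprime a d -> sg a theta = (c a)%:C%C.
Proof.
move=> ad; rewrite rmorphD fmorphV sgE // -(conj_unity_root d0 (zaX a)).
by rewrite addcJ /c rmorphM rmorph_nat.
Qed.

Lemma conj_abs_theta a (q : rat) : coprime a d -> conj_abs a (theta - q%:A) = `|c a - ratr q|.
Proof.
move=> ad; rewrite /conj_abs rmorphB sg_alg sg_theta // -(fmorph_rat (real_complex R)) -rmorphB.
exact: nc_real.
Qed.

Lemma c_le2 a : `|c a| <= 2.
Proof.
rewrite /c normrM ger0_norm // -[leRHS]mulr1 ler_wpM2l // (le_trans (nc_Re _)) //.
by rewrite (nc_unity_root d0 (zaX a)).
Qed.

Lemma c_eq a b : coprime a d -> coprime b d -> c a = c b ->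
  z ^+ a = z ^+ b \/ z ^+ a * z ^+ b = 1.
Proof.
move=> ad bd cab.
have za0 k : z ^+ k != 0 by rewrite expf_neq0 // (prim_root_eq0 zP) -lt0n.
have : (z ^+ a - z ^+ b) * (z ^+ a * z ^+ b - 1) = 0.
  have := sg_theta ad; rewrite cab -sg_theta // !rmorphD !fmorphV !sgE // => h.
  have -> : (z ^+ a - z ^+ b) * (z ^+ a * z ^+ b - 1) =
    z ^+ a * z ^+ b * ((z ^+ a + (z ^+ a)^-1) - (z ^+ b + (z ^+ b)^-1)).
    by field; rewrite !za0.
  by rewrite h subrr mulr0.
by move/eqP; rewrite mulf_eq0 !subr_eq0 => /orP[]/eqP; [left|right].
Qed.

Lemma conj_abs_conj a b : coprime a d -> coprime b d -> z ^+ a * z ^+ b = 1 -> conj_abs a =1 conj_abs b.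
Proof.
move=> ad bd h x; have [p ->] := horner_alg_onto genK x.
rewrite /conj_abs !sg_horner //.
have za0 : z ^+ a != 0 by rewrite expf_neq0 // (prim_root_eq0 zP) -lt0n.
have -> : z ^+ b = ((z ^+ a)^*)%C.
  by rewrite (conj_unity_root d0 (zaX a)); apply: (mulfI za0); rewrite h divff.
rewrite -[in LHS]nc_conj; congr nc; rewrite -horner_map -map_poly_comp; congr _.[_].
by apply: eq_map_poly => q; rewrite /= fmorph_rat.
Qed.

Lemma c_inj a b : coprime a d -> coprime b d -> c a = c b -> conj_abs a =1 conj_abs b.
Proof.
move=> ad bd /(c_eq ad bd)[h|]; last exact: conj_abs_conj.
by move=> x; have [p ->] := horner_alg_onto genK x; rewrite /conj_abs !sg_horner // h.
Qed.

Lemma conj_abs_inj a b : coprime a d -> coprime b d -> conj_abs a =1 conj_abs b ->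
  z ^+ a = z ^+ b \/ z ^+ a * z ^+ b = 1.
Proof.
(* Since c a <= 2, the absolute value of c a - 3 is 3 - c a, which determines c a. *)
move=> ad bd /(_ (theta - 3%:A)); rewrite !conj_abs_theta // ratr_nat => h.
apply: c_eq => //; move: h.
have := c_le2 a; have := c_le2 b; rewrite !ler_norml => /andP[_ h1] /andP[_ h2].
rewrite !ltr0_norm; lra.
Qed.

Lemma rat_near (x e : R) : 0 < e -> exists q : rat, `|ratr q - x| < e.
Proof.
move=> e0; have [|q] := @rat_in_itvoo R (x - e) (x + e).
  by rewrite ltrD2l gtrN.
by rewrite in_itv /= -ltr_distlC => h; exists q; rewrite distrC.
Qed.

(* Otherwise the product of theta - q_a over all a, with q_a rational and close
   to c a, is bounded below for w and small at every conjugate, against w_bound. *)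
Lemma near_c : exists2 a, a \in I & forall e : R, 0 < e ->
  exists2 q : rat, `|ratr q - c a| < e & w (theta - q%:A) < e.
Proof.
apply: contrapT => H.
pose Q a (e : R) := 0 < e /\ (a \in I -> forall q : rat, `|ratr q - c a| < e -> e <= w (theta - q%:A)).
have /choice[e eP] : forall a, exists e, Q a e.
  move=> a; have [aI|aI] := boolP (a \in I); last by exists 1; split => //; rewrite (negPf aI).
  apply: contrapT => h; apply: H; exists a => // e e0.
  apply: contrapT => h2; apply: h; exists e; split => // _ q qc.
  by rewrite leNgt; apply/negP => h3; apply: h2; exists q.
have [eps eps0 epsP] := pos_lower I (fun a => (eP a).1).
have [B B0 hB] := w_bound.
(* At each conjugate every factor is at most 5, because |c b - c a| <= 4 and dl <= 1, and n
   conjugates enter [w_bound]. Then dl makes D * dl at most half of the lower bound eps^n. *)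
pose D := B * n%:R * 5 ^+ n.
have D0 : 0 < D by rewrite !mulr_gt0 ?exprn_gt0 // ltr0n totient_gt0.
pose dl := Num.min (Num.min eps 1) (eps ^+ n / (2 * D)).
have e1 : 0 < eps ^+ n / (2 * D) by rewrite divr_gt0 ?exprn_gt0 // mulr_gt0.
have dl0 : 0 < dl by rewrite !lt_min eps0 ltr01 e1.
have /choice[q qP] := fun a => rat_near (c a) dl0.
pose P := \prod_(a <- I) (theta - (q a)%:A).
have lo : eps ^+ n <= w P.
  rewrite /P (abs_prod wP) -size_I -prod_const_size.
  rewrite big_seq [leRHS]big_seq ler_prod // => a aI; rewrite (ltW eps0) /=.
  rewrite (le_trans (epsP _ aI)) // (eP a).2 // (lt_le_trans (qP a)) //.
  by rewrite (le_trans _ (epsP _ aI)) // /dl !ge_min lexx.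
have hi b : b \in I -> conj_abs b P <= dl * 5 ^+ n.
  move=> bI; have bd : coprime b d by move: bI; rewrite mem_I => /andP[].
  rewrite /P (abs_prod (conj_abs_abs b)) -size_I; apply: (prod_one_small bI).
  - by rewrite ler1n.
  - move=> a _; rewrite (abs_ge0 (conj_abs_abs b)) conj_abs_theta //.
    have -> : c b - ratr (q a) = c b - c a - (ratr (q a) - c a) by ring.
    have d1 : dl <= 1 by rewrite /dl !ge_min lexx orbT.
    have := ler_normB (c b - c a) (ratr (q a) - c a).
    have := ler_normB (c b) (c a).
    have := qP a; have := c_le2 a; have := c_le2 b; rewrite /=; lra.
  - by rewrite conj_abs_theta // distrC ltW.
have : eps ^+ n <= D * dl.
  apply: (le_trans lo); apply: (le_trans (hB P)).
  rewrite /D -!mulrA ler_pM2l // [5 ^+ n * _]mulrC -size_I.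
  rewrite -[X in X%:R]count_predT -sum1_count natr_sum mulr_suml.
  rewrite big_seq [leRHS]big_seq; apply: ler_sum => b bI; rewrite mul1r.
  by rewrite size_I; exact: hi.
apply/negP; rewrite -ltNge.
have : dl <= eps ^+ n / (2 * D) by rewrite /dl ge_min lexx orbT.
rewrite -(ler_pM2l D0) => /le_lt_trans; apply.
have -> : D * (eps ^+ n / (2 * D)) = eps ^+ n / 2 by field; rewrite gt_eqF.
by rewrite ltr_pdivrMr // mulr_natr mulr2n ltrDl exprn_gt0.
Qed.

(* In w_bound for x^k times a product of factors theta - q_b, small at the
   conjugates b <> a and large for w, only the term of a survives; let k grow. *)
Lemma arch_place_le : exists2 a, a \in I & forall x, w x <= conj_abs a x.
Proof.
have [a aI aP] := near_c; exists a => // x.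
have ad : coprime a d by move: aI; rewrite mem_I => /andP[].
pose T := [seq b <- I | c b != c a].
have TI b : b \in T -> [/\ b \in I, c b != c a & coprime b d].
  by rewrite mem_filter => /andP[-> bI]; split => //; move: bI; rewrite mem_I => /andP[].
have [g g0 gP] : exists2 g, 0 < g & forall b, b \in T -> g <= `|c b - c a|.
  have [|g g0 gP] := @pos_lower R _ T (fun b => if c b == c a then 1 else `|c b - c a|).
    by move=> b; case: eqVneq => // h; rewrite normr_gt0 subr_eq0.
  by exists g => // b bT; have := gP b bT; have [_ /negPf -> _] := TI b bT.
have [B B0 hB] := w_bound.
have M k : 0 <= conj_abs k x by rewrite (abs_ge0 (conj_abs_abs k)).
have key k : w x ^+ k * (g / 2) ^+ size T <= B * n%:R * 5 ^+ size T * conj_abs a x ^+ k.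
  apply/ler_addgt0Pr => e e0.
  pose S := 1 + B * 5 ^+ size T * \sum_(b <- I) conj_abs b x ^+ k.
  have S0 : 0 < S.
    by rewrite /S ltr_wpDr // !mulr_ge0 ?exprn_ge0 ?(ltW B0) // sumr_ge0 // => b _; rewrite exprn_ge0.
  (* With the g / 8 used for q0 below, w (theta - q b) is at least g - g/4 - g/8 - g/8 = g/2 for b
     in T. The bound e / S makes the terms that carry dl contribute at most e. *)
  pose dl := Num.min (Num.min (g / 4) 1) (e / S).
  have dl0 : 0 < dl by rewrite !lt_min ltr01 !divr_gt0.
  have d1 : dl <= 1 by rewrite /dl !ge_min lexx orbT.
  have dg : dl <= g / 4 by rewrite /dl !ge_min lexx.
  have dS : dl <= e / S by rewrite /dl !ge_min lexx orbT.
  have /choice[q qP] := fun b => rat_near (c b) dl0.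
  have g8 : 0 < g / 8 by rewrite divr_gt0.
  have [q0 q0c q0w] := aP _ g8.
  pose y := \prod_(b <- T) (theta - (q b)%:A).
  have ylo : (g / 2) ^+ size T <= w y.
    rewrite /y (abs_prod wP) -prod_const_size.
    rewrite big_seq [leRHS]big_seq ler_prod // => b bT; rewrite divr_ge0 ?(ltW g0) //=.
    have := absB wP (theta - (q b)%:A) (theta - q0%:A).
    have -> : theta - (q b)%:A - (theta - q0%:A) = (q0 - q b)%:A :> K.
      by rewrite scalerBl; ring.
    rewrite wQ /archimedean_abs rmorphB /= => h.
    have := gP _ bT; have := qP b; move: h q0c q0w.
    have -> : c b - c a = (ratr (q0) - c a) - (ratr (q b) - c b) - (ratr q0 - ratr (q b)) by ring.
    set u := ratr q0 - c a; set v := ratr (q b) - c b; set t := ratr q0 - ratr (q b).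
    have := ler_normB (u - v) t; have := ler_normB u v; lra.
  have yb b : coprime b d -> conj_abs b y <= 5 ^+ size T.
    move=> bd; rewrite /y (abs_prod (conj_abs_abs b)) -prod_const_size.
    apply: ler_prod => k' _; rewrite (abs_ge0 (conj_abs_abs b)) conj_abs_theta //=.
    have -> : c b - ratr (q k') = c b - c k' - (ratr (q k') - c k') by ring.
    have := ler_normB (c b - c k') (ratr (q k') - c k').
    have := ler_normB (c b) (c k').
    have := qP k'; have := c_le2 k'; have := c_le2 b; lra.
  have ybT b : b \in T -> conj_abs b y <= dl * 5 ^+ size T.
    move=> bT; have [_ _ bd] := TI b bT.
    rewrite /y (abs_prod (conj_abs_abs b)); apply: (prod_one_small bT).
    - by rewrite ler1n.
    - move=> k' _; rewrite (abs_ge0 (conj_abs_abs b)) conj_abs_theta //=.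
      have -> : c b - ratr (q k') = c b - c k' - (ratr (q k') - c k') by ring.
      have := ler_normB (c b - c k') (ratr (q k') - c k').
      have := ler_normB (c b) (c k').
      have := qP k'; have := c_le2 k'; have := c_le2 b; lra.
    - by rewrite conj_abs_theta // distrC ltW.
  apply: (@le_trans _ _ (w (x ^+ k * y))).
    by rewrite (absM wP) (absX wP) ler_wpM2l // exprn_ge0 // (abs_ge0 wP).
  apply: (le_trans (hB _)).
  have term b : b \in I -> conj_abs b (x ^+ k * y) <=
      5 ^+ size T * conj_abs a x ^+ k + dl * 5 ^+ size T * conj_abs b x ^+ k.
    move=> bI; have bd : coprime b d by move: bI; rewrite mem_I => /andP[].
    rewrite (absM (conj_abs_abs b)) (absX (conj_abs_abs b)).
    have [cb|cb] := eqVneq (c b) (c a).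
      rewrite (c_inj bd ad cb) ler_wpDr ?mulr_ge0 ?exprn_ge0 ?(ltW dl0) //.
      by rewrite mulrC ler_wpM2r ?exprn_ge0 //; have := yb b bd; rewrite (c_inj bd ad cb).
    rewrite ler_wpDl ?mulr_ge0 ?exprn_ge0 // mulrC ler_wpM2r ?exprn_ge0 //.
    by apply: ybT; rewrite mem_filter cb.
  apply: (@le_trans _ _ (B * \sum_(b <- I) (5 ^+ size T * conj_abs a x ^+ k + dl * 5 ^+ size T * conj_abs b x ^+ k))).
    rewrite ler_pM2l // big_seq [leRHS]big_seq; exact: ler_sum.
  rewrite big_split /= mulrDr lerD //.
    rewrite big_const_seq count_predT size_I -Monoid.iteropE.
    have -> : iterop n +%R (5 ^+ size T * conj_abs a x ^+ k) 0 = n%:R * (5 ^+ size T * conj_abs a x ^+ k).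
      by rewrite mulr_natl.
    by rewrite !mulrA.
  rewrite -mulr_sumr.
  apply: (@le_trans _ _ (dl * S)).
    rewrite /S mulrDr ler_wpDl ?mulr1 ?(ltW dl0) // mulrA mulrA [B * _]mulrC -!mulrA.
    by rewrite ler_pM2l // mulrCA !mulrA lexx.
  by rewrite -ler_pdivlMr.
apply: (le_of_pow_bound _ _ _ key) => //; first by rewrite (abs_ge0 wP).
by rewrite exprn_gt0 // divr_gt0.
Qed.

Lemma arch_place : exists2 a, a \in I & w = conj_abs a.
Proof.
have [a aI h] := arch_place_le; exists a => //; apply/funext => x.
apply/eqP; rewrite eq_le h /=; have [->|x0] := eqVneq x 0.
  by rewrite (abs0 wP) (abs0 (conj_abs_abs a)).
(* An inequality between two absolute values turns around when applied to the inverse. *)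
have := h x^-1; rewrite (absV wP) (absV (conj_abs_abs a)).
by rewrite lef_pV2 // posrE ?(abs_gt0 wP) ?(abs_gt0 (conj_abs_abs a)).
Qed.

End Archimedean.

Section ArchimedeanSum.
Variables (R : realType) (K : fieldExtType rat) (iota : {rmorphism K -> algC}).
Variables (d : nat) (zt : K).
Hypothesis ztP : d.-primitive_root zt.
Hypothesis genK : <<1; zt>>%VS = fullv.
Variables (z : R[i]) (sg : nat -> {rmorphism K -> R[i]}).
Hypothesis zP : d.-primitive_root z.
Hypothesis sgE : forall a, coprime a d -> sg a zt = z ^+ a.
Hypothesis d3 : (3 <= d)%N.

Lemma archimedean_abs_abs : absolute_value (archimedean_abs R).
Proof.
rewrite /archimedean_abs; split=> [x|x|x y|x y]; first exact: normr_ge0.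
- split=> [/eqP|->]; last by rewrite rmorph0 normr0.
  by rewrite normr_eq0 fmorph_eq0 => /eqP.
- by rewrite rmorphM normrM.
- by rewrite rmorphD ler_normD.
Qed.

Lemma Im_neq0 a : coprime a d -> complex.Im (z ^+ a) != 0.
Proof.
move=> ad; apply/eqP => im0.
have zc : (z ^+ a)^*%C = z ^+ a.
  by move: im0; case: (z ^+ a) => x y /= ->; rewrite oppr0.
have d0 : (0 < d)%N by lia.
have := nc_sqr (z ^+ a); rewrite (nc_unity_root d0 (zaX zP a)) expr1n zc -exprD.
move=> /esym/eqP; rewrite -(prim_order_dvd zP) addnn -mul2n Gauss_dvdl 1?coprime_sym //.
by move/dvdn_leq => /(_ isT); lia.
Qed.

(** A non-real t and 1 form a basis of the complex numbers over R. The bound on the coordinates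
    turns Cauchy or null complex sequences into Cauchy or null real ones. *)
Lemma complex_coords (t : R[i]) : complex.Im t != 0 -> exists B : R, exists (c0 c1 : R[i] -> R),
  0 < B /\ [/\ forall s, s = (c0 s)%:C%C + (c1 s)%:C%C * t,
   forall s, `|c0 s| <= B * nc s /\ `|c1 s| <= B * nc s,
   forall x y x' y', x%:C%C + y%:C%C * t = x'%:C%C + y'%:C%C * t -> x = x' /\ y = y',
   {morph c0 : x y / x - y} & {morph c1 : x y / x - y}].
Proof.
case: t => al be /= be0.
pose c1 (s : R[i]) := complex.Im s / be.
pose c0 (s : R[i]) := complex.Re s - al * c1 s.
exists (1 + (1 + `|al|) * `|be|^-1), c0, c1.
have b0 : 0 <= `|be|^-1 by rewrite invr_ge0.
have c1le s : `|c1 s| <= `|be|^-1 * nc s.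
  by rewrite /c1 normrM normfV mulrC ler_wpM2l // nc_Im.
have h0 : 0 <= (1 + `|al|) * `|be|^-1 by rewrite mulr_ge0 // addr_ge0.
split; first by rewrite ltr_wpDr.
split.
- move=> [x y]; rewrite /c0 /c1; apply/eqP; rewrite eq_complex /=.
  by apply/andP; split; apply/eqP; field.
- move=> s; have h2 := nc_Re s; have h1 := c1le s; have n0 := abs_ge0 (nc_abs R) s.
  rewrite /c0; set c := c1 s in h1 *; set n := nc s in h1 h2 n0 *.
  have hn : 0 <= `|be|^-1 * n by rewrite mulr_ge0.
  have ha : `|al| * `|c| <= `|al| * (`|be|^-1 * n) by rewrite ler_wpM2l.
  have hq : 0 <= `|al| * (`|be|^-1 * n) by rewrite mulr_ge0.
  rewrite !mulrDl !mul1r -!mulrA; split; last by lra.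
  by rewrite (le_trans (ler_normB _ _)) // normrM; lra.
- move=> x y x' y' /eqP; rewrite eq_complex /= !mul0r !addr0 !subr0 !add0r.
  by move=> /andP[/eqP h1 /eqP /(mulIf be0) yE]; move: h1; rewrite yE => /addIr.
- by move=> [x y] [x' y'] /=; rewrite /c0 /c1 /=; field.
- by move=> [x y] [x' y'] /=; rewrite /c1 /=; field.
Qed.

(** The basis is 1, zt, since z^a is not real. The real coordinates of the n-th term of a Cauchy
    sequence are replaced by rationals at distance less than 1 / (n + 1), which changes it by a null
    sequence. *)
Lemma arch_local_degree a : coprime a d -> local_degree (archimedean_abs R) (conj_abs sg a) = 2%N.
Proof.
move=> ad; apply: local_degree_unique.
- exact: archimedean_abs_abs.
- exact: conj_abs_abs.
- exact: conj_abs_alg.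
have [B [c0 [c1 [B0 [cE cB cU c0B c1B]]]]] := complex_coords (Im_neq0 ad).
exists (fun j _ => if j == 0 then 1 else zt); split.
- by move=> j; apply: cauchy_cst; apply: conj_abs_abs.
- move=> x xC.
  have approx (c : R[i] -> R) : {morph c : x y / x - y} -> (forall s, `|c s| <= B * nc s) ->
      exists2 q : nat -> rat, cauchy_seq (archimedean_abs R) q &
        forall n, `|ratr (q n) - c (sg a (x n))| < n.+1%:R^-1.
    move=> cM cle.
    have /choice[q qP] := fun n => rat_near (c (sg a (x n))) (e := n.+1%:R^-1) ltac:(by rewrite invr_gt0).
    exists q => // e e0.
    have [|n0 h0] := xC (e / 2 / B); first by rewrite !divr_gt0.
    pose n1 := Num.bound (4 / e).
    have n1P k : (n1 <= k)%N -> k.+1%:R^-1 < e / 4.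
      move=> nk; rewrite -[e / 4]invrK ltf_pV2 ?posrE ?invr_gt0 ?divr_gt0 // invf_div.
      have : 4 / e < n1%:R by rewrite archi_boundP // divr_ge0 // ltW.
      by move/lt_le_trans; apply; rewrite ler_nat; lia.
    exists (maxn n0 n1) => m k; rewrite !geq_max => /andP[m0 m1] /andP[k0 k1].
    rewrite /archimedean_abs rmorphB.
    have := h0 _ _ m0 k0; rewrite ltr_pdivlMr // /conj_abs rmorphB => h.
    have := cle (sg a (x m) - sg a (x k)); rewrite cM mulrC => h2.
    have := lt_trans (qP m) (n1P _ m1); have := lt_trans (qP k) (n1P _ k1).
    move: h h2; set N := nc _; set X := c (sg a (x m)); set Y := c (sg a (x k)).
    set Q := ratr (q m); set P := ratr (q k).
    move=> h h2 h3 h4.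
    have -> : Q - P = (Q - X) - (P - Y) + (X - Y) by ring.
    have := ler_normD ((Q - X) - (P - Y)) (X - Y).
    have := ler_normB (Q - X) (P - Y); lra.
  have [q0 q0C q0P] := approx c0 c0B (fun s => (cB s).1).
  have [q1 q1C q1P] := approx c1 c1B (fun s => (cB s).2).
  exists (fun j => if j == 0 then q0 else q1); first by move=> j; case: ifP.
  move=> e e0; exists (Num.bound (2 / e)) => n nn.
  have ne : n.+1%:R^-1 < e / 2.
    rewrite -[e / 2]invrK ltf_pV2 ?posrE ?invr_gt0 ?divr_gt0 // invf_div.
    have : 2 / e < (Num.bound (2 / e))%:R by rewrite archi_boundP // divr_ge0 // ltW.
    by move/lt_le_trans; apply; rewrite ler_nat; lia.
  rewrite !big_ord_recl big_ord0 /= addr0 -(mulr_algl (q1 n) zt).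
  rewrite /conj_abs rmorphB rmorphD rmorphM !sg_alg sgE //.
  rewrite [X in nc (X - _)](cE (sg a (x n))).
  set t := z ^+ a; set X := c0 _; set Y := c1 _.
  rewrite -!(fmorph_rat (real_complex R)).
  have -> : X%:C%C + Y%:C%C * t - ((ratr (q0 n))%:C%C + (ratr (q1 n))%:C%C * t) =
     (X - ratr (q0 n))%:C%C + (Y - ratr (q1 n))%:C%C * t.
    by rewrite !rmorphB; ring.
  rewrite (le_lt_trans (absD (nc_abs R) _ _)) // (absM (nc_abs R)) !nc_real.
  rewrite (nc_unity_root _ (zaX zP a)) ?mulr1; last by lia.
  have := lt_trans (q0P n) ne; have := lt_trans (q1P n) ne.
  rewrite distrC -/Y => h1; rewrite distrC -/X => h0; lra.
- move=> c cC cN j e e0.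
  have [|n0 h0] := cN (e / B); first by rewrite divr_gt0.
  exists n0 => n nn; have := h0 n nn; rewrite ltr_pdivlMr //; apply: le_lt_trans.
  rewrite !big_ord_recl big_ord0 /= addr0 -(mulr_algl _ zt).
  rewrite /conj_abs rmorphD rmorphM !sg_alg sgE //.
  set t := z ^+ a; rewrite -!(fmorph_rat (real_complex R)).
  set s := (_ + _ : R[i]).
  have [s0 s1] : c0 s = ratr (c ord0 n) /\ c1 s = ratr (c (lift ord0 ord0) n).
    by apply: cU; rewrite -cE.
  have := cB s; rewrite s0 s1 => -[h1 h2]; rewrite mulrC.
  by case: (unliftP ord0 j) => [k ->|->] //; rewrite (ord1 k).
Qed.

Let w_ a : K -> R := conj_abs sg a.
(** One exponent from each pair a, d - a of complex conjugate embeddings; 2 a = d with a prime to d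
    would force d = 2. *)
Let H := [seq a <- index_iota 0 d | coprime a d && (a.*2 < d)%N].

Lemma coprime_subl a : (a < d)%N -> coprime a d -> coprime (d - a) d.
Proof.
move=> ad; rewrite /coprime -{1 3}(subnK (ltnW ad)) gcdnDl gcdnDr.
by rewrite gcdnC.
Qed.

Lemma places_above_arch :
  (places_above (archimedean_abs R) : set (K -> R)) = [set` [seq w_ a | a <- H]].
Proof.
apply/seteqP; split=> [w [wP wQ]|w /=].
  have [a aI wE] := arch_place iota ztP genK zP sgE wP wQ.
  move: aI; rewrite mem_filter mem_index_iota /= => /andP[ad ald].
  have a2d : a.*2 != d.
    apply/eqP => h; move: ad; rewrite /coprime -h -mul2n gcdnMl => /eqP a1; lia.
  case: (ltnP a.*2 d) => ha.
    by apply/mapP; exists a; rewrite // mem_filter mem_index_iota ad ha ald.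
  have bd := coprime_subl ald ad.
  apply/mapP; exists (d - a)%N.
    rewrite mem_filter mem_index_iota bd /=; lia.
  rewrite wE; apply/funext; apply: (conj_abs_conj ztP genK zP sgE) => //.
  by rewrite -exprD subnKC ?(ltnW ald) // (prim_expr_order zP).
move=> /mapP[a _ ->]; split; first exact: conj_abs_abs.
exact: conj_abs_alg.
Qed.

Lemma uniq_places : uniq [seq w_ a | a <- H].
Proof.
rewrite map_inj_in_uniq ?filter_uniq ?iota_uniq // => a b.
rewrite !mem_filter !mem_index_iota => /andP[/andP[ad a2] /andP[_ al]].
move=> /andP[/andP[bd b2] /andP[_ bl]] h.
have [/eqP|] := conj_abs_inj ztP zP sgE ad bd (fun x => congr1 (fun f => f x) h).
  by rewrite (eq_prim_root_expr zP) !modn_small // => /eqP.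
rewrite -exprD => /eqP; rewrite -(prim_order_dvd zP) => /dvdn_leq dl.
case: (posnP (a + b)) => [|/dl]; lia.
Qed.

(** A complex place has local degree 2 and comes from the two exponents a and d - a, so weight 2 on
    half of the units is weight 1 on all of them. *)
Lemma sum_places_above_arch (L : (K -> R) -> R) :
  \sum_(w \in (places_above (archimedean_abs R) : set (K -> R)))
    (local_degree (archimedean_abs R) w)%:R / (\dim {:K})%:R * L w =
  (totient d)%:R^-1 * usum d (fun a => L (w_ a)).
Proof.
rewrite places_above_arch -fsbig_seq ?uniq_places // big_map.
rewrite (dim_cyclotomic iota ztP genK) /usum big_filter.
transitivity (\sum_(0 <= a < d | coprime a d && (a.*2 < d)%N) (totient d)%:R^-1 * (L (w_ a) *+ 2)).
  apply: eq_bigr => a /andP[ad _]; rewrite arch_local_degree // -mulr_natl; ring.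
rewrite -mulr_sumr; congr (_ * _).
rewrite [RHS](bigID (fun a => a.*2 < d)%N) /=.
under eq_bigr do rewrite mulr2n.
rewrite big_split /=; congr (_ + _).
have c0 : coprime 0 d = false by rewrite /coprime gcd0n; apply/eqP; lia.
have d0 : (0 < d)%N by lia.
rewrite !(big_ltn_cond d0) /= c0 /= [RHS]big_nat_rev /=.
rewrite big_nat_cond [RHS]big_nat_cond.
apply: eq_big => [a|a /andP[/andP[a0 ad] /andP[ca _]]].
  case: (boolP (0 < a < d)%N) => //= /andP[a0 ad].
  rewrite add1n subSS; have [ca|ca] := boolP (coprime a d).
    rewrite coprime_subl //=; apply/idP/idP; first by lia.
    move=> h; have a2d : a.*2 != d.
      by apply/eqP => h'; move: ca; rewrite /coprime -h' -mul2n gcdnMl => /eqP; lia.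
    lia.
  suff /negPf-> : ~~ coprime (d - a) d by [].
  by apply: contra ca => /(coprime_subl _); rewrite subKn ?(ltnW ad) //; apply; lia.
congr (L _); apply/funext => x; rewrite add1n subSS.
apply: (conj_abs_conj ztP genK zP sgE) => //; first exact: coprime_subl.
by rewrite -exprD subnKC ?(ltnW ad) // (prim_expr_order zP).
Qed.

End ArchimedeanSum.

(** * The non-archimedean places of a cyclotomic field *)

Lemma le_of_pow_linear_bound (R : realType) (u v : R) : 0 <= u -> 0 <= v ->
  (forall k, u ^+ k <= k.+1%:R * v ^+ k) -> u <= v.
Proof.
move=> u0 v0 h; rewrite leNgt; apply/negP => vu.
have [v00|vn] := eqVneq v 0.
  have := h 1%N; rewrite v00 !expr1 mulr0 leNgt; apply/negP/negPn.
  by rewrite -v00.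
have vp : 0 < v by rewrite lt_def vn v0.
pose t := u / v - 1.
have t0 : 0 < t by rewrite /t subr_gt0 ltr_pdivlMr // mul1r.
(* At the exponent 2k the squared Bernoulli bound (1 + k t)^2 contains k^2 t^2 > 2 k, so it beats
   the linear factor 2k + 1. *)
have [k kP] : exists k : nat, 2 / t ^+ 2 < k%:R.
  by exists (Num.bound `|2 / t ^+ 2|); rewrite (le_lt_trans (ler_norm _)) // archi_boundP.
have := h (k * 2)%N; rewrite -ler_pdivrMr ?exprn_gt0 // -expr_div_n.
have -> : u / v = 1 + t by rewrite /t; ring.
rewrite leNgt; apply/negP/negPn; rewrite exprM.
apply: (@lt_le_trans _ _ ((1 + k%:R * t) ^+ 2)); last first.
  have b := bernoulli_ineq k (ltW t0).
  have c0 : 0 <= 1 + k%:R * t by rewrite addr_ge0 // mulr_ge0 // ltW.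
  by apply: lerXn2r => //; rewrite nnegrE // (le_trans c0).
move: kP; rewrite ltr_pdivrMr ?exprn_gt0 // => kP.
have k0 : (0 < k)%N by case: k kP {h} => //; rewrite mul0r ltrn0.
have k1 : 1 <= k%:R :> R by rewrite ler1n.
rewrite -addn1 natrD natrM.
have : k%:R * 2 < k%:R * (k%:R * t ^+ 2) by rewrite ltr_pM2l // ltr0n.
have : 0 <= k%:R * t by rewrite mulr_ge0 // ltW.
set K := k%:R; nra.
Qed.

Section Ultrametric.
Variables (R : realType) (K : fieldType) (w : K -> R).
Hypothesis wP : absolute_value w.
Hypothesis w_nat : forall m : nat, w m%:R <= 1.

(** The binomial expansion of (x + y)^k has k + 1 terms, each at most the k-th power of the maximum
    because binomial coefficients have absolute value at most 1; the factor k + 1 is harmless in the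
    limit. *)
Lemma ultrametric x y : w (x + y) <= Num.max (w x) (w y).
Proof.
set M := Num.max _ _; have M0 : 0 <= M by rewrite le_max (abs_ge0 wP).
apply: le_of_pow_linear_bound => //; first exact: (abs_ge0 wP).
move=> k; rewrite -(absX wP) exprDn (le_trans (abs_sum wP _ _ _)) //.
rewrite mulr_natl -[X in _ *+ X]card_ord -sumr_const; apply: ler_sum => i _.
have ik : (i <= k)%N by rewrite -ltnS.
have -> : M ^+ k = 1 * (M ^+ (k - i) * M ^+ i) by rewrite mul1r -exprD subnK.
rewrite -mulr_natl (absM wP) ler_pM ?(abs_ge0 wP) //.
have Mx : w x <= M by rewrite le_max lexx.
have My : w y <= M by rewrite le_max lexx orbT.
rewrite (absM wP) !(absX wP) ler_pM ?exprn_ge0 ?(abs_ge0 wP) //.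
  by apply: lerXn2r; rewrite ?nnegrE ?(abs_ge0 wP).
by apply: lerXn2r; rewrite ?nnegrE ?(abs_ge0 wP).
Qed.

Lemma ultrametric_sum (I : Type) (r : seq I) (P : pred I) (F : I -> K) B : 0 <= B ->
  (forall i, P i -> w (F i) <= B) -> w (\sum_(i <- r | P i) F i) <= B.
Proof.
move=> B0 h; elim/big_ind: _ => //; first by rewrite (abs0 wP).
by move=> x y hx hy; rewrite (le_trans (ultrametric _ _)) // ge_max hx.
Qed.

(** Nonzero terms of pairwise distinct absolute values cannot cancel: the largest one dominates
    strictly. *)
Lemma ultrametric_max_term (I : finType) (F : I -> K) :
  (forall i j, w (F i) = w (F j) -> w (F i) != 0 -> i = j) ->
  forall i, w (F i) <= w (\sum_i F i).
Proof.
move=> h i; have [j _ jmax] := @Order.TotalTheory.arg_maxP _ _ _ i xpredT (fun i => w (F i)) isT.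
have {}jmax k : w (F k) <= w (F j) := jmax k isT.
apply: (le_trans (jmax i)).
have [->|j0] := eqVneq (w (F j)) 0; first exact: (abs_ge0 wP).
have jpos : 0 < w (F j) by rewrite lt_def j0 (abs_ge0 wP).
have lt : w (\sum_(k | k != j) F k) < w (F j).
  elim/big_ind: _ => [|x y hx hy|k kj]; first by rewrite (abs0 wP).
    by rewrite (le_lt_trans (ultrametric _ _)) // gt_max hx.
  rewrite lt_def jmax andbT; apply: contra kj => /eqP e.
  by apply/eqP/h; rewrite -?e.
rewrite (bigD1 j) //=; set S := \sum_(k | _) _ in lt *.
have := ultrametric (F j + S) (- S); rewrite addrK (absN wP) le_max.
by rewrite [X in _ || X]leNgt lt orbF.
Qed.

Lemma abs_root1 z n : (0 < n)%N -> z ^+ n = 1 -> w z = 1.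
Proof.
move=> n0 /(congr1 w); rewrite (absX wP) (abs1 wP) => /eqP.
by rewrite pexpr_eq1 ?(abs_ge0 wP) // => /eqP.
Qed.

Lemma abs_1subX z a : w z = 1 -> w (1 - z ^+ a) <= w (1 - z).
Proof.
move=> z1; have -> : 1 - z ^+ a = (1 - z) * \sum_(i < a) z ^+ i.
  by rewrite -opprB subrX1 -mulNr opprB.
rewrite (absM wP) -[leRHS]mulr1 ler_wpM2l ?(abs_ge0 wP) //.
by apply: ultrametric_sum => // i _; rewrite (absX wP) z1 expr1n.
Qed.

End Ultrametric.

Section PAdic.
Variables (R : realType) (K : fieldExtType rat) (iota : {rmorphism K -> algC}).
Variables (d : nat) (zt : K).
Hypothesis ztP : d.-primitive_root zt.
Hypothesis genK : <<1; zt>>%VS = fullv.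
Hypothesis d1 : (1 < d)%N.
Variable p : nat.
Hypothesis pp : prime p.

Let n := totient d.
Let n0 : (0 < n)%N. Proof. by rewrite totient_gt0; lia. Qed.

Lemma padic_abs_nat m : padic_abs R p m%:R = if m == 0%N then 0 else p%:R ^- logn p m.
Proof.
rewrite /padic_abs pnatr_eq0; case: eqP => // _.
have -> : m%:R = (m%:Z)%:Q :> rat by [].
by rewrite numq_int denq_int /= logn1 sub0r exprnN.
Qed.

Section OnePlace.
Variable w : K -> R.
Hypothesis wP : absolute_value w.
Hypothesis wQ : forall q : rat, w q%:A = padic_abs R p q.

Lemma w_natE m : w m%:R = padic_abs R p m%:R.
Proof. by rewrite -wQ scaler_nat. Qed.

Lemma w_nat_le1 m : w m%:R <= 1.
Proof.
rewrite w_natE padic_abs_nat; case: ifP => // _.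
by rewrite invf_le1 ?exprn_gt0 ?ltr0n ?prime_gt0 // exprn_ege1 // ler1n prime_gt0.
Qed.

Lemma vP : absolute_value (padic_abs R p).
Proof.
split=> [x|x|x y|x y]; rewrite -!wQ.
- exact: (abs_ge0 wP).
- split=> [/eqP|->]; last by rewrite scale0r (abs0 wP).
  by rewrite (abs_eq0 wP) scaler_eq0 oner_eq0 orbF => /eqP.
- by rewrite -(absM wP) -scalerAl mul1r scalerA.
- by rewrite scalerDl (absD wP).
Qed.

Lemma w_zt1 : w zt = 1.
Proof. exact: (abs_root1 wP (ltnW d1) (prim_expr_order ztP)). Qed.

(** As a is invertible modulo d, zt is in turn a power of zt^a, so each of the two numbers is a
    multiple of the other by a sum of roots of unity. *)
Lemma w_1subX_coprime a : coprime a d -> w (1 - zt ^+ a) = w (1 - zt).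
Proof.
move=> ad; apply/eqP; rewrite eq_le (abs_1subX wP w_nat_le1) ?w_zt1 //=.
have a0 : (0 < a)%N by case: a ad => //; rewrite /coprime gcd0n => /eqP; lia.
have [b [k kE]] : exists b k, (a * b = k * d + 1)%N.
  by case: (egcdnP d a0) => b k; rewrite (eqP ad) => kE _; exists b, k; rewrite mulnC.
have {1}-> : zt = (zt ^+ a) ^+ b.
  by rewrite -exprM kE exprD mulnC exprM (prim_expr_order ztP) expr1n mul1r expr1.
by apply: (abs_1subX wP w_nat_le1); rewrite (absX wP) w_zt1 expr1n.
Qed.

(** The n factors of the product in [prod_coprime_prim_root] have the same absolute value, so w (1 -
    zt)^n is the absolute value of 1 or of a prime q; it differs from 1 only for q = p. *)
Lemma w_1sub : w (1 - zt) = 1 \/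
  (exists k, d = (p ^ k.+1)%N) /\ w (1 - zt) ^+ n = p%:R^-1.
Proof.
have [q qE qP] := prod_coprime_prim_root d1 ztP.
have E : w (1 - zt) ^+ n = w q%:R.
  rewrite -qE (abs_prod wP) (eq_bigr (fun=> w (1 - zt))); last first.
    by move=> a ad; exact: w_1subX_coprime.
  by rewrite -big_filter prod_const_size /n totient_usum /usum sum1_count size_filter.
case: qP => [q1|[qp [k dE]]].
  left; move/eqP: E; rewrite q1 (abs1 wP) pexpr_eq1 ?(abs_ge0 wP) //.
  by move/eqP.
move: E; rewrite w_natE padic_abs_nat ifF; last by apply/eqP; have := prime_gt0 qp; lia.
rewrite logn_prime //; case: eqVneq => [pq|_] /= E.
  by right; split; [exists k; rewrite pq|rewrite E expr1].
left; move/eqP: E; rewrite expr0 invr1 pexpr_eq1 ?(abs_ge0 wP) //.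
by move/eqP.
Qed.

Lemma wZ q x : w (q *: x) = padic_abs R p q * w x.
Proof. by rewrite -[q *: x]mulr_algl (absM wP) wQ. Qed.

Hypothesis w_pi : w (1 - zt) ^+ n = p%:R^-1.

Lemma w_pi_gt0 : 0 < w (1 - zt).
Proof.
rewrite (abs_gt0 wP); apply/eqP => h; move: w_pi; rewrite h (abs0 wP) expr0n gtn_eqF //.
by move=> /esym/eqP; rewrite invr_eq0 pnatr_eq0 => /eqP p0; have := prime_gt0 pp; lia.
Qed.

(** Total ramification: w p is the n-th power of w (1 - zt), so a nonzero term of index i has as
    absolute value a power of w (1 - zt) with exponent congruent to i modulo n. These are pairwise
    distinct for i < n. *)
Lemma w_pi_term_max (c : 'I_n -> rat) i :
  padic_abs R p (c i) * w (1 - zt) ^+ i <= w (\sum_i c i *: (1 - zt) ^+ i).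
Proof.
have r0 := w_pi_gt0.
have r1 : w (1 - zt) != 1.
  apply/eqP => h; move: w_pi; rewrite h expr1n => /esym/eqP.
  by rewrite invr_eq1 pnatr_eq1 => /eqP p1; have := prime_gt1 pp; lia.
rewrite -(absX wP) -wZ.
apply: (ultrametric_max_term wP w_nat_le1 (F := fun i => c i *: (1 - zt) ^+ i)) => j k.
have E l : c l != 0 -> exists e : int, w (c l *: (1 - zt) ^+ l) = w (1 - zt) ^ (l%:Z - n%:Z * e).
  move=> cl; rewrite wZ /padic_abs (negPf cl); set e := (_ - _ : int); exists e.
  have -> : p%:R = w (1 - zt) ^ (- n%:Z) by rewrite -exprnN w_pi invrK.
  rewrite exprz_exp (absX wP) [_ ^+ l]exprnP -expfzDr ?gt_eqF //.
  by congr (_ ^ _); ring.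
move=> h jn; have kn : w (c k *: (1 - zt) ^+ k) != 0 by rewrite -h.
have cn l : w (c l *: (1 - zt) ^+ l) != 0 -> c l != 0.
  by apply: contra => /eqP ->; rewrite scale0r (abs0 wP).
have [e1 h1] := E j (cn _ jn); have [e2 h2] := E k (cn _ kn).
move: h; rewrite h1 h2 => /(ieexprIz r0 r1) h.
apply: val_inj => /=; have := ltn_ord j; have := ltn_ord k.
move: h; move: (nat_of_ord j) (nat_of_ord k) => a b h ak bk.
have [ee|] := eqVneq e1 e2; first by move: h; rewrite ee => /addIr [].
rewrite neq_lt => /orP[] le; nia.
Qed.

End OnePlace.

Lemma pi_expand (x : K) : exists c : 'I_n -> rat, x = \sum_i c i *: (1 - zt) ^+ i.
Proof.
have [q -> qn] := horner_alg_small iota ztP genK x.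
exists (fun i => (q \Po (1 - 'X))`_i).
have -> : horner_alg zt q = horner_alg (1 - zt) (q \Po (1 - 'X)).
  rewrite /horner_alg /horner_morph map_comp_poly horner_comp; congr _.[_].
  by rewrite rmorphB rmorph1 /= map_polyX !hornerE; ring.
have sz : (size (q \Po (1 - 'X)) <= n)%N.
  rewrite size_comp_poly2 // -opprB size_polyN -polyC1.
  exact: size_XsubC.
rewrite /horner_alg /horner_morph (horner_coef_wide _ (n := n)) ?size_map_poly //.
by apply: eq_bigr => i _; rewrite coef_map /= mulr_algl.
Qed.

(** By [w_pi_term_max] the absolute value of an element is at least that of each term of its
    expansion in powers of 1 - zt, and the value at 1 - zt determines those of the terms; the
    ultrametric inequality bounds the other place by them. *)
Lemma padic_place_unique (w w' : K -> R) :
  absolute_value w -> (forall q : rat, w q%:A = padic_abs R p q) ->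
  absolute_value w' -> (forall q : rat, w' q%:A = padic_abs R p q) ->
  w (1 - zt) ^+ n = p%:R^-1 -> w' (1 - zt) ^+ n = p%:R^-1 -> w = w'.
Proof.
move=> wP wQ wP' wQ' h h'.
have r : w (1 - zt) = w' (1 - zt).
  apply/eqP; rewrite -(@eqrXn2 _ n) ?(abs_ge0 wP) ?(abs_ge0 wP') //.
  by rewrite h h'.
suff le (u u' : K -> R) : absolute_value u -> (forall q : rat, u q%:A = padic_abs R p q) ->
    absolute_value u' -> (forall q : rat, u' q%:A = padic_abs R p q) ->
    u (1 - zt) ^+ n = p%:R^-1 -> u (1 - zt) = u' (1 - zt) -> forall x, u' x <= u x.
  apply/funext => x; apply/eqP; rewrite eq_le.
  by rewrite (le w' w) // (le w w').
move=> uP uQ uP' uQ' hu e x; have [c ->] := pi_expand x.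
apply: (ultrametric_sum uP' (w_nat_le1 uQ')) => [|i _]; first exact: (abs_ge0 uP).
by rewrite (wZ uP' uQ') (absX uP') -e; exact: w_pi_term_max.
Qed.

(** The powers of 1 - zt are already a basis of K over Q, so a sequence in K expands exactly;
    [w_pi_term_max] bounds its coordinates, which gives their convergence and the independence. *)
Lemma padic_local_degree (w : K -> R) :
  absolute_value w -> (forall q : rat, w q%:A = padic_abs R p q) ->
  w (1 - zt) ^+ n = p%:R^-1 -> local_degree (padic_abs R p) w = n.
Proof.
move=> wP wQ h; have vP := vP wP wQ.
apply: local_degree_unique => //.
have r0 := w_pi_gt0 wP h.
exists (fun i _ => (1 - zt) ^+ i); split.
- by move=> j; exact: cauchy_cst.
- move=> x xC; have /choice[c cP] := fun m => pi_expand (x m).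
  exists (fun i m => c m i) => [j e e0|].
    have [|N hN] := xC (e * w (1 - zt) ^+ j); first by rewrite mulr_gt0 ?exprn_gt0.
    exists N => m k mN kN; have := hN m k mN kN.
    rewrite (cP m) (cP k) -sumrB => H.
    rewrite -(ltr_pM2r (exprn_gt0 j r0)); apply: le_lt_trans H.
    under eq_bigr => i _ do rewrite -scalerBl.
    exact: (w_pi_term_max wP wQ h (fun i => c m i - c k i) j).
  by move=> e e0; exists 0%N => m _; rewrite -cP subrr (abs0 wP).
- move=> c cC cN j e e0.
  have [|N hN] := cN (e * w (1 - zt) ^+ j); first by rewrite mulr_gt0 ?exprn_gt0.
  exists N => m mN; have H := hN m mN.
  rewrite -(ltr_pM2r (exprn_gt0 j r0)); apply: le_lt_trans H.
  exact: (w_pi_term_max wP wQ h (fun i => c i m) j).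
Qed.

(** A place with w (1 - zt) = 1 contributes 0, since L w is squeezed between 0 and 0. Any other
    place is totally ramified, hence unique and of full degree n, and ln (w (1 - zt)) = - ln p / n
    with p <= d. *)
Lemma sum_places_above_padic (L : (K -> R) -> R) :
  (forall w, absolute_value w -> (forall m : nat, w m%:R <= 1) ->
     ln (w (1 - zt)) <= L w <= 0) ->
  let S := \sum_(w \in (places_above (padic_abs R p) : set (K -> R)))
    (local_degree (padic_abs R p) w)%:R / (\dim {:K})%:R * L w in
  ((forall k, d <> (p ^ k.+1)%N) -> S = 0) /\ - ln d%:R / n%:R <= S <= 0.
Proof.
move=> hL S.
have Lw0 w : places_above (padic_abs R p) w -> w (1 - zt) = 1 -> L w = 0.
  move=> [wP wQ] h; have := hL w wP (w_nat_le1 wQ); rewrite h ln1 => h2.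
  by apply/eqP; rewrite eq_le andbC.
have dp0 : 0 <= ln (d%:R : R) / n%:R by rewrite divr_ge0 ?ln_ge0 ?ler1n //; lia.
have [allone|] := pselect (forall w, places_above (padic_abs R p) w -> w (1 - zt) = 1).
  have -> : S = 0.
    by rewrite /S fsbig1 // => w wP; rewrite Lw0 ?mulr0 // allone.
  by split => //; rewrite lexx mulNr oppr_le0 dp0.
move=> /existsNP[w /not_implyP[[wP wQ] w1]].
have [//|[[k dE] wn]] := w_1sub wP wQ.
split=> [/(_ k)//|].
have -> : S = L w.
  rewrite /S (fsbigE [:: w]) //=; last 1 first.
  - move=> w' [wP' wQ']; rewrite inE => ww'.
    have [h|[_ h]] := w_1sub wP' wQ'; first by rewrite Lw0 ?mulr0.
    by case/eqP: ww'; apply: padic_place_unique.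
  - rewrite big_cons big_nil ifT ?inE // addr0 padic_local_degree // (dim_cyclotomic iota ztP genK) divff ?mul1r //.
    by rewrite pnatr_eq0 -lt0n.
  - by move=> w' /=; rewrite inE => /eqP ->.
have /andP[lo ->] := hL w wP (w_nat_le1 wQ).
rewrite andbT (le_trans _ lo) //.
have -> : ln (w (1 - zt)) = - ln p%:R / n%:R.
  have r0 := w_pi_gt0 wP wn.
  apply: (@mulIf _ n%:R); first by rewrite pnatr_eq0 -lt0n.
  rewrite divfK ?pnatr_eq0 -?lt0n // mulr_natr -lnXn // wn lnV ?posrE ?ltr0n ?prime_gt0 //.
have dg : (0 < d)%N by lia.
have pg := prime_gt0 pp.
rewrite !mulNr lerN2 ler_pM2r ?invr_gt0 ?ltr0n // ler_ln ?posrE ?ltr0n //.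
by rewrite ler_nat dE expnS leq_pmulr // expn_gt0 prime_gt0.
Qed.

End PAdic.

(** * The height of a torsion point as a mean over conjugates *)

Lemma cyclic_pair (N : nat) (xi y1 y2 : algC) : N.-primitive_root xi ->
  y1 ^+ N = 1 -> y2 ^+ N = 1 ->
  exists d u v s t : nat, let zt := y1 ^+ s * y2 ^+ t in
  [/\ d.-primitive_root zt, y1 = zt ^+ u & y2 = zt ^+ v].
Proof.
move=> xiP h1 h2; have N0 := prim_order_gt0 xiP.
have [[a' /= _] y1E'] := prim_rootP xiP h1; have [[b /= _] y2E] := prim_rootP xiP h2.
(* Adding N makes the exponent positive, as the Bezout relation of [egcdnP] requires. *)
pose a := (a' + N)%N.
have y1E : y1 = xi ^+ a by rewrite /a exprD (prim_expr_order xiP) mulr1.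
have a0 : (0 < a)%N by rewrite /a; lia.
have [km kn kE _] := egcdnP b a0.
set h := gcdn a b in kE.
have h0 : (0 < h)%N by rewrite gcdn_gt0 a0.
have [lm ln lE _] := egcdnP N h0.
set g := gcdn h N in lE.
have g0 : (0 < g)%N by rewrite gcdn_gt0 h0.
have ga : (g %| a)%N by rewrite (dvdn_trans (dvdn_gcdl _ _)) // dvdn_gcdl.
have gb : (g %| b)%N by rewrite (dvdn_trans (dvdn_gcdl _ _)) // dvdn_gcdr.
have gN : (g %| N)%N by rewrite dvdn_gcdr.
(* The relation km a = kn b + h would need the exponent - kn for y2; modulo N, the factor N - 1
   stands for - 1. *)
exists (N %/ g)%N, (a %/ g)%N, (b %/ g)%N, (km * lm)%N, (kn * N.-1 * lm)%N.
cbv zeta; set zt := _ * _.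
have ztE : zt = xi ^+ g.
  have e : (a * (km * lm) + b * (kn * N.-1 * lm) = (kn * b * lm + ln) * N + g)%N.
    have -> : (a * (km * lm) = (km * a) * lm)%N by ring.
    rewrite kE mulnDl [(h * lm)%N]mulnC lE.
    by case: (N) N0 => // M _ /=; ring.
  by rewrite /zt y1E y2E -!exprM -exprD e exprD mulnC exprM (prim_expr_order xiP) expr1n mul1r.
split.
- by have := exp_prim_root xiP g; rewrite (gcdn_idPl gN) -ztE.
- by rewrite ztE -exprM mulnC divnK.
- by rewrite ztE -exprM mulnC divnK.
Qed.

Section TorsionHeight.
Variable R : realType.

(* At roots of unity x and y, the largest absolute value of a coordinate of
   intersection_point (x, y). *)
Definition chord_max (x y : R[i]) : R :=
  Num.max (nc (1 - x)) (Num.max (nc (1 - y)) (nc (y - x))).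

Lemma bigmax3 (F : 'I_3 -> R) : (forall i, 0 <= F i) ->
  \big[Num.max/0]_(i < 3) F i = Num.max (F 2) (Num.max (F 1) (F 0)).
Proof.
move=> F0; rewrite !big_ord_recl big_ord0.
have -> : lift ord0 ord0 = 1 :> 'I_3 by apply: val_inj.
have -> : lift ord0 (lift ord0 ord0) = 2 :> 'I_3 by apply: val_inj.
have -> : ord0 = 0 :> 'I_3 by apply: val_inj.
by rewrite [Num.max (F 2) 0]max_l // maxA maxC [Num.max (F 0) _]maxC.
Qed.

Lemma archimedean_neq_padic p : prime p -> archimedean_abs R <> padic_abs R p.
Proof.
move=> pp /(congr1 (fun f => f p%:R)); rewrite padic_abs_nat // ifF; last first.
  by apply/eqP; have := prime_gt0 pp; lia.
rewrite logn_prime // eqxx expr1 /archimedean_abs ratr_nat ger0_norm // => h.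
have : p%:R * p%:R = 1 :> R by rewrite {2}h divff // pnatr_eq0 -lt0n prime_gt0.
by rewrite -natrM => /eqP; rewrite pnatr_eq1 muln_eq1 => /andP[/eqP p1]; have := prime_gt1 pp; lia.
Qed.

(** Since zt is a monomial in zt^u and zt^v, the largest coordinate is at least |1 - zt| at a
    non-archimedean place, and it is at most 1. This is the hypothesis of [sum_places_above_padic],
    which leaves at most one prime. *)
Lemma number_field_height_cyclotomic (K : fieldExtType rat) (iota : {rmorphism K -> algC})
    d (zt : K) (z : R[i]) (s t u v : nat) :
  d.-primitive_root zt -> <<1; zt>>%VS = fullv -> (3 <= d)%N -> d.-primitive_root z ->
  zt = (zt ^+ u) ^+ s * (zt ^+ v) ^+ t ->
  forall x : 'rV[K]_3, x 0 0 = zt ^+ v - zt ^+ u -> x 0 1 = 1 - zt ^+ v -> x 0 2 = zt ^+ u - 1 ->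
  - ln d%:R / (totient d)%:R <= number_field_height R x -
    (totient d)%:R^-1 * usum d (fun a => ln (chord_max (z ^+ (a * u)) (z ^+ (a * v)))) <= 0.
Proof.
move=> ztP genK d3 zP ztE x x0 x1 x2.
have d1 : (1 < d)%N by lia.
(* For a not prime to d an arbitrary embedding is used, so that sg is defined on all naturals. *)
have /choice[sg sgE] : forall a, exists f : {rmorphism K -> R[i]}, coprime a d -> f zt = z ^+ a.
  move=> a; have [ad|ad] := boolP (coprime a d).
    have zaP : d.-primitive_root (z ^+ a) by rewrite (prim_root_exp_coprime a zP).
    by have [f fE] := cyclotomic_embedding iota ztP genK zaP; exists f.
  by have [f fE] := cyclotomic_embedding iota ztP genK zP; exists f.
pose L (w : K -> R) := ln (\big[Num.max/0]_(i < 3) w (x 0 i)).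
have LE w : absolute_value w -> L w =
    ln (Num.max (w (1 - zt ^+ u)) (Num.max (w (1 - zt ^+ v)) (w (zt ^+ v - zt ^+ u)))).
  move=> wP; rewrite /L bigmax3; last by move=> i; rewrite (abs_ge0 wP).
  by rewrite x0 x1 x2 -[zt ^+ u - 1]opprB (absN wP).
have zt1 : 1 - zt != 0.
  by rewrite subr_eq0 eq_sym -[zt]expr1 -(prim_order_dvd ztP) dvdn1; lia.
have L0 w : absolute_value w -> (forall m : nat, w m%:R <= 1) -> ln (w (1 - zt)) <= L w <= 0.
  move=> wP wn; rewrite LE //.
  have wz : w zt = 1 by rewrite (abs_root1 wP (ltnW d1) (prim_expr_order ztP)).
  have wzX k : w (zt ^+ k) = 1 by rewrite (absX wP) wz expr1n.
  set M := Num.max _ _.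
  have hM : w (1 - zt) <= M.
    have -> : 1 - zt = (1 - (zt ^+ u) ^+ s) + (zt ^+ u) ^+ s * (1 - (zt ^+ v) ^+ t).
      by rewrite {1}ztE; ring.
    rewrite (le_trans (ultrametric wP wn _ _)) // (absM wP) (absX wP) wzX expr1n mul1r.
    rewrite ge_max /M !le_max (abs_1subX wP wn s (wzX u)) (abs_1subX wP wn t (wzX v)) //.
    by rewrite orbT.
  have w0 : 0 < w (1 - zt) by rewrite (abs_gt0 wP).
  rewrite ler_ln ?posrE ?(lt_le_trans w0) // hM /= ln_le0 //.
  have le1 a b : w a <= 1 -> w b <= 1 -> w (a - b) <= 1.
    by move=> ha hb; rewrite (le_trans (ultrametric wP wn _ _)) // (absN wP) ge_max ha.
  by rewrite /M !ge_max !le1 ?(abs1 wP) ?wzX.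
pose F (v : rat -> R) := \sum_(w \in (places_above v : set (K -> R)))
    (local_degree v w)%:R / (\dim {:K})%:R * L w.
have Farch : F (archimedean_abs R) = (totient d)%:R^-1 *
    usum d (fun a => ln (chord_max (z ^+ (a * u)) (z ^+ (a * v)))).
  rewrite /F (sum_places_above_arch iota ztP genK zP sgE d3); congr (_ * _).
  apply: eq_bigr => a ad; rewrite LE; last exact: conj_abs_abs.
  by rewrite /conj_abs !rmorphB !rmorph1 !rmorphXn sgE // -!exprM.
have Fp p : prime p -> ((forall k, d <> (p ^ k.+1)%N) -> F (padic_abs R p) = 0) /\
    - ln d%:R / (totient d)%:R <= F (padic_abs R p) <= 0.
  by move=> pp; exact: (sum_places_above_padic iota ztP genK d1 pp L0).
change (- ln d%:R / (totient d)%:R <= (\sum_(v \in @rat_places R) F v) -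
    (totient d)%:R^-1 * usum d (fun a => ln (chord_max (z ^+ (a * u)) (z ^+ (a * v)))) <= 0).
rewrite -Farch.
have ld0 : - ln (d%:R : R) / (totient d)%:R <= 0.
  by rewrite mulNr oppr_le0 divr_ge0 // ln_ge0 // ler1n; lia.
have [[p [pp [k dE]]]|npp] := pselect (exists p, prime p /\ exists k, d = (p ^ k.+1)%N).
  have -> : \sum_(v \in @rat_places R) F v = F (archimedean_abs R) + F (padic_abs R p).
    rewrite (fsbigE [:: archimedean_abs R; padic_abs R p]) //=.
    - rewrite !big_cons big_nil !ifT ?addr0 // inE; [by right; exists p|by left].
    - by rewrite inE andbT; apply/eqP; exact: archimedean_neq_padic.
    - by move=> v' /=; rewrite !inE => /orP[]/eqP->; [left|right; exists p].
    - move=> v' [->|[q qp ->]]; rewrite !inE ?eqxx //= negb_or => /andP[_ /eqP qNp].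
      apply: (Fp q qp).1 => l dl; apply: qNp; congr padic_abs.
      have : (q %| p ^ k.+1)%N by rewrite -dE dl expnS dvdn_mulr.
      by rewrite Euclid_dvdX // => /andP[]; rewrite dvdn_prime2 // => /eqP.
  by rewrite addrAC subrr add0r; exact: (Fp p pp).2.
have -> : \sum_(v \in @rat_places R) F v = F (archimedean_abs R).
  rewrite (fsbigE [:: archimedean_abs R]) //=.
  - by rewrite big_cons big_nil ifT ?addr0 // inE; left.
  - by move=> v' /=; rewrite mem_seq1 => /eqP ->; left.
  - move=> v' [->|[q qp ->]]; rewrite !inE ?eqxx //= => _.
    by apply: (Fp q qp).1 => l dl; apply: npp; exists q; split => //; exists l.
by rewrite subrr lexx ld0.
Qed.

(** Here d is the order of the cyclic group generated by the inverses of the two coordinates, which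
    are what [intersection_point] contains; zt is a generator and u, v are their exponents. *)
Lemma height_formula (om : algC * algC) : torsion_point om -> om != (1, 1) ->
  exists d u v : nat, [/\ (1 < d)%N,
    forall i j k l, om.1 ^+ i * om.2 ^+ j = om.1 ^+ k * om.2 ^+ l <->
      (i * u + j * v = k * u + l * v %[mod d])%N &
    (3 <= d)%N -> forall z : R[i], d.-primitive_root z ->
      - ln d%:R / (totient d)%:R <= height_C_cap R om -
      (totient d)%:R^-1 * usum d (fun a => ln (chord_max (z ^+ (a * u)) (z ^+ (a * v)))) <= 0].
Proof.
case: om => om1 om2 [[/= n1 n10 h1] [/= n2 n20 h2]] omn1.
pose N := (n1 * n2)%N.
have N0 : (0 < N)%N by rewrite muln_gt0 n10.
have [xi xiP] := C_prim_root_exists N0.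
have e1 : om1^-1 ^+ N = 1 by rewrite exprVn /N exprM h1 expr1n invr1.
have e2 : om2^-1 ^+ N = 1 by rewrite exprVn /N mulnC exprM h2 expr1n invr1.
have [d [u [v [s [t [ztP y1E y2E]]]]]] := cyclic_pair xiP e1 e2.
set ztC := _ * _ in ztP y1E y2E.
have d0 := prim_order_gt0 ztP.
have d1 : (1 < d)%N.
  rewrite ltn_neqAle d0 andbT; apply/eqP => d1.
  have zt1 : ztC = 1 by have := prim_expr_order ztP; rewrite -d1 expr1.
  move: omn1; rewrite -[om1]invrK -[om2]invrK y1E y2E zt1 !expr1n invr1.
  by rewrite eqxx.
exists d, u, v; split => //.
  move=> i j k l /=.
  have E a b : om1 ^+ a * om2 ^+ b = (ztC ^+ (a * u + b * v))^-1.
    by rewrite -[om1]invrK -[om2]invrK y1E y2E exprD !(mulnC _ u) !(mulnC _ v) !exprM invfM !exprVn.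
  rewrite !E; split=> [/invr_inj/eqP|h].
    by rewrite (eq_prim_root_expr ztP) => /eqP.
  by congr (_^-1); apply/eqP; rewrite (eq_prim_root_expr ztP); apply/eqP.
move=> d3 z zP; rewrite /height_C_cap /height.
case: coordinate_field => K [iota [x xE xgen]] /=.
have xiE i : iota (x 0 i) = intersection_point (om1, om2) 0 i by rewrite -xE mxE.
(* The field K is only known to be generated by the coordinates of the point. The two roots of unity
   are recovered from these coordinates, so zt lies in K and generates it. *)
pose y1 := x 0 2 + 1; pose y2 := 1 - x 0 1.
have y1I : iota y1 = om1^-1.
  by rewrite rmorphD rmorph1 xiE /intersection_point row3E subrK.
have y2I : iota y2 = om2^-1.
  by rewrite rmorphB rmorph1 xiE /intersection_point row3E /=; ring.
pose zt := y1 ^+ s * y2 ^+ t.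
have ztI : iota zt = ztC by rewrite rmorphM !rmorphXn /= y1I y2I.
have y1zt : y1 = zt ^+ u by apply: (fmorph_inj iota); rewrite rmorphXn /= ztI -y1E.
have y2zt : y2 = zt ^+ v by apply: (fmorph_inj iota); rewrite rmorphXn /= ztI -y2E.
have x2E : x 0 2 = zt ^+ u - 1 by rewrite -y1zt /y1 addrK.
have x1E : x 0 1 = 1 - zt ^+ v by rewrite -y2zt /y2; ring.
have x0E : x 0 0 = zt ^+ v - zt ^+ u.
  apply: (fmorph_inj iota); rewrite xiE -y1zt -y2zt rmorphB /= y1I y2I.
  by rewrite /intersection_point row3E.
have ztP' : d.-primitive_root zt by rewrite -(fmorph_primitive_root iota) ztI.
apply: (number_field_height_cyclotomic iota (s := s) (t := t) ztP' _ d3 zP) => //.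
  apply/eqP; rewrite eqEsubv subvf /= -xgen; apply/Fadjoin_seqP; split.
    exact: subv_adjoin.
  have ztk k : zt ^+ k \in <<1; zt>>%VS by rewrite rpredX // memv_adjoin.
  move=> c /mapP[i _ ->]; case: i => -[|[|[|//]]] hi.
  - by have -> : Ordinal hi = 0 :> 'I_3 by [apply: val_inj]; rewrite x0E rpredB.
  - by have -> : Ordinal hi = 1 :> 'I_3 by [apply: val_inj]; rewrite x1E rpredB // rpred1.
  - by have -> : Ordinal hi = 2 :> 'I_3 by [apply: val_inj]; rewrite x2E rpredB // rpred1.
by rewrite -y1zt -y2zt.
Qed.

End TorsionHeight.

(** * Equidistribution of torsion points *)

Section Equidistribution.
Variables (R : realType) (n N : nat) (xi : R[i]).
Hypothesis n0 : (0 < n)%N.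
Hypothesis nN : (n <= N)%N.
Hypothesis xiP : N.-primitive_root xi.

Implicit Types x y z : R[i].

Local Notation conj x := (conjc x).

Let N0 : (0 < N)%N := leq_trans n0 nN.

Lemma xi_unit g : nc (xi ^+ g) = 1.
Proof. by rewrite (nc_unity_root (n := N)) // exprAC (prim_expr_order xiP) expr1n. Qed.

Lemma mul_conj z : nc z = 1 -> z * conj z = 1.
Proof. by move=> z1; rewrite -nc_sqr z1 expr1n. Qed.

(* The Fejer kernel, used on the finite group of N-th roots of unity so that
   no integration is needed. *)
Definition fejer z : R := nc (\sum_(j < n) z ^+ j) ^+ 2 / n%:R.

Lemma fejer_ge0 z : 0 <= fejer z.
Proof. by rewrite divr_ge0 ?sqr_ge0. Qed.

Lemma sum_root_pow (k l : nat) : (k < N)%N -> (l < N)%N ->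
  \sum_(g < N) (conj (xi ^+ g)) ^+ k * (xi ^+ g) ^+ l = if k == l then N%:R else 0.
Proof.
move=> kN lN.
have xi0 : xi != 0 by rewrite (prim_root_eq0 xiP) -lt0n.
have cj g : conj (xi ^+ g) = (xi ^+ g)^-1.
  by apply: (conj_unity_root N0); rewrite exprAC (prim_expr_order xiP) expr1n.
pose y := xi ^+ l / xi ^+ k.
have E (g : 'I_N) : (conj (xi ^+ g)) ^+ k * (xi ^+ g) ^+ l = y ^+ g.
  by rewrite cj exprVn expr_div_n mulrC -!exprM ![(_ * g)%N]mulnC.
rewrite (eq_bigr _ (fun g _ => E g)).
have yN : y ^+ N = 1.
  by rewrite expr_div_n -!exprM !(mulnC _ N) !exprM (prim_expr_order xiP) !expr1n divr1.
case: eqVneq => [kl|kl].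
  have -> : y = 1 by rewrite /y kl divff // expf_neq0.
  by under eq_bigr do rewrite expr1n; rewrite sumr_const card_ord.
have y1 : y != 1.
  apply: contra kl => /eqP y1.
  have : xi ^+ l == xi ^+ k by rewrite -[xi ^+ l](divfK (expf_neq0 k xi0)) -/y y1 mul1r.
  by rewrite (eq_prim_root_expr xiP) !modn_small // eq_sym.
apply/eqP; have /eqP := subrX1 y N; rewrite yN subrr eq_sym mulf_eq0 subr_eq0.
by rewrite (negPf y1).
Qed.

(** The mass is exact because n <= N: the exponents below n are distinct modulo N, so orthogonality
    leaves only the diagonal. *)
Lemma fejer_mass z : nc z = 1 -> \sum_(g < N) fejer (z * conj (xi ^+ g)) = N%:R.
Proof.
move=> z1; rewrite -mulr_suml; apply: (canLR (mulfK _)); first by rewrite pnatr_eq0 -lt0n.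
apply: complexI; rewrite rmorph_sum rmorphM !rmorph_nat.
have E (g : 'I_N) : (nc (\sum_(j < n) (z * conj (xi ^+ g)) ^+ j) ^+ 2)%:C%C =
    \sum_(j < n) \sum_(k < n) z ^+ j * conj z ^+ k * ((conj (xi ^+ g)) ^+ j * (xi ^+ g) ^+ k).
  have := conjcK (xi ^+ g); set c := conj (xi ^+ g) => cK.
  rewrite nc_sqr rmorph_sum mulr_suml; apply: eq_bigr => j _.
  rewrite mulr_sumr; apply: eq_bigr => k _.
  by rewrite rmorphXn rmorphM /= cK !exprMn; ring.
rewrite (eq_bigr _ (fun g _ => E g)) exchange_big /=.
transitivity (\sum_(j < n) (N%:R : R[i])); last first.
  by rewrite sumr_const card_ord mulr_natr.
apply: eq_bigr => j _; rewrite exchange_big /= (bigD1 j) //= -mulr_sumr.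
rewrite sum_root_pow ?(leq_trans (ltn_ord _)) // eqxx -exprMn mul_conj // expr1n mul1r.
rewrite big1 ?addr0 // => k kj; rewrite -mulr_sumr sum_root_pow ?(leq_trans (ltn_ord _)) //.
by rewrite ifF ?mulr0 //; apply/negbTE; rewrite eq_sym.
Qed.

Lemma fejer_moment2 z : nc z = 1 -> fejer z * nc (1 - z) ^+ 2 <= 4 / n%:R.
Proof.
move=> z1; rewrite /fejer mulrAC ler_wpM2r ?invr_ge0 //.
rewrite -exprMn -(absM (nc_abs R)) mulrC.
have -> : (1 - z) * \sum_(j < n) z ^+ j = 1 - z ^+ n.
  by rewrite -[RHS]opprB subrX1 -mulNr opprB.
have h : nc (1 - z ^+ n) <= 2.
  rewrite (le_trans (absB (nc_abs R) _ _)) // (absX (nc_abs R)) z1 expr1n.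
  by rewrite (abs1 (nc_abs R)); lra.
have := abs_ge0 (nc_abs R) (1 - z ^+ n); nra.
Qed.

(** Each distance x is bounded by eta / 2 + x^2 / (2 eta), and [fejer_moment2] bounds the quadratic
    part. In this section [eta] is a free scale, not the limit of the heights. *)
Lemma fejer_moment1 z eta : nc z = 1 -> 0 < eta ->
  \sum_(g < N) fejer (z * conj (xi ^+ g)) * nc (z - xi ^+ g) <=
    N%:R * ((eta + 4 / n%:R / eta) / 2).
Proof.
move=> z1 eta0.
apply: (@le_trans _ _ (\sum_(g < N) (fejer (z * conj (xi ^+ g)) * (eta / 2) +
    4 / n%:R / eta / 2))).
  apply: ler_sum => g _.
  have gu := xi_unit g.
  have u1 : nc (z * conj (xi ^+ g)) = 1 by rewrite (absM (nc_abs R)) nc_conj z1 gu mul1r.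
  have -> : nc (z - xi ^+ g) = nc (1 - z * conj (xi ^+ g)).
    rewrite -[RHS]mul1r -gu -(absM (nc_abs R)) -(absN (nc_abs R)); congr nc.
    by rewrite mulrBr mulr1 mulrCA mul_conj // mulr1 opprB.
  have := fejer_moment2 u1; have := fejer_ge0 (z * conj (xi ^+ g)).
  set k := fejer _; set x := nc _; set c := 4 / n%:R => k0 h.
  have kx : k * x <= k * (eta / 2) + k * x ^+ 2 / eta / 2.
    have e2 : k * (eta / 2) + k * x ^+ 2 / eta / 2 - k * x = k * (eta - x) ^+ 2 / (2 * eta).
      by field; rewrite gt_eqF.
    rewrite -subr_ge0 e2; apply: divr_ge0; last by rewrite mulr_ge0 // ltW.
    by apply: mulr_ge0 => //; exact: sqr_ge0.
  apply: (le_trans kx); rewrite lerD2l ler_pM2r // ler_pM2r ?invr_gt0 //.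
rewrite big_split /= -mulr_suml fejer_mass // sumr_const card_ord -[X in _ + X]mulr_natl.
by rewrite -mulrDr -mulrDl.
Qed.

Variables (r : seq nat) (zz ww : nat -> R[i]) (f : R[i] -> R[i] -> R) (Bf Lf dl eta : R).
Hypothesis zz1 : forall a, nc (zz a) = 1.
Hypothesis ww1 : forall a, nc (ww a) = 1.
Hypothesis fB : forall x y, nc x = 1 -> nc y = 1 -> `|f x y| <= Bf.
Hypothesis fL : forall x y x' y', nc x = 1 -> nc y = 1 -> nc x' = 1 -> nc y' = 1 ->
  `|f x y - f x' y'| <= Lf * (nc (x - x') + nc (y - y')).
Hypothesis Lf0 : 0 <= Lf.
Hypothesis eta0 : 0 < eta.
Hypothesis dl0 : 0 <= dl.
Let m := size r.
Hypothesis m0 : (0 < m)%N.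
(** Weyl's condition on the sample: the means of the nontrivial characters of small degree are at
    most dl. *)
Hypothesis Tsmall : forall p q : 'I_n * 'I_n, p != q ->
  nc (\sum_(a <- r) zz a ^+ p.1 * ww a ^+ p.2 * conj (zz a ^+ q.1 * ww a ^+ q.2)) <= dl * m%:R.

Let grid (F : 'I_N -> 'I_N -> R) := \sum_(g < N) \sum_(h < N) F g h.
Let kappa a (g h : 'I_N) := fejer (zz a * conj (xi ^+ g)) * fejer (ww a * conj (xi ^+ h)).

Let kappa_ge0 a g h : 0 <= kappa a g h.
Proof. by rewrite mulr_ge0 ?fejer_ge0. Qed.

Let kappa_mass a : grid (kappa a) = N%:R ^+ 2.
Proof.
rewrite /grid /kappa; under eq_bigr do rewrite -mulr_sumr fejer_mass //.
by rewrite -mulr_suml fejer_mass // expr2.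
Qed.

(** Expanding the kernel gives n^4 character sums divided by n^2. The n^2 diagonal ones give m
    exactly, and each other one is at most dl m. *)
Let kappa_avg (g h : 'I_N) : `|\sum_(a <- r) kappa a g h - m%:R| <= n%:R ^+ 2 * dl * m%:R.
Proof.
pose U a (p : 'I_n * 'I_n) := zz a ^+ p.1 * ww a ^+ p.2.
pose cc (p : 'I_n * 'I_n) := conj (xi ^+ g) ^+ p.1 * conj (xi ^+ h) ^+ p.2.
pose T p q := \sum_(a <- r) U a p * conj (U a q).
have nn : n%:R != 0 :> R by rewrite pnatr_eq0 -lt0n.
have kE a : (kappa a g h)%:C%C = (n%:R ^+ 2)^-1 *
    \sum_p \sum_q (U a p * conj (U a q)) * (cc p * conj (cc q)).
  have -> : kappa a g h = n%:R ^- 2 * nc (\sum_p U a p * cc p) ^+ 2.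
    rewrite /kappa /fejer; set A := \sum_(j < n) _; set B := \sum_(j < n) _.
    have -> : \sum_p U a p * cc p = A * B.
      rewrite mulr_suml (eq_bigr (fun j : 'I_n => \sum_(l < n) U a (j, l) * cc (j, l))).
        by rewrite pair_big /=; apply: eq_bigr => -[].
      move=> j _; rewrite mulr_sumr; apply: eq_bigr => l _.
      by rewrite /U /cc /= !exprMn; ring.
    by rewrite (absM (nc_abs R)); field.
  rewrite rmorphM fmorphV rmorphXn /= rmorph_nat nc_sqr; congr (_ * _).
  rewrite rmorph_sum mulr_suml; apply: eq_bigr => p _; rewrite mulr_sumr.
  by apply: eq_bigr => q _; rewrite rmorphM /=; ring.
have cc1 p : nc (cc p) = 1.
  by rewrite (absM (nc_abs R)) !(absX (nc_abs R)) !nc_conj !xi_unit !expr1n mulr1.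
have U1 a p : nc (U a p) = 1.
  by rewrite (absM (nc_abs R)) !(absX (nc_abs R)) zz1 ww1 !expr1n mulr1.
have SE : (\sum_(a <- r) kappa a g h)%:C%C = (n%:R ^+ 2)^-1 *
    \sum_p \sum_q T p q * (cc p * conj (cc q)).
  rewrite rmorph_sum (eq_bigr _ (fun a _ => kE a)) -mulr_sumr; congr (_ * _).
  rewrite exchange_big; apply: eq_bigr => p _; rewrite exchange_big.
  by apply: eq_bigr => q _; rewrite mulr_suml.
have Tpp p : T p p = m%:R.
  rewrite /T (eq_bigr (fun=> 1)) => [|a _]; last by rewrite mul_conj.
  by rewrite big_const_seq count_predT -[RHS]mulr1 mulr_natl -Monoid.iteropE.
have DE : (\sum_(a <- r) kappa a g h - m%:R)%:C%C = (n%:R ^+ 2)^-1 *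
    \sum_p \sum_(q | q != p) T p q * (cc p * conj (cc q)).
  rewrite rmorphB /= SE rmorph_nat.
  have -> : m%:R = (n%:R ^+ 2)^-1 * \sum_(p : 'I_n * 'I_n) (m%:R : R[i]).
    rewrite sumr_const card_prod card_ord -[(_ *+ (_ * _))]mulr_natr natrM -expr2.
    by rewrite mulrCA mulVf ?mulr1 // expf_neq0 // pnatr_eq0 -lt0n.
  rewrite -mulrBr -sumrB; congr (_ * _); apply: eq_bigr => p _.
  by rewrite (bigD1 p) //= Tpp mul_conj // mulr1 addrAC subrr add0r.
have h1 : nc (\sum_p \sum_(q | q != p) T p q * (cc p * conj (cc q))) <=
    (n%:R ^+ 2) * (n%:R ^+ 2) * (dl * m%:R).
  apply: (@le_trans _ _ (\sum_(p : 'I_n * 'I_n) \sum_(q : 'I_n * 'I_n) dl * m%:R)).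
    apply: (le_trans (abs_sum (nc_abs R) _ _ _)); apply: ler_sum => p _.
    apply: (le_trans (abs_sum (nc_abs R) _ _ _)).
    rewrite [leRHS](bigID (fun q => q != p)) /= -[leLHS]addr0 lerD //; last first.
      by rewrite sumr_ge0 // => q _; rewrite mulr_ge0.
    apply: ler_sum => q qp; rewrite (absM (nc_abs R)) (absM (nc_abs R)) nc_conj !cc1 !mulr1.
    by apply: Tsmall; rewrite eq_sym.
  rewrite !sumr_const card_prod card_ord -mulrnA -[leLHS]mulr_natl !natrM.
  by rewrite !expr2.
have -> : `|\sum_(a <- r) kappa a g h - m%:R| = nc ((\sum_(a <- r) kappa a g h - m%:R)%:C%C).
  by rewrite nc_real.
rewrite DE (absM (nc_abs R)) (absV (nc_abs R)) (absX (nc_abs R)).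
have -> : nc (n%:R : R[i]) = n%:R.
  by rewrite -(rmorph_nat (real_complex R)) nc_real ger0_norm.
rewrite ler_pdivrMl ?exprn_gt0 ?ltr0n //.
by apply: (le_trans h1); rewrite !mulrA.
Qed.

(** The double sum D weights the grid values of f by the kernel. Summing over the grid first, the
    kernel is concentrated near the sample point and D is close to the sample mean by the Lipschitz
    bound; summing over the sample first, [kappa_avg] makes D close to the grid mean. *)
Lemma equidistribution :
  `|m%:R^-1 * \sum_(a <- r) f (zz a) (ww a) -
    (N%:R ^+ 2)^-1 * grid (fun g h => f (xi ^+ g) (xi ^+ h))| <=
  Lf * (eta + 4 / n%:R / eta) + Bf * (n%:R ^+ 2 * dl).
Proof.
have mR : 0 < m%:R :> R by rewrite ltr0n.
have NR1 : 0 < N%:R :> R by rewrite ltr0n.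
have NR : 0 < N%:R ^+ 2 :> R by rewrite exprn_gt0.
pose ff (g h : 'I_N) := f (xi ^+ g) (xi ^+ h).
pose D := \sum_(a <- r) grid (fun g h => ff g h * kappa a g h).
have gridD (F G : 'I_N -> 'I_N -> R) : grid F - grid G = grid (fun g h => F g h - G g h).
  by rewrite /grid -sumrB; apply: eq_bigr => g _; rewrite -sumrB.
have grid_norm (F G : 'I_N -> 'I_N -> R) : (forall g h, `|F g h| <= G g h) -> `|grid F| <= grid G.
  move=> h; apply: (le_trans (ler_norm_sum _ _ _)); apply: ler_sum => g _.
  by apply: (le_trans (ler_norm_sum _ _ _)); apply: ler_sum.
have gridZ (F : 'I_N -> 'I_N -> R) c : c * grid F = grid (fun g h => c * F g h).
  by rewrite /grid mulr_sumr; apply: eq_bigr => g _; rewrite mulr_sumr.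
have h1 : `|D - N%:R ^+ 2 * \sum_(a <- r) f (zz a) (ww a)| <=
    m%:R * (N%:R ^+ 2 * (Lf * (eta + 4 / n%:R / eta))).
  rewrite mulr_sumr -sumrB (le_trans (ler_norm_sum _ _ _)) //.
  have -> : m%:R * (N%:R ^+ 2 * (Lf * (eta + 4 / n%:R / eta))) =
      \sum_(a <- r) (N%:R ^+ 2 * (Lf * (eta + 4 / n%:R / eta))).
    by rewrite big_const_seq count_predT mulr_natl -Monoid.iteropE.
  apply: ler_sum => a _; rewrite -(kappa_mass a) mulrC gridZ gridD.
  set zeta := eta + _.
  apply: (@le_trans _ _ (grid (fun g h => Lf * (nc (zz a - xi ^+ g) + nc (ww a - xi ^+ h)) * kappa a g h))).
    apply: grid_norm => g h; rewrite -mulrBl normrM (ger0_norm (kappa_ge0 a g h)).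
    rewrite ler_wpM2r ?kappa_ge0 // distrC; apply: fL; rewrite ?xi_unit //.
  have -> : grid (fun g h => Lf * (nc (zz a - xi ^+ g) + nc (ww a - xi ^+ h)) * kappa a g h) =
     Lf * (N%:R * (\sum_(g < N) fejer (zz a * conj (xi ^+ g)) * nc (zz a - xi ^+ g)) +
       N%:R * (\sum_(h < N) fejer (ww a * conj (xi ^+ h)) * nc (ww a - xi ^+ h))).
    rewrite -{1}(fejer_mass (ww1 a)) -(fejer_mass (zz1 a)) mulrDr.
    rewrite [X in Lf * X + _]mulrC !mulr_suml !mulr_sumr -big_split.
    apply: eq_bigr => g _; rewrite mulr_sumr !mulr_sumr -big_split; apply: eq_bigr => h _.
    by rewrite /kappa /=; ring.
  have := fejer_moment1 (zz1 a) eta0; have := fejer_moment1 (ww1 a) eta0.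
  rewrite kappa_mass -/zeta; set X := \sum_(g < N) _; set Y := \sum_(g < N) _ => hX hY.
  rewrite [leRHS]mulrCA ler_wpM2l //.
  have : N%:R * X <= N%:R * (N%:R * (zeta / 2)) by rewrite ler_pM2l.
  have : N%:R * Y <= N%:R * (N%:R * (zeta / 2)) by rewrite ler_pM2l.
  rewrite expr2; lra.
have h2 : `|D - m%:R * grid ff| <= N%:R ^+ 2 * (Bf * (n%:R ^+ 2 * dl * m%:R)).
  have -> : D = grid (fun g h => ff g h * \sum_(a <- r) kappa a g h).
    rewrite /D exchange_big /=; apply: eq_bigr => g _; rewrite exchange_big /=.
    by apply: eq_bigr => h _; rewrite mulr_sumr.
  rewrite gridZ gridD.
  have -> : N%:R ^+ 2 * (Bf * (n%:R ^+ 2 * dl * m%:R)) =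
      grid (fun _ _ => Bf * (n%:R ^+ 2 * dl * m%:R)).
    by rewrite /grid !sumr_const !card_ord -mulrnA -[RHS]mulr_natl natrM expr2.
  apply: grid_norm => g h; rewrite [m%:R * _]mulrC -mulrBr normrM ler_pM //.
  by apply: fB; rewrite xi_unit.
set A := \sum_(a <- r) _ in h1 *; rewrite -/ff; set G := grid ff in h2 *.
have -> : m%:R^-1 * A - (N%:R ^+ 2)^-1 * G =
    (m%:R * N%:R ^+ 2)^-1 * ((D - m%:R * G) - (D - N%:R ^+ 2 * A)).
  by field; rewrite (gt_eqF mR) (gt_eqF NR1).
rewrite normrM ger0_norm ?invr_ge0 ?mulr_ge0 ?(ltW mR) ?(ltW NR) //.
rewrite ler_pdivrMl ?mulr_gt0 // (le_trans (ler_normB _ _)) //.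
move: h1 h2; lra.
Qed.

End Equidistribution.

(** * The mean of F over the grid of roots of unity *)

Section HexagonCount.
Local Open Scope nat_scope.
Variable N : nat.

(* cnorm g is the distance from g to 0 modulo N. *)
Definition cnorm g := minn g (N - g).
Definition cdist g h := cnorm (maxn g h - minn g h).
Definition star g h := maxn (maxn (cnorm g) (cnorm h)) (cdist g h).

Lemma sum_interval a b : b <= N -> \sum_(0 <= h < N) (a <= h < b : nat) = b - a.
Proof.
move=> bN; elim: N b bN => [|n IH] b; first by rewrite leqn0 => /eqP ->; rewrite big_nil.
rewrite big_nat_recr //=; have [bn|bn] := leqP b n.
  by move=> _; rewrite IH //; lia.
move=> bn1; have {bn bn1}-> : b = n.+1 by lia.
rewrite (eq_big_nat _ _ (F2 := fun h => (a <= h < n : nat))); last by move=> i /andP[_ hi]; lia.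
by rewrite IH //; lia.
Qed.

Lemma sum_below b : b <= N -> \sum_(0 <= h < N) (h < b : nat) = b.
Proof. by move=> bN; have := sum_interval 0 bN; rewrite subn0. Qed.

(** The admissible h lie on two arcs of 2 t + 1 residues whose centres are 0 and g. The first
    summand counts their overlap on the near side, the second one, truncated at 0, the overlap on
    the far side of the circle. *)
Lemma star_row t g : 2 * t < N -> g < N ->
  \sum_(0 <= h < N) (star g h <= t : nat) =
  if g <= t then (2 * t + 1 - g) + (2 * t + g + 1 - N)
  else if N - t <= g then (2 * t + 1 - (N - g)) + (2 * t + (N - g) + 1 - N)
  else 0.
Proof.
move=> tN gN.
have sE h : h < N -> star g h <= t =
    [&& (g <= t) || (N - t <= g), (h <= t) || (N - t <= h) &
      [|| maxn g h - minn g h <= t | N - t <= maxn g h - minn g h]].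
  move=> hN; rewrite /star /cdist /cnorm !geq_max !geq_min -andbA.
  set m := maxn g h - minn g h; have mN : m < N by rewrite /m; lia.
  by congr [&& _ || _, _ || _ & _ || _]; lia.
case: ifP => gt.
  rewrite (eq_big_nat _ _ (F2 := fun h => (h < t.+1 : nat) + ((N - t + g <= h < N : nat) +
    (N - t <= h < t + g + 1 : nat)))); last first.
    move=> h /andP[_ hN]; rewrite sE // gt orTb andTb.
    by case: (leqP g h) => gh; lia.
  by rewrite !big_split /= !sum_interval ?sum_below; lia.
case: ifP => gt2.
  rewrite (eq_big_nat _ _ (F2 := fun h => (N - t <= h < N : nat) + ((h < t + 1 - (N - g) : nat) +
    (g - t <= h < t.+1 : nat)))); last first.
    move=> h /andP[_ hN]; rewrite sE // gt gt2 andTb.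
    by case: (leqP g h) => gh; lia.
  by rewrite !big_split /= !sum_interval ?sum_below; lia.
by rewrite big_nat big1 // => h /andP[_ hN]; rewrite sE // gt gt2.
Qed.

Lemma sum_trunc a n : a <= N ->
  2 * \sum_(0 <= g < n) (a + g - N) = (a + n - 1 - N) * (a + n - N).
Proof.
move=> aN; elim: n => [|n IH]; first by rewrite big_nil; nia.
rewrite big_nat_recr //= mulnDr IH.
have [h|h] := leqP (a + n) N.
  have -> : a + n - N = 0 by lia.
  have -> : a + n.+1 - 1 - N = 0 by lia.
  by rewrite muln0.
have [u uE] : exists u, a + n = N + u.+1 by exists (a + n - N).-1; lia.
have -> : a + n - N = u.+1 by lia.
have -> : a + n - 1 - N = u by lia.
have -> : a + n.+1 - 1 - N = u.+1 by lia.
have -> : a + n.+1 - N = u.+2 by lia.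
lia.
Qed.

Lemma sum_desc a n : n <= a.+1 -> 2 * \sum_(0 <= g < n) (a - g) + n * n = (2 * a + 1) * n.
Proof.
elim: n => [|n IH] h; first by rewrite big_nil; lia.
by rewrite big_nat_recr //=; have := IH (ltnW h); nia.
Qed.

(** A hexagon of radius t has 3 t^2 + 3 t + 1 points. The last product uses truncated subtraction
    and vanishes while 3 t < N; beyond that it counts the overlaps around the torus. *)
Lemma star_count t : 2 * t < N ->
  \sum_(0 <= g < N) \sum_(0 <= h < N) (star g h <= t : nat) =
  3 * t * t + 3 * t + 1 + (3 * t + 1 - N) * (3 * t + 2 - N).
Proof.
move=> tN; pose phi g := (2 * t + 1 - g) + (2 * t + g + 1 - N).
rewrite (eq_big_nat _ _ (F2 := fun g => if g <= t then phi g else if N - t <= g then phi (N - g) else 0)); last first.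
  by move=> g /andP[_ gN]; exact: star_row.
have E : \sum_(0 <= g < N) (if g <= t then phi g else if N - t <= g then phi (N - g) else 0) =
    \sum_(0 <= g < t.+1) phi g + \sum_(1 <= g < t.+1) phi g.
  rewrite (big_cat_nat _ (n := t.+1)) //=; last by lia.
  congr addn; first by apply: eq_big_nat => g /andP[_ h]; rewrite ifT //; lia.
  rewrite (big_cat_nat _ (n := N - t)) //=; [|lia|lia].
  rewrite big_nat big1 ?add0n; last first.
    by move=> g /andP[h1 h2]; rewrite ifF ?ifF //; lia.
  rewrite [RHS]big_nat_rev /= -{1}(add0n (N - t)) big_addn.
  rewrite -{1}[1]add0n big_addn.
  have -> : N - (N - t) = t by lia.
  rewrite subn1 /=; apply: eq_big_nat => g /andP[_ gt].
  by rewrite ifF ?ifT; [congr phi|..]; lia.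
rewrite E.
have D := @sum_desc (2 * t + 1) t.+1 ltac:(lia).
have U := @sum_trunc (2 * t + 1) t.+1 ltac:(lia).
have S0 : \sum_(0 <= g < t.+1) phi g = phi 0 + \sum_(1 <= g < t.+1) phi g by rewrite big_ltn.
have S1 : \sum_(0 <= g < t.+1) phi g = \sum_(0 <= g < t.+1) (2 * t + 1 - g) +
    \sum_(0 <= g < t.+1) (2 * t + 1 + g - N).
  rewrite -big_split; apply: eq_bigr => g _; rewrite /phi /=; congr addn; lia.
have p0 : phi 0 = 2 * t + 1 by rewrite /phi; lia.
move: D U S0 S1; rewrite p0.
have -> : 2 * t + 1 + t.+1 - 1 - N = 3 * t + 1 - N by lia.
have -> : 2 * t + 1 + t.+1 - N = 3 * t + 2 - N by lia.
move: (_ * (3 * t + 2 - N)) => Q; nia.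
Qed.

Lemma star_le g h : star g h <= N./2.
Proof. by rewrite /star /cdist /cnorm; lia. Qed.

End HexagonCount.

(** * Trigonometric bounds, the logarithmic series and roots of unity *)

Section RealAnalysis.
Variable R : realType.

Lemma mean_value (f df : R -> R) (a b : R) : a <= b ->
  (forall x, a <= x <= b -> is_derive x (1 : R) f (df x)) ->
  exists2 c, a <= c <= b & f b - f a = df c * (b - a).
Proof.
move=> ab dfP; have [||c cab cE] := @MVT_segment R f df a b ab.
- by move=> x; rewrite in_itv /= => /andP[/ltW ax /ltW xb]; apply: dfP; rewrite ax.
- apply: derivable_within_continuous => x; rewrite in_itv /= => xab.
  by have := dfP x xab; case.
by exists c => //; move: cab; rewrite in_itv.
Qed.

Lemma sin_lex (x : R) : 0 <= x -> sin x <= x.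
Proof.
move=> x0; pose f (t : R) := t - sin t; pose df (t : R) := 1 - cos t.
have dfP t : 0 <= t <= x -> is_derive t (1 : R) f (df t).
  by move=> _; apply: is_derive_eq.
have [c _] := mean_value x0 dfP.
rewrite /f sin0 !subr0 => E; rewrite -subr_ge0 E mulr_ge0 // /df subr_ge0.
exact: cos_le1.
Qed.

Lemma xcos_le_sin (x : R) : 0 <= x <= pi -> x * cos x <= sin x.
Proof.
move=> /andP[x0 xpi]; pose f (t : R) := sin t - t * cos t; pose df (t : R) := t * sin t.
have dfP t : 0 <= t <= x -> is_derive t (1 : R) f (df t).
  by move=> _; apply: is_derive_eq; rewrite /df /= /GRing.scale /=; ring.
have [c /andP[c0 cx]] := mean_value x0 dfP.
rewrite /f sin0 mul0r !subr0 => E; rewrite -subr_ge0 E !mulr_ge0 //.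
by rewrite sin_ge0_pi // c0 (le_trans cx).
Qed.

(** The upper bound is 1 / sin^2 = 1 + cot^2 together with x cos x <= sin x. *)
Lemma invsin_bounds (x : R) : 0 < x < pi / 2 ->
  (x ^+ 2)^-1 <= (sin x ^+ 2)^-1 <= 1 + (x ^+ 2)^-1.
Proof.
move=> /andP[x0 xp]; have pi0 := pi_gt0 R.
have s0 : 0 < sin x by apply: sin_gt0_pihalf; rewrite x0 xp.
have c0 : 0 < cos x by apply: cos_gt0_pihalf; rewrite xp (lt_trans _ x0) // oppr_lt0 divr_gt0.
have sx := sin_lex (ltW x0).
have xc : x * cos x <= sin x by apply: xcos_le_sin; rewrite (ltW x0) /=; lra.
have x2 : 0 < x ^+ 2 by rewrite exprn_gt0.
have s2 : 0 < sin x ^+ 2 by rewrite exprn_gt0.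
apply/andP; split.
  by rewrite lef_pV2 ?posrE // lerXn2r ?nnegrE ?(ltW x0) ?(ltW s0).
have h : x ^+ 2 * cos x ^+ 2 <= sin x ^+ 2.
  by rewrite -exprMn lerXn2r ?nnegrE ?mulr_ge0 ?(ltW x0) ?(ltW s0) ?(ltW c0).
have cs := cos2Dsin2 x.
have -> : 1 + (x ^+ 2)^-1 = (x ^+ 2 + 1) / x ^+ 2 by field; rewrite gt_eqF.
rewrite ler_pdivlMr // mulrC ler_pdivrMr //.
nra.
Qed.

Lemma is_derive_monomial (c x : R) k :
  is_derive x (1 : R) (fun y => c * y ^+ k.+1) (k.+1%:R * c * x ^+ k).
Proof.
have -> : (fun y => c * y ^+ k.+1) = c \*: ((@id R) ^+ k.+1).
  by apply/funext => y; rewrite /= exprfctE.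
have := is_deriveZ c (is_deriveX k.+1 (is_derive_id x (1 : R))).
by congr is_derive; rewrite /GRing.scale /=; ring.
Qed.

(** The square of |1 - r e^(it)|, see [nc_1sub_cis]. *)
Definition chord2 (t r : R) : R := 1 + r ^+ 2 - 2 * r * cos t.

Lemma chord2_ge (t r : R) : 0 <= r < 1 -> (1 - r) ^+ 2 <= chord2 t r.
Proof. by move=> /andP[r0 r1]; rewrite /chord2; have := cos_le1 t; nra. Qed.

Lemma cosSS (t : R) k : cos (k.+2%:R * t) = 2 * cos t * cos (k.+1%:R * t) - cos (k%:R * t).
Proof.
have -> : k.+2%:R * t = k.+1%:R * t + t by rewrite -natr1; ring.
have -> : k%:R * t = k.+1%:R * t - t by rewrite -[k.+1%:R]natr1; ring.
by rewrite cosD cosB; ring.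
Qed.

Lemma sum_geometric_cos (t r : R) K :
  (\sum_(k < K) r ^+ k * cos (k.+1%:R * t)) * chord2 t r =
  cos t - r - r ^+ K * cos (K.+1%:R * t) + r ^+ K.+1 * cos (K%:R * t).
Proof.
elim: K => [|K IH]; first by rewrite big_ord0 !mul1r !mul0r cos0; ring.
by rewrite big_ord_recr mulrDl IH /= cosSS /chord2 !exprS; ring.
Qed.

(** The derivative in r of the expression inside the absolute value is a geometric remainder with
    factor r^K, by [sum_geometric_cos]; the mean value theorem from r = 0 then gives an explicit
    rate, uniform in t. *)
Lemma ln_chord_series (t r : R) K : 0 <= r < 1 ->
  `|ln (chord2 t r) / 2 + \sum_(k < K) r ^+ k.+1 / k.+1%:R * cos (k.+1%:R * t)|
    <= 2 * r ^+ K / (1 - r) ^+ 2.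
Proof.
move=> /andP[r0 r1].
pose f (x : R) := ln (chord2 t x) / 2 + \sum_(k < K) (cos (k.+1%:R * t) / k.+1%:R) * x ^+ k.+1.
pose df (x : R) := (x - cos t) / chord2 t x + \sum_(k < K) x ^+ k * cos (k.+1%:R * t).
have chp x : 0 <= x <= r -> 0 < chord2 t x.
  move=> /andP[x0 xr]; apply: lt_le_trans (chord2_ge t _); last by rewrite x0 (le_lt_trans xr).
  by rewrite exprn_gt0 // subr_gt0 (le_lt_trans xr).
have dfP x : 0 <= x <= r -> is_derive x (1 : R) f (df x).
  move=> xr; have ch0 := chp x xr.
  have d1 : is_derive x (1 : R) (chord2 t) (2 * x - 2 * cos t).
    rewrite /chord2; apply: is_derive_eq; rewrite /GRing.scale /=; ring.
  have d2 : is_derive x (1 : R) (@ln R \o chord2 t) ((chord2 t x)^-1 * (2 * x - 2 * cos t)).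
    apply: is_derive1_comp; exact: is_derive1_ln.
  have d3 : is_derive x (1 : R) (fun x => \sum_(k < K) (cos (k.+1%:R * t) / k.+1%:R) * x ^+ k.+1)
     (\sum_(k < K) x ^+ k * cos (k.+1%:R * t)).
    have -> : (fun x => \sum_(k < K) (cos (k.+1%:R * t) / k.+1%:R) * x ^+ k.+1) =
        \sum_(k < K) (fun x => (cos (k.+1%:R * t) / k.+1%:R) * x ^+ k.+1).
      by rewrite fct_sumE.
    apply: is_derive_sum => k.
    have := is_derive_monomial (cos (k.+1%:R * t) / k.+1%:R) x k.
    by congr is_derive; rewrite mulrCA divff ?pnatr_eq0 // mulr1 mulrC.
  have := is_deriveD (is_deriveZ (2^-1) d2) d3.
  have -> : 2^-1 \*: (@ln R \o chord2 t) + (fun x => \sum_(k < K) cos (k.+1%:R * t) / k.+1%:R * x ^+ k.+1) = f.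
    by apply/funext => y; rewrite /f /= [in RHS]mulrC.
  by congr is_derive; rewrite /df /GRing.scale /=; congr (_ + _); field; rewrite gt_eqF.
have [c /andP[c0 cr]] := mean_value r0 dfP.
have c1 : c < 1 by apply: le_lt_trans r1.
have f0 : f 0 = 0.
  rewrite /f /chord2 expr0n /= mulr0 mul0r subr0 addr0 ln1 mul0r add0r big1 // => k _.
  by rewrite expr0n mulr0.
have -> : \sum_(k < K) r ^+ k.+1 / k.+1%:R * cos (k.+1%:R * t) =
    \sum_(k < K) cos (k.+1%:R * t) / k.+1%:R * r ^+ k.+1.
  by apply: eq_bigr => k _; ring.
rewrite -/(f r) f0 !subr0 => ->.
have chc : 0 < chord2 t c by apply: chp; rewrite c0.
have dfE : df c = c ^+ K * (c * cos (K%:R * t) - cos (K.+1%:R * t)) / chord2 t c.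
  apply: (canRL (mulfK _)); first by rewrite gt_eqF.
  rewrite /df mulrDl sum_geometric_cos divfK ?gt_eqF // exprS; ring.
rewrite dfE !normrM normfV (ger0_norm (exprn_ge0 K c0)) (gtr0_norm chc) (ger0_norm r0).
have h1 : `|c * cos (K%:R * t) - cos (K.+1%:R * t)| <= 2.
  rewrite (le_trans (ler_normB _ _)) // normrM (ger0_norm c0).
  have := cos_max (K%:R * t); have := cos_max (K.+1%:R * t); nra.
have h2 : c ^+ K <= r ^+ K by rewrite lerXn2r ?nnegrE.
have h3 : (1 - r) ^+ 2 <= chord2 t c.
  by apply: le_trans (chord2_ge t _); rewrite ?c0 //; nra.
have s0 : 0 < (1 - r) ^+ 2 by rewrite exprn_gt0 // subr_gt0.
have s1 : c ^+ K * `|c * cos (K%:R * t) - cos (K.+1%:R * t)| <= 2 * r ^+ K.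
  by rewrite mulrC ler_pM ?exprn_ge0.
have s2 : (chord2 t c)^-1 <= ((1 - r) ^+ 2)^-1 by rewrite lef_pV2 ?posrE.
have s3 : 0 <= c ^+ K * `|c * cos (K%:R * t) - cos (K.+1%:R * t)|.
  by rewrite mulr_ge0 ?exprn_ge0.
have s4 : c ^+ K * `|c * cos (K%:R * t) - cos (K.+1%:R * t)| / chord2 t c <=
    2 * r ^+ K / (1 - r) ^+ 2.
  by apply: ler_pM => //; rewrite invr_ge0 ltW.
rewrite -[leRHS]mulr1; apply: ler_pM => //; last exact: ltW.
by rewrite mulr_ge0 // invr_ge0 ltW.
Qed.

End RealAnalysis.

Section RootsOfUnity.
Variable R : realType.

Definition cis (t : R) : R[i] := Complex (cos t) (sin t).

Lemma cisD s t : cis s * cis t = cis (s + t).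
Proof.
by apply/eqP; rewrite eq_complex /= cosD sinD eqxx /= addrC [cos s * _]mulrC mulrC [X in X + _]mulrC [cos s * _]mulrC.
Qed.

Lemma cisX t k : cis t ^+ k = cis (k%:R * t).
Proof.
elim: k => [|k IH]; first by rewrite mul0r expr0 /cis cos0 sin0.
by rewrite exprS IH cisD -natr1 mulrDl mul1r addrC.
Qed.

Lemma nc_cis t : nc (cis t) = 1.
Proof. by rewrite /nc /= cos2Dsin2 sqrtr1. Qed.

Lemma nc_1sub_cis (r t : R) : nc (1 - r%:C%C * cis t) ^+ 2 = chord2 t r.
Proof.
apply: complexI; rewrite nc_sqr; apply/eqP; rewrite eq_complex /chord2 /=.
have := cos2Dsin2 t; move: (cos t) (sin t) => c s cs.
apply/andP; split; apply/eqP; last by ring.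
symmetry; transitivity (1 - 2 * r * c + r ^+ 2 * (c ^+ 2 + s ^+ 2)); first by rewrite cs; ring.
by ring.
Qed.

Definition rootN N : R[i] := cis (2 * pi / N%:R).

Lemma rootNX N k : rootN N ^+ k = cis (2 * pi * k%:R / N%:R).
Proof. by rewrite /rootN cisX; congr cis; ring. Qed.

Lemma chord2_1 (t : R) : chord2 t 1 = 4 * sin (t / 2) ^+ 2.
Proof.
have -> : chord2 t 1 = 2 - 2 * cos (t / 2 *+ 2).
  by rewrite /chord2 expr1n mulr1 -[t / 2 *+ 2]mulr_natr divfK //; ring.
by rewrite cos_mulr2n cos2sin2; ring.
Qed.

Lemma rootN_prim N : (0 < N)%N -> N.-primitive_root (rootN N).
Proof.
move=> N0; have NR : 0 < N%:R :> R by rewrite ltr0n.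
apply/andP; split => //; apply/forallP => i; rewrite unity_rootE rootNX.
have pi0 := pi_gt0 R.
have := ltn_ord i; move: (nat_of_ord i) => k kN.
apply/eqP; have [iN|iN] := eqVneq k.+1 N.
  by rewrite -iN mulfK ?pnatr_eq0 // mulr_natl /cis cos2pi sin2pi eqxx.
apply/negbTE/eqP => /(congr1 (@complex.Re R)) /= c1.
have lt : (k.+1 < N)%N by rewrite ltn_neqAle iN kN.
have := chord2_1 (2 * pi * k.+1%:R / N%:R); rewrite /chord2 c1.
have -> : 2 * pi * k.+1%:R / N%:R / 2 = pi * (k.+1%:R / N%:R) :> R by field; rewrite gt_eqF.
suff : 0 < sin (pi * (k.+1%:R / N%:R) : R) by nra.
apply: sin_gt0_pi; rewrite mulr_gt0 ?divr_gt0 ?ltr0n //=.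
by rewrite gtr_pMr // ltr_pdivrMr // mul1r ltr_nat.
Qed.

End RootsOfUnity.

(** * The values of zeta at 2 and 3 *)

Section Basel.
Variable R : realType.

Lemma sum_sqr N : (6 * \sum_(0 <= s < N) s * s + 3 * N * N = 2 * N * N * N + N)%N.
Proof. by elim: N => [|N IH]; rewrite ?big_nil // big_nat_recr //=; lia. Qed.

Lemma sum_id N : (2 * \sum_(0 <= s < N) s + N = N * N)%N.
Proof. by elim: N => [|N IH]; rewrite ?big_nil // big_nat_recr //=; lia. Qed.

(** Parseval's identity for the sequence 0, 1, ..., N - 1, whose discrete Fourier transform at a
    frequency g other than 0 is N / (xi^g - 1), as summation by parts ([tele]) shows. *)
Lemma sum_inv_chord N : (0 < N)%N ->
  \sum_(1 <= g < N) (chord2 (2 * pi * g%:R / N%:R) 1)^-1 = (N%:R ^+ 2 - 1) / 12 :> R.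
Proof.
move=> N0; have xiP := rootN_prim R N0; set xi := rootN R N in xiP.
have NR : N%:R != 0 :> R by rewrite pnatr_eq0 -lt0n.
pose y g := \sum_(s < N) s%:R * (xi ^+ g) ^+ s.
have parseval : \sum_(0 <= g < N) nc (y g) ^+ 2 = N%:R * (\sum_(0 <= s < N) s * s)%:R.
  rewrite !big_mkord; apply: complexI; rewrite rmorph_sum rmorphM !rmorph_nat natr_sum mulr_sumr.
  rewrite (eq_bigr (fun g : 'I_N => \sum_(s < N) \sum_(t < N) (s%:R * t%:R) *
     ((conjc (xi ^+ g)) ^+ t * (xi ^+ g) ^+ s))); last first.
    move=> g _; set c := xi ^+ g; rewrite /= nc_sqr rmorph_sum mulr_suml; apply: eq_bigr => s _.
    rewrite mulr_sumr; apply: eq_bigr => t _; rewrite rmorphM rmorphXn /= conjc_nat; ring.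
  rewrite exchange_big; apply: eq_bigr => s _; rewrite exchange_big (bigD1 s) //=.
  rewrite -mulr_sumr (sum_root_pow N0 (leqnn N) xiP) // eqxx natrM big1 => [|t ts].
    by rewrite addr0; ring.
  rewrite -mulr_sumr (sum_root_pow N0 (leqnn N) xiP) // ifF ?mulr0 //.
  by apply/negbTE.
have y0 : nc (y 0%N) = (\sum_(0 <= s < N) s)%:R.
  have -> : y 0%N = (\sum_(0 <= s < N) s)%:R.
    by rewrite big_mkord natr_sum; apply: eq_bigr => s _; rewrite expr0 expr1n mulr1.
  by rewrite -(rmorph_nat (real_complex R)) nc_real ger0_norm.
have tele z k : (z - 1) * \sum_(s < k) s%:R * z ^+ s = k%:R * z ^+ k - \sum_(s < k) z ^+ s.+1 :> R[i].
  elim: k => [|k IH]; first by rewrite !big_ord0 mul0r mulr0 subr0.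
  by rewrite !big_ord_recr /= mulrDr IH -natr1 !exprS; ring.
have yg g : (0 < g < N)%N -> nc (y g) ^+ 2 = N%:R ^+ 2 / chord2 (2 * pi * g%:R / N%:R) 1.
  move=> /andP[g0 gN]; set z := xi ^+ g.
  have z1 : z != 1.
    by rewrite -(prim_order_dvd xiP); apply/negP => /dvdn_leq => /(_ g0); lia.
  have zN : z ^+ N = 1 by rewrite exprAC (prim_expr_order xiP) expr1n.
  have : (z - 1) * y g = N%:R.
    rewrite /y -/z tele zN mulr1.
    have -> : \sum_(s < N) z ^+ s.+1 = z * \sum_(s < N) z ^+ s.
      by rewrite mulr_sumr; apply: eq_bigr => s _; rewrite exprS.
    have /eqP := subrX1 z N; rewrite zN subrr eq_sym mulf_eq0 subr_eq0 (negPf z1) /= => /eqP ->.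
    by rewrite mulr0 subr0.
  move=> /(congr1 (@nc R)); rewrite (absM (nc_abs R)).
  rewrite -(rmorph_nat (real_complex R)) nc_real ger0_norm // => e.
  have cE : nc (z - 1) ^+ 2 = chord2 (2 * pi * g%:R / N%:R) 1.
    by rewrite -(nc_1sub_cis 1) -rootNX -/xi -/z mul1r -[z - 1]opprB (absN (nc_abs R)).
  have cn : nc (z - 1) != 0 by rewrite (abs_eq0 (nc_abs R)) subr_eq0.
  by rewrite -cE -e; field.
have S1 : \sum_(1 <= g < N) nc (y g) ^+ 2 =
    N%:R ^+ 2 * \sum_(1 <= g < N) (chord2 (2 * pi * g%:R / N%:R) 1)^-1.
  by rewrite mulr_sumr; apply: eq_big_nat => g gN; exact: yg.
move: parseval; rewrite [X in X = _ -> _]big_ltn // S1 y0.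
set S := \sum_(1 <= g < N) _; set A := \sum_(0 <= s < N) s; set B := \sum_(0 <= s < N) (s * s)%N.
have := congr1 (fun n : nat => n%:R : R) (sum_sqr N); have := congr1 (fun n : nat => n%:R : R) (sum_id N).
rewrite /= !natrD !natrM -/A -/B => hA hB h.
set n : R := N%:R in NR hA hB h *.
apply: (mulfI (expf_neq0 2 NR)).
have -> : n ^+ 2 * S = n * B%:R - A%:R ^+ 2 by rewrite -h; ring.
have -> : A%:R = (n * n - n) / 2 :> R by lra.
have -> : B%:R = (2 * n * n * n + n - 3 * n * n) / 6 :> R by lra.
by field.
Qed.

End Basel.

Section ZetaValues.
Variable R : realType.

Definition zsum (s n : nat) : R := \sum_(k < n) (k.+1%:R : R) ^- s.

Lemma chord2_bounds (N k : nat) : (0 < k)%N -> (2 * k < N)%N ->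
  (N%:R ^+ 2) / (4 * pi ^+ 2 * k%:R ^+ 2) <= (chord2 (R := R) (2 * pi * k%:R / N%:R) 1)^-1
    <= 1 / 4 + (N%:R ^+ 2) / (4 * pi ^+ 2 * k%:R ^+ 2).
Proof.
set x : R := N%:R ^+ 2 / _; move=> k0 kN; have pi0 := pi_gt0 R.
have NR : 0 < N%:R :> R by rewrite ltr0n; lia.
have kR : 0 < k%:R :> R by rewrite ltr0n.
pose t : R := pi * k%:R / N%:R.
have tP : 0 < t < pi / 2.
  rewrite divr_gt0 ?mulr_gt0 //= ltr_pdivrMr //.
  have : 2 * k%:R < N%:R :> R by rewrite -natrM ltr_nat.
  nra.
have := invsin_bounds tP.
rewrite chord2_1.
have -> : 2 * pi * k%:R / N%:R / 2 = t :> R by rewrite /t; field; rewrite gt_eqF.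
have -> : (4 * sin t ^+ 2)^-1 = (sin t ^+ 2)^-1 / 4 by rewrite invfM mulrC.
have -> : x = (t ^+ 2)^-1 / 4.
  rewrite /x /t; move: (pi : R) pi0 => p p0.
  by field; rewrite !(gt_eqF p0, gt_eqF kR, gt_eqF NR).
by move=> /andP[h1 h2]; lra.
Qed.

(** With N = 2 P + 1 the frequencies k and N - k pair up, and [chord2_bounds] compares each term of
    the exact sum [sum_inv_chord] with a multiple of 1 / k^2. *)
Lemma basel_partial P : 0 <= pi ^+ 2 / 6 - zsum 2 P <= pi ^+ 2 / (2 * P + 1)%N%:R.
Proof.
pose N := (2 * P + 1)%N; rewrite -/N.
have N0 : (0 < N)%N by rewrite /N; lia.
have NR : 0 < N%:R :> R by rewrite ltr0n.
have pi0 := pi_gt0 R.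
pose u g : R := (chord2 (2 * pi * g%:R / N%:R) 1)^-1.
have uN g : (g <= N)%N -> u (N - g)%N = u g.
  move=> gN; rewrite /u /chord2; congr (_ - _ * _)^-1.
  rewrite natrB // mulrBr mulrBl mulfK ?gt_eqF // addrC mulr_natl cosD2pi cosN //.
have S2 : \sum_(1 <= g < N) u g = 2 * \sum_(k < P) u k.+1.
  rewrite (big_cat_nat _ (n := P.+1)) //=; [|rewrite /N; lia].
  rewrite -{1}[1%N]add0n big_addn subn1 /= big_mkord.
  rewrite -{1}[P.+1]add0n big_addn.
  have -> : (N - P.+1)%N = P by rewrite /N; lia.
  rewrite big_nat_rev /= big_mkord mulr_natl mulr2n; congr (_ + _).
    by apply: eq_bigr => k _; rewrite addn1.
  apply: eq_bigr => k _; have kP := ltn_ord k.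
  have -> : (0 + P - k.+1 + P.+1 = N - k.+1)%N by rewrite /N; lia.
  by rewrite uN // /N; lia.
have := sum_inv_chord R N0; rewrite -/(u _) [LHS]S2 => S.
pose c : R := N%:R ^+ 2 / (4 * pi ^+ 2).
have c0 : 0 < c by rewrite divr_gt0 ?mulr_gt0 ?exprn_gt0.
have aux (a b x : R) : a / b * x^-1 = a / (b * x) by rewrite invfM mulrA.
have lo : c * zsum 2 P <= \sum_(k < P) u k.+1.
  rewrite mulr_sumr; apply: ler_sum => k _.
  have /andP[h _] := @chord2_bounds N k.+1 isT ltac:(rewrite /N; have := ltn_ord k; lia).
  by apply: le_trans h; rewrite [leLHS]aux.
have hi : \sum_(k < P) u k.+1 <= P%:R / 4 + c * zsum 2 P.
  have -> : P%:R / 4 + c * zsum 2 P = \sum_(k < P) (1 / 4 + c * (k.+1%:R : R) ^- 2).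
    rewrite big_split /= -mulr_sumr sumr_const card_ord; congr (_ + _).
      by rewrite mul1r mulr_natl.
    by rewrite /zsum mulr_sumr.
  apply: ler_sum => k _.
  have /andP[_ h] := @chord2_bounds N k.+1 isT ltac:(rewrite /N; have := ltn_ord k; lia).
  by apply: (le_trans h); rewrite lerD2l [leRHS]aux.
set U := \sum_(k < P) u k.+1 in S lo hi.
have UE : U = (N%:R ^+ 2 - 1) / 24 by lra.
have cE : pi ^+ 2 / 6 = (N%:R ^+ 2) / 24 / c.
  by rewrite /c; move: (pi : R) pi0 => p p0; field; rewrite !(gt_eqF p0, gt_eqF NR).
have PN : 4 * (P%:R : R) <= 2 * N%:R - 2 by rewrite /N natrD natrM; lra.
have N1 : 1 <= N%:R :> R by rewrite ler1n.
have pE : pi ^+ 2 / N%:R = N%:R / 4 / c.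
  by rewrite /c; move: (pi : R) pi0 => p p0; field; rewrite !(gt_eqF p0, gt_eqF NR).
rewrite cE pE; apply/andP; split.
  rewrite subr_ge0 ler_pdivlMr //; lra.
rewrite lerBlDr ler_pdivrMr // mulrDl divfK ?gt_eqF //.
nra.
Qed.

Lemma zeta2E : zeta R 2 = pi ^+ 2 / 6.
Proof.
apply/cvg_lim => //; apply/cvgrPdist_le => /= e e0.
have pi0 := pi_gt0 R.
exists (Num.bound (pi ^+ 2 / e)) => // P /= PP.
have -> : series (fun k => (k.+1%:R : R) ^- 2) P = zsum 2 P.
  by rewrite /series /= big_mkord.
have /andP[h1 h2] := basel_partial P.
rewrite ger0_norm // (le_trans h2) // ler_pdivrMr ?ltr0n; last by lia.
rewrite mulrC -ler_pdivrMr //.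
have : pi ^+ 2 / e < (Num.bound (pi ^+ 2 / e))%:R.
  by rewrite archi_boundP // divr_ge0 ?exprn_ge0 ?ltW.
move/ltW/le_trans; apply; rewrite ler_nat; lia.
Qed.

Lemma zsum2_le P : zsum 2 P <= pi ^+ 2 / 6.
Proof. by have /andP[h _] := basel_partial P; rewrite -subr_ge0. Qed.

Lemma zeta3_cvg : zsum 3 @ \oo --> zeta R 3.
Proof.
have sE : series (fun k => (k.+1%:R : R) ^- 3) = zsum 3.
  by apply/funext => n; rewrite /series /= big_mkord.
rewrite /zeta sE; apply: (@nondecreasing_is_cvgn R).
  apply/nondecreasing_seqP => n; rewrite /zsum big_ord_recr /= lerDl invr_ge0 exprn_ge0 //.
exists (pi ^+ 2 / 6) => _ [n _ <-]; apply: le_trans (zsum2_le n).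
apply: ler_sum => k _; rewrite lef_pV2 ?posrE ?exprn_gt0 //.
by rewrite ler_weXn2l // ler1n.
Qed.

End ZetaValues.

(** * Weighted cosine sums over the grid *)

Section StarSums.
Variable R : realType.

Lemma star_abel M (G : nat -> R) : let N := (6 * M)%N in
  \sum_(0 <= g < N) \sum_(0 <= h < N) G (star N g h) =
  N%:R ^+ 2 * G (3 * M)%N - \sum_(0 <= t < 3 * M) (G t.+1 - G t) *
    (3 * t * t + 3 * t + 1 + (3 * t + 1 - N) * (3 * t + 2 - N))%N%:R.
Proof.
cbv zeta; set N := (6 * M)%N.
(* Summation by parts from the largest value 3 M = N / 2 of [star], so that only the counts of
   points with [star] at most t enter. *)
have GE s : (s <= 3 * M)%N -> G s = G (3 * M)%N - \sum_(0 <= t < 3 * M) (s <= t)%N%:R * (G t.+1 - G t).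
  move=> sM; rewrite (big_cat_nat _ (n := s)) //= big_nat big1 ?add0r; last first.
    by move=> t /andP[_ ts]; rewrite leqNgt ts mul0r.
  rewrite (eq_big_nat _ _ (F2 := fun t => G t.+1 - G t)); last first.
    by move=> t /andP[st _]; rewrite st mul1r.
  by rewrite telescope_sumr //; ring.
have sl g h : (star N g h <= 3 * M)%N by have := star_le N g h; rewrite /N; lia.
under eq_bigr => g _ do under eq_bigr => h _ do rewrite GE //.
under eq_bigr => g _ do rewrite sumrB sumr_const_nat subn0.
rewrite sumrB sumr_const_nat subn0 -mulrnA -[X in X - _]mulr_natl natrM -expr2; congr (_ - _).
under eq_bigr => g _ do rewrite exchange_big.
rewrite exchange_big; apply: eq_big_nat => t /andP[_ tM].
rewrite -star_count; last by rewrite /N; lia.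
rewrite mulrC natr_sum mulr_suml; apply: eq_bigr => g _.
by rewrite natr_sum mulr_suml.
Qed.

(** The weight A t (t + 1) + B has constant second difference, so two summations by parts against
    the recurrence of G leave boundary terms only. *)
Lemma second_difference_sum (G : nat -> R) c A B n :
  (forall k, G k.+2 = 2 * c * G k.+1 - G k) ->
  2 * (1 - c) * \sum_(0 <= t < n) (G t.+1 - G t) * (A * t%:R ^+ 2 + A * t%:R + B) =
  2 * (1 - c) * (G n * (A * n%:R ^+ 2 + A * n%:R + B) - B * G 0%N) -
    2 * A * (n.+1%:R * G n - n%:R * G n.+1 - G 0%N).
Proof.
move=> rec; elim: n => [|n IH]; first by rewrite big_nil; ring.
by rewrite big_nat_recr //= mulrDr IH rec -!natr1; ring.
Qed.

Lemma cos_sin_natpi k : cos (k%:R * pi : R) = (-1) ^+ k /\ sin (k%:R * pi : R) = 0.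
Proof.
elim: k => [|k [IHc IHs]]; first by rewrite mul0r cos0 sin0.
by rewrite -natr1 mulrDl mul1r cosDpi sinDpi IHc IHs exprS mulN1r oppr0.
Qed.

Lemma cos_third k : cos (k%:R * (2 * pi / 3) : R) = (3 * (3 %| k)%N%:R - 1) / 2.
Proof.
have pi0 := pi_gt0 R.
set t : R := 2 * pi / 3; set c := cos t.
have c1 : c < 1.
  rewrite -[ltRHS](@cos0 R) /c ltr_cos ?in_itv /= ?lexx ?(ltW pi0) //.
    by rewrite /t divr_gt0 // mulr_gt0.
  by apply/andP; split; rewrite /t; lra.
have C0 : cos (0%:R * t) = 1 by rewrite mul0r cos0.
have C1 : cos (1%:R * t) = c by rewrite mul1r.
have C2 : cos (2%:R * t) = 2 * c ^+ 2 - 1 by rewrite cosSS C0 C1 -/c; ring.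
have C3 : cos (3%:R * t) = 1 by rewrite (_ : 3 * t = pi *+ 2) ?cos2pi // /t -mulr_natl; field.
(* This is cos (3 t) = 1 written in terms of c; as c < 1, it gives c = - 1 / 2. *)
have E : (c - 1) * (2 * c + 1) ^+ 2 = 0.
  have := C3; rewrite cosSS C2 C1 -/c; clear; move: c => x h.
  have -> : (x - 1) * (2 * x + 1) ^+ 2 = (2 * x * (2 * x ^+ 2 - 1) - x) - 1 by ring.
  by rewrite h subrr.
have ch : c = - 1 / 2.
  move/eqP: E; rewrite mulf_eq0 sqrf_eq0 => /orP[/eqP|/eqP]; lra.
have : cos (k%:R * t) = (3 * (3 %| k)%N%:R - 1) / 2 /\ cos (k.+1%:R * t) = (3 * (3 %| k.+1)%N%:R - 1) / 2.
  elim: k => [|k [IH1 IH2]]; first by rewrite C0 C1 ch dvdn0 /=; lra.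
  split => //; rewrite cosSS IH1 IH2 -/c ch.
  have : ((3 %| k) + (3 %| k.+1) + (3 %| k.+2) = 1)%N by lia.
  move/(congr1 (fun n : nat => n%:R : R)); rewrite !natrD; lra.
by case.
Qed.

(* Summation by parts against star_count: the three terms come from t = 3M,
   t = 0 and t = 2M, where the formula for the count changes. *)
Definition star_weight k : R := 4 * (-1) ^+ k - 1 - 3 * cos (k%:R * (2 * pi / 3)).

Lemma star_weight_le k : `|star_weight k| <= 8.
Proof.
rewrite /star_weight ler_norml; have /ler_normlP[] := cos_max (k%:R * (2 * pi / 3) : R).
by rewrite -signr_odd; case: (odd k); rewrite ?expr1 ?expr0; lra.
Qed.

Lemma star_cos_sum M k : (0 < M)%N -> let N := (6 * M)%N in let al : R := 2 * pi * k%:R / N%:R in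
  chord2 al 1 * \sum_(0 <= g < N) \sum_(0 <= h < N) cos ((star N g h)%:R * al) =
  6 * star_weight k + chord2 al 1 * (1 + 2 * cos (k%:R * (2 * pi / 3)) - 3 * (-1) ^+ k).
Proof.
move=> M0; cbv zeta; set N := (6 * M)%N; set al : R := _ / _.
have pi0 := pi_gt0 R.
have MR : M%:R != 0 :> R by rewrite pnatr_eq0 -lt0n.
pose G s : R := cos (s%:R * al); pose c : R := cos al.
have rec s : G s.+2 = 2 * c * G s.+1 - G s by exact: cosSS.
have G3 : G (3 * M)%N = (-1) ^+ k.
  rewrite /G -(cos_sin_natpi k).1; congr cos; rewrite /al /N !natrM.
  by move: (pi : R) => p; field.
have G3s : sin ((3 * M)%N%:R * al) = 0.
  rewrite -(cos_sin_natpi k).2; congr sin; rewrite /al /N !natrM.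
  by move: (pi : R) => p; field.
have G3' : G (3 * M).+1 = c * (-1) ^+ k.
  by rewrite /G -natr1 mulrDl mul1r cosD G3s mul0r subr0 -/(G _) G3 mulrC.
have G2 : G (2 * M)%N = cos (k%:R * (2 * pi / 3)).
  rewrite /G; congr cos; rewrite /al /N !natrM.
  by move: (pi : R) => p; field.
have G0 : G 0%N = 1 by rewrite /G mul0r cos0.
rewrite (star_abel M G) -/N.
have chE : chord2 al 1 = 2 * (1 - c) by rewrite /chord2 -/c; ring.
have S1 := second_difference_sum 3 1 (3 * M) rec.
(* The truncated product in [star_count] starts at t = 2 M = N / 3; in u = t - 2 M it is (3 u + 1)(3
   u + 2) = 9 u^2 + 9 u + 2, so [second_difference_sum] applies a second time. *)
pose H u := G (2 * M + u)%N.
have recH s : H s.+2 = 2 * c * H s.+1 - H s by rewrite /H !addnS rec.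
have S2 := second_difference_sum 9 2 M recH.
have SE : \sum_(0 <= t < 3 * M) (G t.+1 - G t) *
    (3 * t * t + 3 * t + 1 + (3 * t + 1 - N) * (3 * t + 2 - N))%N%:R =
  \sum_(0 <= t < 3 * M) (G t.+1 - G t) * (3 * t%:R ^+ 2 + 3 * t%:R + 1) +
  \sum_(0 <= u < M) (H u.+1 - H u) * (9 * u%:R ^+ 2 + 9 * u%:R + 2).
  under eq_bigr => t _ do rewrite natrD mulrDr.
  rewrite big_split /=; congr (_ + _).
    by apply: eq_bigr => t _; rewrite !natrD !natrM; ring.
  rewrite (big_cat_nat _ (n := (2 * M)%N)) //=; last by lia.
  rewrite big_nat big1 ?add0r; last first.
    move=> t /andP[_ tM]; have -> : (3 * t + 1 - N = 0)%N by rewrite /N; lia.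
    by rewrite mul0n mulr0.
  rewrite -{1}[(2 * M)%N]add0n big_addn.
  have -> : (3 * M - 2 * M = M)%N by lia.
  apply: eq_bigr => u _; rewrite /H.
  have -> : (2 * M + u.+1 = (u + 2 * M).+1)%N by lia.
  have -> : (2 * M + u = u + 2 * M)%N by lia.
  congr (_ * _).
  have -> : (3 * (u + 2 * M) + 1 - N = 3 * u + 1)%N by rewrite /N; lia.
  have -> : (3 * (u + 2 * M) + 2 - N = 3 * u + 2)%N by rewrite /N; lia.
  by rewrite natrM !natrD ?natrM; ring.
rewrite SE mulrBr mulrDr chE S1 S2 /H addn0 addnS.
have -> : (2 * M + M = 3 * M)%N by lia.
rewrite G3 G3' G2 G0 /star_weight /N !natrM -!natr1 !natrM.
ring.
Qed.

End StarSums.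

Section StarFourier.
Variable R : realType.

(** The limit of the grid mean of the k-th cosine as M grows: in [star_cos_sum] the factor
    [chord2 al 1] behaves like (2 pi k / N)^2. *)
Definition fcoef k : R := 6 * star_weight R k / (4 * pi ^+ 2 * k%:R ^+ 2).

Lemma star_cos_avg M k : (0 < M)%N -> (0 < k)%N -> (2 * k < 6 * M)%N ->
  `|(\sum_(0 <= g < 6 * M) \sum_(0 <= h < 6 * M)
       cos ((star (6 * M) g h)%:R * (2 * pi * k%:R / (6 * M)%N%:R))) / (6 * M)%N%:R ^+ 2 - fcoef k|
  <= 18 / (6 * M)%N%:R ^+ 2.
Proof.
move=> M0 k0 kM; have := @star_cos_sum R M k M0; cbv zeta.
set N := (6 * M)%N; set al : R := 2 * pi * k%:R / N%:R; set T := \sum_(0 <= g < N) _ => hT.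
have pi0 := pi_gt0 R.
have NR : 0 < N%:R :> R by rewrite ltr0n /N; lia.
have kR : 0 < k%:R :> R by rewrite ltr0n.
have := chord2_bounds R k0 kM; rewrite -/N -/al => /andP[lo hi].
have ch0 : 0 < chord2 al 1.
  rewrite -invr_gt0; apply: lt_le_trans lo.
  by rewrite divr_gt0 ?mulr_gt0 ?exprn_gt0.
set x : R := N%:R ^+ 2 / _ in lo hi.
have fE : fcoef k = 6 * star_weight R k * x / N%:R ^+ 2.
  rewrite /fcoef /x; move: (pi : R) pi0 => p p0.
  by field; rewrite !(gt_eqF p0, gt_eqF kR, gt_eqF NR).
have TE : T = 6 * star_weight R k / chord2 al 1 + (1 + 2 * cos (k%:R * (2 * pi / 3)) - 3 * (-1) ^+ k).
  apply: (mulfI (lt0r_neq0 ch0)); rewrite hT [RHS]mulrDr; congr (_ + _).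
  by rewrite mulrCA divff ?mulr1 // gt_eqF.
rewrite fE TE -mulrBl normrM [X in _ * X]ger0_norm ?invr_ge0 ?exprn_ge0 ?(ltW NR) //.
rewrite ler_pM2r ?invr_gt0 ?exprn_gt0 //.
set y := (chord2 al 1)^-1 in lo hi *; set e := 1 + _ - _.
have -> : 6 * star_weight R k * y + e - 6 * star_weight R k * x = 6 * star_weight R k * (y - x) + e by ring.
have e6 : `|e| <= 6.
  rewrite /e ler_norml; have /ler_normlP[] := cos_max (k%:R * (2 * pi / 3) : R).
  by rewrite -signr_odd; case: (odd k); rewrite ?expr1 ?expr0; lra.
rewrite (le_trans (ler_normD _ _)) // !normrM (ger0_norm (ler0n _ 6)).
(* The constant 18 is 6 * 8 / 4 + 6, with 8 from [star_weight_le] and 6 from e. *)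
have yx : `|y - x| <= 1 / 4 by rewrite ger0_norm ?subr_ge0 // lerBlDr.
have := star_weight_le R k; have := normr_ge0 (y - x); have := normr_ge0 (star_weight R k); nra.
Qed.

(** For unit x and y the three entries are |1 - r t| with t = x, y and x / y, which accounts for the
    asymmetric third one. *)
Definition chord_max_r (r : R) (x y : R[i]) : R :=
  Num.max (nc (1 - r%:C%C * x)) (Num.max (nc (1 - r%:C%C * y)) (nc (y - r%:C%C * x))).

Lemma nc_1sub_gt0 (r : R) (x : R[i]) : 0 < r < 1 -> nc x = 1 -> 1 - r <= nc (1 - r%:C%C * x).
Proof.
move=> /andP[r0 r1] x1; have := abs_dist (nc_abs R) 1 (r%:C%C * x).
rewrite (abs1 (nc_abs R)) (absM (nc_abs R)) nc_real x1 mulr1 (ger0_norm (ltW r0)).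
by rewrite ger0_norm // subr_ge0 ltW.
Qed.

Lemma ln_nc_1sub (r t : R) : 0 < r < 1 -> ln (nc (1 - r%:C%C * cis t)) = ln (chord2 t r) / 2.
Proof.
move=> r01; have := nc_1sub_gt0 r01 (nc_cis t); rewrite -nc_1sub_cis => h.
have n0 : 0 < nc (1 - r%:C%C * cis t) by apply: lt_le_trans h; rewrite subr_gt0; case/andP: r01.
by rewrite lnXn // -[ln _ *+ 2]mulr_natr mulfK.
Qed.

(** The modulus |1 - r e^(it)| is even in t and increases on [0, pi], so the largest of the three
    chords belongs to the exponent farthest from 0 modulo N. *)
Lemma chord_max_r_star (r : R) M g h : 0 < r < 1 -> (0 < M)%N ->
  (g < 6 * M)%N -> (h < 6 * M)%N ->
  ln (chord_max_r r (rootN R (6 * M) ^+ g) (rootN R (6 * M) ^+ h)) =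
  ln (chord2 (2 * pi * (star (6 * M) g h)%:R / (6 * M)%N%:R) r) / 2.
Proof.
move=> r01 M0; set N := (6 * M)%N => gN hN.
have N0 : (0 < N)%N by rewrite /N; lia.
have NR : 0 < N%:R :> R by rewrite ltr0n.
have pi0 := pi_gt0 R.
have /andP[r0 r1] := r01.
rewrite -ln_nc_1sub // -rootNX; congr ln; rewrite /chord_max_r.
set xi := rootN R N; have xiP := rootN_prim R N0; rewrite -/xi in xiP.
pose q s : R := nc (1 - r%:C%C * xi ^+ s); rewrite -!/(q _).
have xi1 k : (xi ^+ k) ^+ N = 1 by rewrite exprAC (prim_expr_order xiP) expr1n.
have xi0 k : xi ^+ k != 0 by rewrite expf_neq0 // (prim_root_eq0 xiP) -lt0n.
have xiN s : (s <= N)%N -> xi ^+ (N - s) = conjc (xi ^+ s).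
  move=> sN; rewrite (conj_unity_root N0 (xi1 s)); apply: (mulIf (xi0 s)).
  by rewrite -exprD subnK // (prim_expr_order xiP) mulVf.
have qN s : (s <= N)%N -> q (N - s)%N = q s.
  move=> sN; rewrite /q xiN // -[RHS]nc_conj rmorphB rmorph1 rmorphM /=.
  by rewrite oppr0.
have qc s : (s <= N)%N -> q (cnorm N s) = q s.
  by move=> sN; rewrite /cnorm /minn; case: ifP => // _; exact: qN.
have qdist : nc (xi ^+ h - r%:C%C * xi ^+ g) = q (maxn g h - minn g h)%N.
  have u1 k : nc (xi ^+ k) = 1 := nc_unity_root N0 (xi1 k).
  have [gh|gh] := leqP g h.
    have -> : xi ^+ h - r%:C%C * xi ^+ g = xi ^+ h * (1 - r%:C%C * xi ^+ (N - (h - g))).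
      rewrite mulrBr mulr1 mulrCA -exprD; congr (_ - _ * _).
      have -> : (h + (N - (h - g)) = N + g)%N by lia.
      by rewrite exprD (prim_expr_order xiP) mul1r.
    by rewrite (absM (nc_abs R)) u1 mul1r -/(q _) qN //; lia.
  have -> : xi ^+ h - r%:C%C * xi ^+ g = xi ^+ h * (1 - r%:C%C * xi ^+ (g - h)).
    by rewrite mulrBr mulr1 mulrCA -exprD subnKC // ltnW.
  by rewrite (absM (nc_abs R)) u1 mul1r.
have q_mono : {in [pred s | (s <= 3 * M)%N] &, {homo q : a b / (a <= b)%N >-> a <= b}}.
  move=> a b; rewrite !inE => aM bM ab.
  rewrite -(@ler_pXn2r _ 2) ?nnegrE ?(abs_ge0 (nc_abs R)) // /q !rootNX !nc_1sub_cis.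
  rewrite /chord2 lerD2l lerN2 ler_pM2l ?mulr_gt0 //.
  have leM s : (s <= 3 * M)%N -> (0 : R) <= 2 * (pi : R) * s%:R / N%:R <= (pi : R).
    move=> sM; apply/andP; split.
      have pg := ltW pi0; apply: divr_ge0 => //; apply: mulr_ge0 => //.
      exact: (mulr_ge0 (ler0n R 2) pg).
    rewrite ler_pdivrMr // [2 * pi]mulrC -mulrA ler_pM2l // -natrM ler_nat /N; lia.
  have [->//|nab] := eqVneq a b.
  apply: ltW; rewrite ltr_cos ?in_itv /= ?leM // ltr_pM2r ?invr_gt0 // ltr_pM2l ?mulr_gt0 //.
  by rewrite ltr_nat ltn_neqAle nab.
have q_max a b : (a <= 3 * M)%N -> (b <= 3 * M)%N -> q (maxn a b) = Num.max (q a) (q b).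
  move=> aM bM; case: (leqP a b) => ab.
    by rewrite max_r // q_mono ?inE.
  by rewrite max_l // q_mono ?inE // ltnW.
have cM s : (cnorm N s <= 3 * M)%N by rewrite /cnorm /N; lia.
rewrite qdist /star !q_max ?geq_max ?cM //.
rewrite !qc ?(ltnW gN) ?(ltnW hN) //; last by lia.
by rewrite maxA.
Qed.

End StarFourier.

(** * The limit of the grid mean of F_r *)

Section GridLimit.
Variable R : realType.

(** The product of the factors 1 - r xi^g is 1 - r^N, which is at most 1. *)
Lemma grid_ln_1sub_le0 (r : R) N : 0 < r < 1 -> (0 < N)%N ->
  \sum_(g < N) ln (nc (1 - r%:C%C * rootN R N ^+ g)) <= 0.
Proof.
move=> r01 N0; have xiP := rootN_prim R N0; have /andP[r0 r1] := r01.
have pos g : 0 < nc (1 - r%:C%C * rootN R N ^+ g).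
  rewrite rootNX; apply: lt_le_trans (nc_1sub_gt0 r01 (nc_cis _)).
  by rewrite subr_gt0.
have lnp (s : seq 'I_N) : \sum_(g <- s) ln (nc (1 - r%:C%C * rootN R N ^+ g)) =
    ln (\prod_(g <- s) nc (1 - r%:C%C * rootN R N ^+ g)).
  elim: s => [|a s IH]; first by rewrite !big_nil ln1.
  by rewrite !big_cons IH lnM ?posrE ?prodr_gt0.
rewrite lnp -(abs_prod (nc_abs R)) -(big_mkord xpredT (fun g => 1 - r%:C%C * rootN R N ^+ g)) (prod_prim_root1 _ N0 xiP).
rewrite -rmorphXn -(rmorph1 (real_complex R)) -rmorphB nc_real ln_le0 //.
have h0 : 0 <= r ^+ N by rewrite exprn_ge0 // ltW.
have h1 : r ^+ N <= 1 by rewrite exprn_ile1 // ltW.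
by rewrite ger0_norm ?subr_ge0 // gerBl.
Qed.

Definition grid_avg (r : R) N : R := (N%:R ^+ 2)^-1 *
  \sum_(g < N) \sum_(h < N) ln (chord_max_r r (rootN R N ^+ g) (rootN R N ^+ h)).

Definition star_avg M k : R := (\sum_(0 <= g < 6 * M) \sum_(0 <= h < 6 * M)
       cos ((star (6 * M) g h)%:R * (2 * pi * k%:R / (6 * M)%N%:R))) / (6 * M)%N%:R ^+ 2.

Lemma grid_avg_series (r : R) M K : 0 < r < 1 -> (0 < M)%N ->
  `|grid_avg r (6 * M) + \sum_(k < K) r ^+ k.+1 / k.+1%:R * star_avg M k.+1| <=
    2 * r ^+ K / (1 - r) ^+ 2.
Proof.
move=> r01 M0; have /andP[r0 r1] := r01.
pose N := (6 * M)%N; have NR : 0 < N%:R :> R by rewrite ltr0n /N; lia.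
pose th g h : R := 2 * pi * (star N g h)%:R / N%:R.
pose e g h := ln (chord2 (th g h) r) / 2 + \sum_(k < K) r ^+ k.+1 / k.+1%:R * cos (k.+1%:R * th g h).
have E : grid_avg r (6 * M) + \sum_(k < K) r ^+ k.+1 / k.+1%:R * star_avg M k.+1 =
    (N%:R ^+ 2)^-1 * \sum_(0 <= g < N) \sum_(0 <= h < N) e g h.
  rewrite /grid_avg -/N /star_avg -/N.
  under [X in _ = _ * X]eq_bigr => g _ do rewrite big_split.
  rewrite [X in _ = _ * X]big_split [RHS]mulrDr; congr (_ + _).
    congr (_ * _); rewrite big_mkord; apply: eq_bigr => g _.
    by rewrite big_mkord; apply: eq_bigr => h _; rewrite chord_max_r_star.
  under [X in _ = _ * X]eq_bigr => g _ do rewrite exchange_big.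
  rewrite exchange_big mulr_sumr; apply: eq_bigr => k _.
  rewrite [in RHS]mulrC mulrA; congr (_ / _); rewrite mulr_sumr; apply: eq_bigr => g _.
  rewrite mulr_sumr; apply: eq_bigr => h _; congr (_ * cos _).
  by rewrite /th; ring.
rewrite E normrM [X in X * _]ger0_norm ?invr_ge0 ?exprn_ge0 ?(ltW NR) //.
rewrite ler_pdivrMl ?exprn_gt0 //.
set B := 2 * r ^+ K / (1 - r) ^+ 2.
have -> : N%:R ^+ 2 * B = \sum_(0 <= g < N) \sum_(0 <= h < N) B.
  by rewrite !sumr_const_nat !subn0 -mulrnA -[RHS]mulr_natl natrM expr2.
rewrite (le_trans (ler_norm_sum _ _ _)) //; apply: ler_sum => g _.
rewrite (le_trans (ler_norm_sum _ _ _)) //; apply: ler_sum => h _.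
by apply: ln_chord_series; rewrite (ltW r0).
Qed.

Lemma star_weightE k : star_weight R k = - (7 / 2) + 8 * (2 %| k)%N%:R - 9 / 2 * (3 %| k)%N%:R.
Proof.
rewrite /star_weight cos_third -signr_odd dvdn2.
by case: (odd k); rewrite ?expr1 ?expr0 /=; lra.
Qed.

Lemma zsum_dvd p L : (0 < p)%N ->
  \sum_(k < p * L) (p %| k.+1)%N%:R * (k.+1%:R : R) ^- 3 = p%:R ^- 3 * zsum R 3 L.
Proof.
move=> p0; elim: L => [|L IH]; first by rewrite muln0 /zsum !big_ord0 mulr0.
rewrite mulnS addnC big_split_ord /= IH /zsum big_ord_recr /= mulrDr; congr (_ + _).
case: p p0 {IH} => // p _; rewrite big_ord_recr /= big1 ?add0r; last first.
  move=> k _; rewrite [(_ %| _)%N](_ : _ = false) ?mul0r //.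
  rewrite -addnS dvdn_addr ?dvdn_mulr //; apply/negbTE.
  by rewrite gtnNdvd // ltnS ltn_ord.
have -> : (p.+1 * L + p).+1 = (p.+1 * L.+1)%N by rewrite -addnS mulnS addnC.
by rewrite dvdn_mulr // mul1r natrM exprMn invfM.
Qed.

(** A length divisible by 6 makes the sums over multiples of 2 and of 3 complete; the coefficients
    are 8 / 2^3 = 1 and (9 / 2) / 3^3 = 1 / 6. *)
Lemma sum_star_weight L : \sum_(k < 6 * L) star_weight R k.+1 * (k.+1%:R : R) ^- 3 =
  - (7 / 2) * zsum R 3 (6 * L) + zsum R 3 (3 * L) - 1 / 6 * zsum R 3 (2 * L).
Proof.
have h2 := @zsum_dvd 2 (3 * L) isT; have h3 := @zsum_dvd 3 (2 * L) isT.
rewrite !mulnA /= in h2 h3.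
under eq_bigr => k _ do rewrite star_weightE mulrBl mulrDl -[8 * _ * _]mulrA -[9 / 2 * _ * _]mulrA.
rewrite sumrB big_split -!mulr_sumr /= h2 h3 -/(zsum R 3 (6 * L)); lra.
Qed.

Lemma etaE : eta R = 4 * zeta R 3 / pi ^+ 2.
Proof.
have pi0 := pi_gt0 R; rewrite /eta zeta2E; move: (pi : R) pi0 => p p0.
by field; rewrite (gt_eqF p0).
Qed.

(** Here the constant appears: - 7/2 + 1 - 1/6 = - 8/3, and 6 / (4 pi^2) times 8/3 is 4 / pi^2. *)
Lemma fcoef_sum_cvg (e : R) : 0 < e -> exists L0, forall L, (L0 <= L)%N ->
  `|\sum_(k < 6 * L) fcoef R k.+1 / k.+1%:R + eta R| <= e.
Proof.
move=> e0; have pi0 := pi_gt0 R.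
have pi2 : 0 < pi ^+ 2 :> R by rewrite exprn_gt0.
have p4 : 4 <= pi ^+ 2 :> R by have := pi_ge2 R; nra.
have e2 : 0 < e / 2 by rewrite divr_gt0.
have /cvgrPdist_le /(_ _ e2)[L0 _ L0P] := @zeta3_cvg R.
exists L0 => L LL; have E : \sum_(k < 6 * L) fcoef R k.+1 / k.+1%:R =
    6 / (4 * pi ^+ 2) * \sum_(k < 6 * L) star_weight R k.+1 * (k.+1%:R : R) ^- 3.
  rewrite mulr_sumr; apply: eq_bigr => k _; rewrite /fcoef.
  have kR : k.+1%:R != 0 :> R by rewrite pnatr_eq0.
  move: (k.+1%:R : R) kR => x x0; move: (pi : R) pi0 => p p0.
  by field; rewrite x0 (gt_eqF p0).
have h6 := L0P (6 * L)%N ltac:(rewrite /=; lia).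
have h3 := L0P (3 * L)%N ltac:(rewrite /=; lia).
have h2 := L0P (2 * L)%N ltac:(rewrite /=; lia).
rewrite E sum_star_weight etaE; move: h6 h3 h2 => /=.
set z := zeta R 3; set z6 := zsum R 3 (6 * L); set z3 := zsum R 3 (3 * L); set z2 := zsum R 3 (2 * L).
move=> h6 h3 h2.
have -> : 6 / (4 * pi ^+ 2) * (- (7 / 2) * z6 + z3 - 1 / 6 * z2) + 4 * z / pi ^+ 2 =
   (21 / 4 * (z - z6) - 6 / 4 * (z - z3) + 1 / 4 * (z - z2)) / pi ^+ 2.
  by move: (pi : R) pi0 => p p0; field; rewrite (gt_eqF p0).
rewrite normrM [X in _ * X]ger0_norm ?invr_ge0 ?(ltW pi2) // ler_pdivrMr //.
(* The coefficients 21/4, 6/4 and 1/4 add up to 7 and each error is at most e / 2, so the numerator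
   is at most 7 e / 2, below 4 e and hence below e pi^2. *)
apply: (@le_trans _ _ (e * 4)); last by rewrite ler_pM2l.
have := ler_normD (21 / 4 * (z - z6) - 6 / 4 * (z - z3)) (1 / 4 * (z - z2)).
have := ler_normB (21 / 4 * (z - z6)) (6 / 4 * (z - z3)).
rewrite ![ `|_ / 4 * _| ]normrM !(@ger0_norm _ (_ / 4)) ?divr_ge0 //; lra.
Qed.


Lemma bernoulli_sub (r : R) n : 0 <= r <= 1 -> 1 - r ^+ n <= n%:R * (1 - r).
Proof.
move=> /andP[r0 r1]; elim: n => [|n IH]; first by rewrite expr0 subrr mul0r.
have h : 0 <= 1 - r ^+ n by rewrite subr_ge0 exprn_ile1.
rewrite exprS -natr1 mulrDl mul1r.
have -> : 1 - r * r ^+ n = r * (1 - r ^+ n) + (1 - r) by ring.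
by rewrite lerD2r (le_trans _ IH) // ler_piMl.
Qed.

Lemma fcoef_le k : (0 < k)%N -> `|fcoef R k| <= 12 / pi ^+ 2 * (k%:R : R) ^- 2.
Proof.
move=> k0; have pi0 := pi_gt0 R; have kR : 0 < k%:R :> R by rewrite ltr0n.
have -> : fcoef R k = star_weight R k / 8 * (12 / pi ^+ 2 * (k%:R : R) ^- 2).
  rewrite /fcoef; move: (pi : R) pi0 => p p0.
  by field; rewrite !(gt_eqF p0, gt_eqF kR).
have h : 0 <= 12 / pi ^+ 2 * (k%:R : R) ^- 2.
  by rewrite mulr_ge0 // ?divr_ge0 ?invr_ge0 ?exprn_ge0 // ltW.
rewrite normrM [X in _ * X]ger0_norm // ler_piMl // normrM normfV [X in _ / X]ger0_norm //.
by rewrite ler_pdivrMr // mul1r star_weight_le.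
Qed.

(** Abel's limit theorem with a rate uniform in K: 1 - r^k <= k (1 - r) cancels the denominator k,
    and the sum of the |fcoef k| is at most 12 / pi^2 times pi^2 / 6. *)
Lemma fcoef_abel (r : R) K : 0 <= r <= 1 ->
  `|\sum_(k < K) r ^+ k.+1 / k.+1%:R * fcoef R k.+1 - \sum_(k < K) fcoef R k.+1 / k.+1%:R|
    <= 2 * (1 - r).
Proof.
move=> r01; have pi0 := pi_gt0 R; have pi2 : 0 < pi ^+ 2 :> R by rewrite exprn_gt0.
have /andP[r0 r1] := r01.
rewrite -sumrB (le_trans (ler_norm_sum _ _ _)) //.
apply: (@le_trans _ _ (\sum_(k < K) (1 - r) * (12 / pi ^+ 2) * (k.+1%:R : R) ^- 2)).
  apply: ler_sum => k _; have kR : 0 < k.+1%:R :> R by rewrite ltr0n.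
  have -> : r ^+ k.+1 / k.+1%:R * fcoef R k.+1 - fcoef R k.+1 / k.+1%:R =
      - ((1 - r ^+ k.+1) / k.+1%:R) * fcoef R k.+1 by ring.
  rewrite normrM -[leRHS]mulrA ler_pM // ?fcoef_le //.
  rewrite normrN ger0_norm; last first.
    by rewrite divr_ge0 // ?subr_ge0 ?exprn_ile1 // ltW.
  by rewrite ler_pdivrMr // mulrC bernoulli_sub.
rewrite -mulr_sumr -/(zsum R 2 K).
apply: (@le_trans _ _ ((1 - r) * (12 / pi ^+ 2) * (pi ^+ 2 / 6))).
  by rewrite ler_wpM2l ?zsum2_le // mulr_ge0 ?subr_ge0 // divr_ge0 // ltW.
rewrite le_eqVlt; apply/orP; left; apply/eqP.
by move: (pi : R) pi0 => p p0; field; rewrite (gt_eqF p0).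
Qed.

Lemma grid_limit (e : R) : 0 < e -> exists2 r0, 0 < r0 < 1 & forall r, r0 < r < 1 ->
  exists M0, forall M, (M0 <= M)%N -> `|grid_avg r (6 * M) - eta R| <= e.
Proof.
(* The cost 2 (1 - r) of [fcoef_abel] is then below e / 4. With r fixed, the series is cut at K = 6
   L, and M is chosen last. *)
move=> e0; pose r0 := 1 - Num.min (e / 8) (1 / 2).
have m1 : 0 < Num.min (e / 8) (1 / 2) by rewrite lt_min !divr_gt0.
have m2 : Num.min (e / 8) (1 / 2) <= 1 / 2 by rewrite ge_min lexx orbT.
have m3 : Num.min (e / 8) (1 / 2) <= e / 8 by rewrite ge_min lexx.
exists r0; first by rewrite /r0; apply/andP; split; lra.
move=> r /andP[rr r1]; have r_gt0 : 0 < r by move: rr; rewrite /r0; lra.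
have r01 : 0 < r < 1 by rewrite r_gt0.
have e4 : 0 < e / 4 by rewrite divr_gt0.
have [L0 L0P] := fcoef_sum_cvg e4.
have s0 : 0 < (1 - r) ^+ 2 by rewrite exprn_gt0 // subr_gt0.
have [L1 L1P] : exists L1, forall n, (L1 <= n)%N -> 2 * r ^+ n / (1 - r) ^+ 2 <= e / 4.
  have q0 : 0 < e / 4 * (1 - r) ^+ 2 / 2 by rewrite divr_gt0 // mulr_gt0.
  have /cvgrPdist_le /(_ _ q0)[L1 _ h] := @cvg_expr R r ltac:(by rewrite gtr0_norm).
  exists L1 => n nn; have := h n nn; rewrite sub0r normrN ger0_norm ?exprn_ge0 ?(ltW r_gt0) //.
  by rewrite ler_pdivrMr // ler_pdivlMr // mulrC.
have [L [LL0 LL1]] : exists L, (L0 <= L)%N /\ (L1 <= L)%N.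
  by exists (maxn L0 L1); rewrite leq_maxl leq_maxr.
have L1K : (L1 <= 6 * L)%N by rewrite (leq_trans LL1) // leq_pmull.
move KE : (6 * L)%N L1K => K L1K.
(* M > K gives 2 k < 6 M for the K frequencies used, and the other bound makes K * 18 / (6 M)^2 at
   most e / 4. *)
exists (maxn K.+1 (Num.bound (12 * K%:R / e))) => M; rewrite geq_max => /andP[KM MB].
have M0 : (0 < M)%N by apply: leq_trans KM.
have NR : 0 < (6 * M)%N%:R :> R by rewrite ltr0n muln_gt0.
have h1 := grid_avg_series K r01 M0.
have h2 := L1P K L1K.
have h3 := L0P L LL0; rewrite KE in h3.
have h4 := @fcoef_abel r K ltac:(by rewrite !ltW).
have h5 : `|\sum_(k < K) r ^+ k.+1 / k.+1%:R * star_avg M k.+1 -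
    \sum_(k < K) r ^+ k.+1 / k.+1%:R * fcoef R k.+1| <= e / 4.
  rewrite -sumrB (le_trans (ler_norm_sum _ _ _)) //.
  apply: (@le_trans _ _ (\sum_(k < K) 18 / (6 * M)%N%:R ^+ 2)).
    apply: ler_sum => k _; rewrite -mulrBr normrM -[leRHS]mul1r ler_pM //.
      have kR : 0 < k.+1%:R :> R by rewrite ltr0n.
      rewrite ger0_norm ?divr_ge0 ?exprn_ge0 ?(ltW r_gt0) // ler_pdivrMr // mul1r.
      by rewrite (@le_trans _ _ 1) ?exprn_ile1 ?(ltW r_gt0) ?(ltW r1) // ler1n.
    apply: star_cos_avg => //; move: (nat_of_ord k) (ltn_ord k) (KM); clear => k1; lia.
  rewrite sumr_const card_ord -[_ *+ K]mulr_natl mulrA ler_pdivrMr ?exprn_gt0 //.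
  have hb : 12 * K%:R / e <= M%:R.
    have : 12 * K%:R / e < (Num.bound (12 * K%:R / e))%:R.
      by rewrite archi_boundP // divr_ge0 ?mulr_ge0 // ltW.
    by move/ltW/le_trans; apply; rewrite ler_nat.
  move: hb; rewrite ler_pdivrMr // natrM => hb.
  have M1 : 1 <= M%:R :> R by rewrite ler1n.
  have : e * M%:R <= e * M%:R ^+ 2 by rewrite ler_pM2l // expr2 ler_peMl // ltW // ltr0n.
  have := ler0n R K; rewrite exprMn; lra.
have -> : grid_avg r (6 * M) - eta R =
   (grid_avg r (6 * M) + \sum_(k < K) r ^+ k.+1 / k.+1%:R * star_avg M k.+1)
   - (\sum_(k < K) r ^+ k.+1 / k.+1%:R * star_avg M k.+1 - \sum_(k < K) r ^+ k.+1 / k.+1%:R * fcoef R k.+1)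
   - (\sum_(k < K) r ^+ k.+1 / k.+1%:R * fcoef R k.+1 - \sum_(k < K) fcoef R k.+1 / k.+1%:R)
   - (\sum_(k < K) fcoef R k.+1 / k.+1%:R + eta R) by ring.
move: h1 h3 h4 h5; set a := _ + _; set b := _ - \sum_(k < K) r ^+ _ / _ * fcoef R _.
set c := _ - \sum_(k < K) _; set d := _ + eta R => h1 h3 h4 h5.
have := ler_normB (a - b - c) d; have := ler_normB (a - b) c; have := ler_normB a b.
move: rr; rewrite /r0; lra.
Qed.

End GridLimit.

(** * Comparison of F with F_r *)

Section Chords.
Variable R : realType.
Implicit Types (x y : R[i]) (r a b c : R).

Lemma ln_sub_le a b c : 0 < c -> c <= a -> c <= b -> ln a - ln b <= `|a - b| / c.
Proof.
move=> c0 ca cb; have a0 : 0 < a by apply: lt_le_trans ca.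
have b0 : 0 < b by apply: lt_le_trans cb.
rewrite -ln_div ?posrE //.
have E : a / b = 1 + (a - b) / b by field; rewrite gt_eqF.
rewrite E (le_trans (le_ln1Dx _)) //.
  by rewrite -subr_gt0 opprK addrC -E divr_gt0.
rewrite (le_trans (ler_norm _)) // normrM normfV (gtr0_norm b0).
by rewrite ler_wpM2l // lef_pV2.
Qed.

Lemma ln_dist a b c : 0 < c -> c <= a -> c <= b -> `|ln a - ln b| <= `|a - b| / c.
Proof.
move=> c0 ca cb; rewrite ler_norml ln_sub_le // andbT lerNl opprB distrC.
exact: ln_sub_le.
Qed.

Lemma max_dist (a b a' b' e : R) : `|a - a'| <= e -> `|b - b'| <= e ->
  `|Num.max a b - Num.max a' b'| <= e.
Proof.
rewrite !ler_norml => /andP[h1 h2] /andP[h3 h4].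
by case: (leP a b) => ?; case: (leP a' b') => ?; apply/andP; split; lra.
Qed.

Lemma nc_1sub_le2 r x : 0 < r < 1 -> nc x = 1 -> nc (1 - r%:C%C * x) <= 2.
Proof.
move=> /andP[r0 r1] x1; rewrite (le_trans (absB (nc_abs R) _ _)) //.
rewrite (abs1 (nc_abs R)) (absM (nc_abs R)) nc_real x1 mulr1 gtr0_norm //; lra.
Qed.

Lemma nc_1sub_dist r x x' : 0 < r < 1 ->
  `|nc (1 - r%:C%C * x) - nc (1 - r%:C%C * x')| <= nc (x - x').
Proof.
move=> /andP[r0 r1]; rewrite (le_trans (abs_dist (nc_abs R) _ _)) //.
have -> : 1 - r%:C%C * x - (1 - r%:C%C * x') = - (r%:C%C * (x - x')) by ring.
rewrite (absN (nc_abs R)) (absM (nc_abs R)) nc_real (gtr0_norm r0).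
by rewrite ler_piMl ?(ltW r1) // (abs_ge0 (nc_abs R)).
Qed.

Lemma chord_max_r_bounds r x y : 0 < r < 1 -> nc x = 1 -> nc y = 1 ->
  1 - r <= chord_max_r r x y <= 2.
Proof.
move=> r01 x1 y1; rewrite /chord_max_r le_max nc_1sub_gt0 // !ge_max !nc_1sub_le2 //=.
have /andP[r0 r1] := r01; rewrite (le_trans (absB (nc_abs R) _ _)) //.
rewrite y1 (absM (nc_abs R)) nc_real x1 mulr1 gtr0_norm //; lra.
Qed.

Lemma ln_chord_max_r_bound r x y : 0 < r < 1 -> nc x = 1 -> nc y = 1 ->
  `|ln (chord_max_r r x y)| <= (1 - r)^-1.
Proof.
move=> r01 x1 y1; have /andP[h1 h2] := chord_max_r_bounds r01 x1 y1.
have /andP[r0 r1] := r01.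
have c0 : 0 < 1 - r by rewrite subr_gt0.
have := ln_dist c0 h1 (_ : 1 - r <= 1); rewrite ln1 subr0 => /(_ _).
move=> h; rewrite (le_trans (h _)) //; first lra.
rewrite -[leRHS]mul1r ler_pM2r ?invr_gt0 //.
by rewrite ler_norml; apply/andP; split; lra.
Qed.

Lemma ln_chord_max_r_lip r x x' y y' : 0 < r < 1 -> nc x = 1 -> nc x' = 1 ->
  nc y = 1 -> nc y' = 1 ->
  `|ln (chord_max_r r x y) - ln (chord_max_r r x' y')| <= (1 - r)^-1 * (nc (x - x') + nc (y - y')).
Proof.
move=> r01 x1 x1' y1 y1'; have /andP[h1 h2] := chord_max_r_bounds r01 x1 y1.
have /andP[h3 h4] := chord_max_r_bounds r01 x1' y1'.
have /andP[r0 r1] := r01.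
have c0 : 0 < 1 - r by rewrite subr_gt0.
rewrite (le_trans (ln_dist c0 h1 h3)) // mulrC ler_pM2l ?invr_gt0 //.
have p1 := abs_ge0 (nc_abs R) (x - x'); have p2 := abs_ge0 (nc_abs R) (y - y').
apply: max_dist; first by rewrite (le_trans (nc_1sub_dist _ _ r01)) // lerDl.
apply: max_dist; first by rewrite (le_trans (nc_1sub_dist _ _ r01)) // lerDr.
rewrite (le_trans (abs_dist (nc_abs R) _ _)) //.
have -> : y - r%:C%C * x - (y' - r%:C%C * x') = (y - y') - r%:C%C * (x - x') by ring.
rewrite (le_trans (absB (nc_abs R) _ _)) // addrC lerD2r.
by rewrite (absM (nc_abs R)) nc_real (gtr0_norm r0) ler_piMl ?(ltW r1).
Qed.

Lemma ln_nc_1sub_bound r x : 0 < r < 1 -> nc x = 1 -> `|ln (nc (1 - r%:C%C * x))| <= (1 - r)^-1.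
Proof.
move=> r01 x1; have h1 := nc_1sub_gt0 r01 x1; have h2 := nc_1sub_le2 r01 x1.
have /andP[r0 r1] := r01.
have c0 : 0 < 1 - r by rewrite subr_gt0.
have := ln_dist c0 h1 (_ : 1 - r <= 1); rewrite ln1 subr0 => /(_ _).
move=> h; rewrite (le_trans (h _)) //; first lra.
rewrite -[leRHS]mul1r ler_pM2r ?invr_gt0 //.
by rewrite ler_norml; apply/andP; split; lra.
Qed.

Lemma ln_nc_1sub_lip r x x' : 0 < r < 1 -> nc x = 1 -> nc x' = 1 ->
  `|ln (nc (1 - r%:C%C * x)) - ln (nc (1 - r%:C%C * x'))| <= (1 - r)^-1 * nc (x - x').
Proof.
move=> r01 x1 x1'; have h1 := nc_1sub_gt0 r01 x1; have h2 := nc_1sub_gt0 r01 x1'.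
have c0 : 0 < 1 - r by rewrite subr_gt0; case/andP: r01.
rewrite (le_trans (ln_dist c0 h1 h2)) // mulrC ler_pM2l ?invr_gt0 //.
exact: nc_1sub_dist.
Qed.

Lemma nc_1sub_sqr r x : nc x = 1 ->
  nc (1 - r%:C%C * x) ^+ 2 = 1 + r ^+ 2 - 2 * r * complex.Re x.
Proof.
move=> x1; apply: complexI; rewrite nc_sqr.
have h := mul_conj x1; have -> : (1 - r%:C%C * x)^*%C = 1 - r%:C%C * x^*%C.
  by case: (x) => a b; apply/eqP; rewrite eq_complex /=; apply/andP; split; apply/eqP; ring.
have e : x + x^*%C = (2 * complex.Re x)%:C%C.
  by case: (x) => a b; apply/eqP; rewrite eq_complex /=; apply/andP; split; apply/eqP; ring.
have -> : (1 - r%:C%C * x) * (1 - r%:C%C * x^*%C) = 1 + r%:C%C ^+ 2 * (x * x^*%C) - r%:C%C * (x + x^*%C).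
  by ring.
rewrite h e mulr1 rmorphB rmorphD rmorph1 rmorphXn !rmorphM /=; ring.
Qed.

(** Both |1 - x|^2 and |1 - r x|^2 / r are a constant minus 2 Re x, so they differ by a constant.
    This makes the identity compatible with maxima ([max_sqr_rel]). *)
Lemma nc_1sub_rel r x : 0 < r -> nc x = 1 ->
  nc (1 - x) ^+ 2 + (1 - r) ^+ 2 / r = nc (1 - r%:C%C * x) ^+ 2 / r.
Proof.
move=> r0 x1; have := nc_1sub_sqr 1 x1; rewrite mul1r => ->.
rewrite nc_1sub_sqr //; field; by rewrite gt_eqF.
Qed.

End Chords.

Section Sandwich.
Variable R : realType.
Implicit Types (x y : R[i]) (r s u v : R).

Lemma max_sqr_rel r s u v u' v' : 0 < r -> 0 <= u -> 0 <= v -> 0 <= u' -> 0 <= v' ->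
  u ^+ 2 + s = u' ^+ 2 / r -> v ^+ 2 + s = v' ^+ 2 / r ->
  Num.max u v ^+ 2 + s = Num.max u' v' ^+ 2 / r.
Proof.
move=> r0 u0 v0 u0' v0' hu hv.
have E : (u <= v) = (u' <= v').
  by rewrite -ler_sqr ?nnegrE // -(lerD2r s) hu hv ler_pM2r ?invr_gt0 // ler_sqr ?nnegrE.
have [vu|vu] := leP u v; last by rewrite max_l ?hu // ltW // ltNge -E -ltNge.
by rewrite max_r ?hv // -E.
Qed.

Lemma nc_ge0 x : 0 <= nc x. Proof. exact: (abs_ge0 (nc_abs R)). Qed.

Lemma chord_max_sqr_rel r x y : 0 < r -> nc x = 1 -> nc y = 1 ->
  chord_max x y ^+ 2 + (1 - r) ^+ 2 / r = chord_max_r r x y ^+ 2 / r.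
Proof.
move=> r0 x1 y1; have y0 : y != 0.
  by apply/eqP => y0; move: y1; rewrite y0 (abs0 (nc_abs R)) => /eqP; rewrite eq_sym oner_eq0.
have z1 : nc (x / y) = 1 by rewrite (absM (nc_abs R)) (absV (nc_abs R)) x1 y1 invr1 mulr1.
have D : nc (y - x) = nc (1 - x / y).
  have -> : y - x = y * (1 - x / y) by field.
  by rewrite (absM (nc_abs R)) y1 mul1r.
have Dr : nc (y - r%:C%C * x) = nc (1 - r%:C%C * (x / y)).
  have -> : y - r%:C%C * x = y * (1 - r%:C%C * (x / y)) by field.
  by rewrite (absM (nc_abs R)) y1 mul1r.
rewrite /chord_max /chord_max_r D Dr.
apply: max_sqr_rel; rewrite ?nc_ge0 ?le_max ?nc_ge0 //; first exact: nc_1sub_rel.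
by apply: max_sqr_rel; rewrite ?nc_ge0 //; exact: nc_1sub_rel.
Qed.

Lemma chord_max_ge x y : nc (1 - x) <= chord_max x y.
Proof. by rewrite le_max lexx. Qed.

Lemma chord_max_le2 x y : nc x = 1 -> nc y = 1 -> chord_max x y <= 2.
Proof.
move=> x1 y1; rewrite /chord_max !ge_max !(le_trans (absB (nc_abs R) _ _)) //.
all: by rewrite ?(abs1 (nc_abs R)) ?x1 ?y1.
Qed.

Lemma nc_1sub_neq0 x : x != 1 -> 0 < nc (1 - x).
Proof. by move=> x1; rewrite (abs_gt0 (nc_abs R)) subr_eq0 eq_sym. Qed.

Lemma ln_sqr u : 0 < u -> ln (u ^+ 2) = ln u *+ 2.
Proof. by move=> u0; rewrite lnXn. Qed.

Lemma ln_chord_max_upper r x y : 0 < r < 1 -> nc x = 1 -> nc y = 1 -> x != 1 ->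
  ln (chord_max x y) <= ln (chord_max_r r x y) - ln r / 2.
Proof.
move=> r01 x1 y1 xn1; have /andP[r0 r1] := r01.
have m0 : 0 < chord_max x y by rewrite (lt_le_trans (nc_1sub_neq0 xn1)) ?chord_max_ge.
have mr0 : 0 < chord_max_r r x y.
  by have /andP[h _] := chord_max_r_bounds r01 x1 y1; rewrite (lt_le_trans _ h) // subr_gt0.
have : ln (chord_max x y ^+ 2) <= ln (chord_max_r r x y ^+ 2 / r).
  rewrite ler_ln ?posrE ?divr_gt0 ?exprn_gt0 // -chord_max_sqr_rel //.
  by rewrite lerDl divr_ge0 ?sqr_ge0 // ltW.
rewrite ln_div ?posrE ?exprn_gt0 // !ln_sqr //; lra.
Qed.

(** Adding the same constant (1 - r)^2 / r to two squares brings their ratio closer to 1. Hence, as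
    |1 - x| is at most the maximum, the ratio of the maximum to |1 - x| can only decrease on passing
    to the smoothed chords. *)
Lemma ln_chord_max_lower r x y : 0 < r < 1 -> nc x = 1 -> nc y = 1 -> x != 1 ->
  ln (chord_max_r r x y) - ln (nc (1 - r%:C%C * x)) + ln (nc (1 - x)) <= ln (chord_max x y).
Proof.
move=> r01 x1 y1 xn1; have /andP[r0 r1] := r01.
have a0 := nc_1sub_neq0 xn1.
have m0 : 0 < chord_max x y by rewrite (lt_le_trans a0) ?chord_max_ge.
have mr0 : 0 < chord_max_r r x y.
  by have /andP[h _] := chord_max_r_bounds r01 x1 y1; rewrite (lt_le_trans _ h) // subr_gt0.
have ar0 : 0 < nc (1 - r%:C%C * x) by rewrite (lt_le_trans _ (nc_1sub_gt0 r01 x1)) // subr_gt0.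
rewrite addrAC lerBlDr -!lnM ?posrE // ler_ln ?posrE ?mulr_gt0 //.
rewrite -ler_sqr ?nnegrE ?mulr_ge0 ?(ltW a0, ltW m0, ltW mr0, ltW ar0) // !exprMn.
have h1 := chord_max_sqr_rel r0 x1 y1; have h2 := nc_1sub_rel r0 x1.
have h3 : nc (1 - x) ^+ 2 <= chord_max x y ^+ 2.
  by rewrite ler_sqr ?nnegrE ?chord_max_ge // ltW.
have h4 : 0 <= (1 - r) ^+ 2 / r by rewrite divr_ge0 ?sqr_ge0 // ltW.
have ri : 0 < r^-1 by rewrite invr_gt0.
rewrite -(ler_pM2r ri) mulrAC -h1 -[leRHS]mulrA -h2 mulrDl mulrDr lerD2l.
by rewrite mulrC ler_wpM2r.
Qed.

End Sandwich.

(** * Means over the conjugates of a torsion point *)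

Section UnitAverages.
Variable R : realType.
Implicit Types (x y z : R[i]) (r s : R).

(** By [usum_fiber] the sum reduces to the exact order e of y, where it is the logarithm of a
    positive integer, the norm of 1 - y. *)
Lemma usum_ln_nc_ge0 d y : (0 < d)%N -> y ^+ d = 1 -> y != 1 ->
  0 <= usum d (fun a => ln (nc (1 - y ^+ a))) :> R.
Proof.
move=> d0 yd yn1; have [e ye ed] := prim_order_exists d0 yd.
have e0 := prim_order_gt0 ye; have e1 : (1 < e)%N.
  case: e e0 ye {ed} => [|[|e]] // _ y1; case/eqP: yn1.
  by rewrite -[y]expr1 (prim_expr_order y1).
have := usum_fiber (f := fun a => ln (nc (1 - y ^+ a)) : R) d0 ed.
move=> /(_ (fun a => congr1 (fun t => ln (nc (1 - t)) : R) (prim_expr_mod ye a))) H.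
have te : 0 < (totient e)%:R :> R by rewrite ltr0n totient_gt0.
rewrite -(pmulr_lge0 _ te) mulr_natr H mulrn_wge0 //.
have [q qE q1] := prod_coprime_prim_root e1 ye.
have pos a : coprime a e -> 0 < nc (1 - y ^+ a).
  move=> ca; apply: nc_1sub_neq0; rewrite -[1](expr0 y) (eq_prim_root_expr ye).
  by apply: contraL ca; rewrite mod0n -/(dvdn e a) => /dvdnP[k ->]; rewrite /coprime gcdnC gcdnMl gtn_eqF.
have -> : usum e (fun a => ln (nc (1 - y ^+ a))) =
    ln (\prod_(0 <= a < e | coprime a e) nc (1 - y ^+ a)).
  rewrite /usum; elim: (index_iota 0 e) => [|a l IH]; first by rewrite !big_nil ln1.
  rewrite !big_cons; case: ifP => // ca; rewrite IH lnM ?posrE ?pos //.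
  by rewrite prodr_gt0.
rewrite -(abs_prod (nc_abs R)) qE -(rmorph_nat (real_complex R)) nc_real normr_nat.
by rewrite ln_ge0 // ler1n; case: q1 => [->|[/prime_gt0]].
Qed.

(** If y has order e, the sum is totient d / totient e times 0, 1 or - 1. The hypothesis says e > 2
    q^2, which gives totient e >= q by [totient_sqr_ge]. *)
Lemma usum_expr_le d y q : (0 < d)%N -> y ^+ d = 1 ->
  (forall k, (0 < k <= 2 * q ^ 2)%N -> y ^+ k != 1) ->
  q%:R * nc (usum d (fun a => y ^+ a)) <= (totient d)%:R.
Proof.
move=> d0 yd yn; have [e ye ed] := prim_order_exists d0 yd.
have e0 := prim_order_gt0 ye.
have qe : (q <= totient e)%N.
  have : (2 * q ^ 2 < e)%N.
    by rewrite ltnNge; apply/negP => h; have := yn e; rewrite e0 h (prim_expr_order ye) eqxx => /(_ isT).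
  have := totient_sqr_ge e0; case: (odd e) => /=; nia.
have := usum_fiber (f := fun a => y ^+ a) d0 ed (prim_expr_mod ye).
move/(congr1 (@nc R)); rewrite -[X in nc X = _]mulr_natr -[X in _ = nc X]mulr_natr !(absM (nc_abs R)).
rewrite -!(rmorph_nat (real_complex R)) !nc_real !normr_nat => H.
have := usum_prim_root e0 ye; set s := usum e _ in H *; move=> sE.
have s1 : nc s <= 1.
  by move: sE; rewrite !inE => /or3P[] /eqP->; rewrite ?(absN (nc_abs R)) ?(abs0 (nc_abs R)) ?(abs1 (nc_abs R)).
apply: (@le_trans _ _ ((totient e)%:R * nc (usum d (fun a => y ^+ a)))).
  by rewrite ler_wpM2r ?nc_ge0 // ler_nat.
by rewrite mulrC H ler_piMl.
Qed.

Lemma usum_filter (V : nmodType) d (f : nat -> V) : usum d f = \sum_(a <- [seq a <- index_iota 0 d | coprime a d]) f a.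
Proof. by rewrite big_filter. Qed.

Lemma size_units d : size [seq a <- index_iota 0 d | coprime a d] = totient d.
Proof. by rewrite size_filter -sum1_count totient_usum. Qed.

End UnitAverages.

(* The condition multiplicatively_separated below for (z^u, z^v), where z is a
   primitive d-th root of unity. *)
Definition separated (n E d u v : nat) : Prop :=
  forall i j i' j', (i < n)%N -> (j < n)%N -> (i' < n)%N -> (j' < n)%N ->
  (i, j) != (i', j') -> forall k, (0 < k <= E)%N ->
  (k * i * u + k * j * v != k * i' * u + k * j' * v %[mod d])%N.

Lemma separatedW n E n' E' d u v : (n' <= n)%N -> (E' <= E)%N ->
  separated n E d u v -> separated n' E' d u v.
Proof.
move=> hn hE S i j i' j' hi hj hi' hj' ne k /andP[k0 kE].
by apply: S => //; rewrite ?k0 ?(leq_trans _ hn) ?(leq_trans kE).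
Qed.

Section MeanApprox.
Variable R : realType.
Implicit Types (x y z : R[i]) (r s : R).

Lemma nat_above (s : R) : exists2 n : nat, (0 < n)%N & s <= n%:R.
Proof.
exists (Num.bound `|s|).+1 => //; rewrite (le_trans (ler_norm s)) //.
by rewrite (le_trans (ltW (archi_boundP _))) // ler_nat.
Qed.

(** The bounds n and E depend only on Bf, Lf and e, and serve all orders d and all grids N >= n at
    once. *)
Lemma mean_approx (f : R[i] -> R[i] -> R) (Bf Lf e : R) :
  (forall x y, nc x = 1 -> nc y = 1 -> `|f x y| <= Bf) ->
  (forall x y x' y', nc x = 1 -> nc y = 1 -> nc x' = 1 -> nc y' = 1 ->
    `|f x y - f x' y'| <= Lf * (nc (x - x') + nc (y - y'))) ->
  0 <= Bf -> 0 <= Lf -> 0 < e ->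
  exists n E, forall d z u v, (0 < d)%N -> d.-primitive_root z -> separated n E d u v ->
  forall N, (n <= N)%N ->
  `|(totient d)%:R^-1 * usum d (fun a => f (z ^+ (a * u)) (z ^+ (a * v))) -
    (N%:R ^+ 2)^-1 * \sum_(g < N) \sum_(h < N) f (rootN R N ^+ g) (rootN R N ^+ h)| <= e.
Proof.
(* s is the scale of [equidistribution] and 1 / q its dl. Taking n >= 4 / s^2 makes the Lipschitz
   term at most 2 Lf s <= e / 2, and q makes the other term at most e / 2; Lf + 1 keeps the
   denominator positive. *)
move=> fB fL B0 L0 e0; pose s := e / (4 * (Lf + 1)).
have L1 : 0 < Lf + 1 by rewrite ltr_wpDl.
have s0 : 0 < s by rewrite divr_gt0 // mulr_gt0.
have h4 : (Lf + 1) * (4 * s) = e by rewrite /s; field; rewrite gt_eqF.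
clearbody s; have [n n0 nE] := nat_above (4 / s ^+ 2).
have [q q0 qE] := nat_above (2 * Bf * n%:R ^+ 2 / e).
exists n, (2 * q ^ 2)%N => d z u v d0 zP S N nN.
have N0 : (0 < N)%N by rewrite (leq_trans n0).
have qR : 0 < q%:R :> R by rewrite ltr0n.
have nR : 0 < n%:R :> R by rewrite ltr0n.
have zd k : nc (z ^+ k) = 1.
  by apply: (nc_unity_root d0); rewrite exprAC (prim_expr_order zP) expr1n.
have small : Lf * (s + 4 / n%:R / s) + Bf * (n%:R ^+ 2 * q%:R^-1) <= e.
  have h1 : 4 / n%:R / s <= s.
    rewrite -mulrA -invfM ler_pdivrMr ?mulr_gt0 //.
    have -> : s * (n%:R * s) = n%:R * s ^+ 2 by ring.
    by rewrite -ler_pdivrMr ?exprn_gt0.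
  have h2 : Bf * (n%:R ^+ 2 * q%:R^-1) <= e / 2.
    by rewrite mulrA ler_pdivrMr //; move: qE; rewrite ler_pdivrMr //; lra.
  have h3 : Lf * (s + 4 / n%:R / s) <= Lf * (s + s) by rewrite ler_wpM2l // lerD2l.
  nra.
have := @equidistribution R n N (rootN R N) n0 nN (rootN_prim R N0)
  [seq a <- index_iota 0 d | coprime a d] (fun a => z ^+ (a * u)) (fun a => z ^+ (a * v))
  f Bf Lf q%:R^-1 s (fun=> zd _) (fun=> zd _) fB fL L0 s0.
rewrite size_units -usum_filter invr_ge0 ltW // totient_gt0 => /(_ isT d0) H.
rewrite (le_trans (H _)) // => -[i j] [i' j'] ne /=.
have zi k : (z ^+ k)^*%C = (z ^+ k)^-1.
  by apply: (conj_unity_root d0); rewrite exprAC (prim_expr_order zP) expr1n.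
have z0 : z != 0 by rewrite (prim_root_eq0 zP) -lt0n.
(* The character sum is the sum of the conjugates of y, and separation says that y^k is not 1 for 0
   < k <= 2 q^2. *)
pose y := z ^+ (i * u + j * v) / z ^+ (i' * u + j' * v).
rewrite (eq_bigr (fun a => y ^+ a)); last first.
  move=> a _; rewrite -!exprM -!exprD zi /y expr_div_n -!exprM.
  by congr (z ^+ _ / z ^+ _); ring.
rewrite -usum_filter mulrC ler_pdivlMr // mulrC; apply: usum_expr_le => //.
  by rewrite /y expr_div_n -!exprM !(mulnC _ d) !exprM (prim_expr_order zP) !expr1n divr1.
move=> k kq; have := S i j i' j' (ltn_ord _) (ltn_ord _) (ltn_ord _) (ltn_ord _) ne k kq.
apply: contra => /eqP yk; rewrite -(eq_prim_root_expr zP).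
rewrite -[X in X == _](divfK (expf_neq0 (k * i' * u + k * j' * v) z0)).
have -> : z ^+ (k * i * u + k * j * v) / z ^+ (k * i' * u + k * j' * v) = y ^+ k.
  by rewrite /y expr_div_n -!exprM; congr (z ^+ _ / z ^+ _); ring.
by rewrite yk mul1r.
Qed.

End MeanApprox.

Section HeightClose.
Variable R : realType.
Implicit Types (x y z : R[i]) (r s e : R).

Lemma usum_le d (f g : nat -> R) : (forall a, coprime a d -> f a <= g a) -> usum d f <= usum d g.
Proof. by move=> fg; apply: ler_sum => a /fg. Qed.

Lemma usum_const d (s : R) : usum d (fun=> s) = (totient d)%:R * s.
Proof.
by rewrite totient_usum /usum natr_sum mulr_suml; apply: eq_bigr => a _; rewrite mul1r.
Qed.

Lemma usumD d (f g : nat -> R) : usum d (fun a => f a + g a) = usum d f + usum d g.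
Proof. exact: big_split. Qed.

Lemma usumB d (f g : nat -> R) : usum d (fun a => f a - g a) = usum d f - usum d g.
Proof. exact: sumrB. Qed.

Lemma separated_prim_neq1 n E d u v z a : (2 <= n)%N -> (1 <= E)%N ->
  d.-primitive_root z -> separated n E d u v -> coprime a d -> z ^+ (a * u) != 1.
Proof.
move=> n2 E1 zP S ad; have := S 1%N 0%N 0%N 0%N n2 (ltnW n2) (ltnW n2) (ltnW n2) isT 1%N.
rewrite E1 !muln0 !mul0n !addn0 !mul1n => /(_ isT); apply: contra.
rewrite -(prim_order_dvd zP) Gauss_dvdr; last by rewrite coprime_sym.
by rewrite mod0n.
Qed.

Lemma mean_chord_max_close e : 0 < e -> exists n E, forall d z u v, (0 < d)%N ->
  d.-primitive_root z -> separated n E d u v ->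
  `|(totient d)%:R^-1 * usum d (fun a => ln (chord_max (z ^+ (a * u)) (z ^+ (a * v)))) - eta R| <= e.
Proof.
move=> e0; have e4 : 0 < e / 4 by rewrite divr_gt0.
have [r0 /andP[r00 r01] rP] := grid_limit e4.
have [r /andP[r0r r1] rln] : exists2 r, r0 < r < 1 & - ln r / 2 <= e / 4.
  (* The first entry puts r above r0, the second gives - ln r <= e / 2. *)
  pose r := Num.max ((r0 + 1) / 2) (expR (- (e / 2))).
  have h : (r0 + 1) / 2 <= r by rewrite le_max lexx.
  have h2 : expR (- (e / 2)) <= r by rewrite le_max lexx orbT.
  have rr : 0 < r by rewrite (lt_le_trans _ h2) // expR_gt0.
  exists r; last first.
    have : - (e / 2) <= ln r by rewrite -[leLHS]expRK ler_ln ?posrE ?expR_gt0.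
    lra.
  apply/andP; split; first lra.
  by rewrite gt_max expR_lt1 oppr_lt0 divr_gt0 // andbT; lra.
have rr : 0 < r by apply: lt_trans r0r.
have r_01 : 0 < r < 1 by rewrite rr.
have [M0 M0P] := rP r ltac:(by rewrite r0r).
have B0 : 0 <= (1 - r)^-1 by rewrite invr_ge0 subr_ge0 ltW.
pose F x y := ln (chord_max_r r x y); pose G x (y : R[i]) := ln (nc (1 - r%:C%C * x)).
have [||n1 [E1 H1]] := @mean_approx R F (1 - r)^-1 (1 - r)^-1 (e / 4) _ _ B0 B0 e4.
- by move=> x y x1 y1; apply: ln_chord_max_r_bound.
- by move=> x y x' y' x1 y1 x1' y1'; apply: ln_chord_max_r_lip.
have [||n2 [E2 H2]] := @mean_approx R G (1 - r)^-1 (1 - r)^-1 (e / 4) _ _ B0 B0 e4.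
- by move=> x y x1 y1; apply: ln_nc_1sub_bound.
- move=> x y x' y' x1 y1 x1' y1'; rewrite (le_trans (ln_nc_1sub_lip r_01 x1 x1')) //.
  by rewrite ler_wpM2l // lerDl nc_ge0.
exists (maxn 2 (maxn n1 n2)), (maxn 1 (maxn E1 E2)) => d z u v d0 zP S.
pose M := maxn M0 (maxn 1 (maxn n1 n2)).
have hM : (M0 <= M)%N by rewrite leq_maxl.
have M1 : (0 < M)%N by rewrite /M !leq_max orbT.
have n1M : (n1 <= 6 * M)%N by rewrite (@leq_trans M) ?leq_pmull // /M !leq_max leqnn !orbT.
have n2M : (n2 <= 6 * M)%N by rewrite (@leq_trans M) ?leq_pmull // /M !leq_max leqnn !orbT.
clearbody M.
have S1 : separated n1 E1 d u v by apply: separatedW S; rewrite !leq_max leqnn !orbT.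
have S2 : separated n2 E2 d u v by apply: separatedW S; rewrite !leq_max leqnn !orbT.
have zn1 a : coprime a d -> z ^+ (a * u) != 1.
  by apply: separated_prim_neq1 zP S; rewrite leq_max.
have := H1 d z u v d0 zP S1 _ n1M; have := H2 d z u v d0 zP S2 _ n2M.
rewrite -/(grid_avg r (6 * M)); have := M0P M hM.
have zd k : nc (z ^+ k) = 1.
  by apply: (nc_unity_root d0); rewrite exprAC (prim_expr_order zP) expr1n.
have : ((6 * M)%:R ^+ 2)^-1 * \sum_(g < 6 * M) \sum_(h < 6 * M)
    G (rootN R (6 * M) ^+ g) (rootN R (6 * M) ^+ h) <= 0.
  rewrite pmulr_rle0 ?invr_gt0 ?exprn_gt0 ?ltr0n ?muln_gt0 //.
  under eq_bigr do rewrite sumr_const.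
  by rewrite sumrMnl mulrn_wle0 // grid_ln_1sub_le0 // muln_gt0.
set AG := _^-1 * _; set AF := grid_avg _ _.
have td : 0 < (totient d)%:R :> R by rewrite ltr0n totient_gt0.
have up : (totient d)%:R^-1 * usum d (fun a => ln (chord_max (z ^+ (a * u)) (z ^+ (a * v)))) <=
    (totient d)%:R^-1 * usum d (fun a => F (z ^+ (a * u)) (z ^+ (a * v))) - ln r / 2.
  have -> : ln r / 2 = (totient d)%:R^-1 * usum d (fun=> ln r / 2) by rewrite usum_const mulKf ?gt_eqF.
  rewrite -mulrBr -usumB ler_pM2l ?invr_gt0 //; apply: usum_le => a ca.
  by apply: ln_chord_max_upper => //; apply: zn1.
(* Termwise the mean of ln |1 - x| is also present, but it is nonnegative and is dropped. The mean
   of G is within e / 4 of its grid mean, which is at most 0, so it costs at most e / 4. *)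
have lo : (totient d)%:R^-1 * usum d (fun a => F (z ^+ (a * u)) (z ^+ (a * v))) -
    (totient d)%:R^-1 * usum d (fun a => G (z ^+ (a * u)) (z ^+ (a * v))) <=
    (totient d)%:R^-1 * usum d (fun a => ln (chord_max (z ^+ (a * u)) (z ^+ (a * v)))).
  rewrite -mulrBr -usumB ler_pM2l ?invr_gt0 //.
  have h : 0 <= usum d (fun a => ln (nc (1 - (z ^+ u) ^+ a))) :> R.
    apply: usum_ln_nc_ge0 => //; first by rewrite exprAC (prim_expr_order zP) expr1n.
    by have := zn1 1%N (coprime1n _); rewrite mul1n.
  rewrite -[leLHS]addr0 (le_trans (lerD (lexx _) h)) // -usumD; apply: usum_le => a ca.
  by rewrite -exprM [(u * a)%N]mulnC ln_chord_max_lower // zn1.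
rewrite !ler_norml => hG /andP[h1 h2] /andP[h3 h4] /andP[h5 h6].
by apply/andP; split; lra.
Qed.

End HeightClose.

(** * Heights of separated torsion points and a uniform bound *)

Section HeightBounds.
Variable R : realType.
Implicit Types (x y z : R[i]) (r s e : R).

(** With s the square root of totient d, d <= 2 s^4 by [totient_sqr_ge], so ln d <= 1 + 4 s <= 5
    s. *)
Lemma ln_div_totient d : (0 < d)%N ->
  ln d%:R / (totient d)%:R <= 5 / Num.sqrt (totient d)%:R :> R.
Proof.
move=> d0; have := totient_sqr_ge d0; have := totient_gt0 d; rewrite d0.
move: (totient d) => t t0 dt.
have t1 : 1 <= t%:R :> R by rewrite ler1n.
have s1 : 1 <= Num.sqrt t%:R :> R by rewrite -[X in X <= _]sqrtr1 ler_wsqrtr.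
have sE : t%:R = Num.sqrt t%:R ^+ 2 :> R by rewrite sqr_sqrtr.
have dt2 : d%:R <= 2 * (t%:R : R) ^+ 2.
  by rewrite -natrX -natrM ler_nat (leq_trans dt) // leq_mul2r leq_subr orbT.
rewrite [X in _ / X <= _]sE; move: (Num.sqrt _) s1 sE => s s1 sE.
have s0 : 0 < s by apply: lt_le_trans s1.
rewrite expr2 invfM mulrA ler_pM2r ?invr_gt0 // ler_pdivrMr //.
have : ln (d%:R : R) <= ln (2 * s ^+ 4).
  rewrite ler_ln ?posrE ?ltr0n ?mulr_gt0 ?exprn_gt0 //.
  by rewrite (le_trans dt2) // sE -exprM.
rewrite lnM ?posrE ?exprn_gt0 // lnXn // -mulr_natr.
have := ln_sublinear s0; have : ln 2 <= 1 :> R.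
  by have := @le_ln1Dx R 1 ltac:(lra).
lra.
Qed.

Lemma ln_div_totient_le5 d : (0 < d)%N -> ln d%:R / (totient d)%:R <= 5 :> R.
Proof.
move=> d0; rewrite (le_trans (ln_div_totient d0)) // ler_pdivrMr.
  by rewrite ler_peMr // -[X in X <= _]sqrtr1 ler_wsqrtr // ler1n totient_gt0.
by rewrite sqrtr_gt0 ltr0n totient_gt0.
Qed.

Lemma ln_div_totient_small e : 0 < e ->
  exists E, forall d, (E < d)%N -> ln d%:R / (totient d)%:R <= e.
Proof.
move=> e0; have [k k0 kE] := nat_above (25 / e ^+ 2).
exists (2 * k ^ 2)%N => d Ed; have d0 : (0 < d)%N by apply: leq_trans Ed.
rewrite (le_trans (ln_div_totient d0)) //.
have kt : (k <= totient d)%N.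
  by have := totient_sqr_ge d0; case: (odd d) => /=; nia.
have h : 5 / e <= Num.sqrt (totient d)%:R.
  rewrite -[leLHS](ger0_norm (_ : 0 <= 5 / e)) ?divr_ge0 ?(ltW e0) // -sqrtr_sqr ler_wsqrtr //.
  rewrite (le_trans _ (_ : k%:R <= _)) ?ler_nat // (le_trans _ kE) //.
  by rewrite exprMn exprVn ler_pM2r ?invr_gt0 ?exprn_gt0 //; lra.
rewrite ler_pdivrMr ?(lt_le_trans _ h) ?divr_gt0 //.
by rewrite mulrC -ler_pdivrMr.
Qed.

(** At a torsion point: the quotient of two distinct monomials with exponents below n has order
    greater than E. Writing it as an inequality of two monomials keeps all exponents natural. *)
Definition multiplicatively_separated (n E : nat) (om : algC * algC) : Prop :=
  forall i j i' j', (i < n)%N -> (j < n)%N -> (i' < n)%N -> (j' < n)%N ->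
  (i, j) != (i', j') -> forall k, (0 < k <= E)%N ->
  om.1 ^+ (k * i) * om.2 ^+ (k * j) != om.1 ^+ (k * i') * om.2 ^+ (k * j').

Lemma height_close e : 0 < e -> exists n E, forall om, torsion_point om -> om != (1, 1) ->
  multiplicatively_separated n E om -> `|height_C_cap R om - eta R| <= e.
Proof.
move=> e0; have e2 : 0 < e / 2 by rewrite divr_gt0.
have [n [E H]] := mean_chord_max_close e2; have [E' E'P] := ln_div_totient_small e2.
exists (maxn 2 n), (maxn 2 (maxn E E')) => om tom om1 S.
have [d [u [v [d1 omE hE]]]] := height_formula R tom om1.
have Sd : separated (maxn 2 n) (maxn 2 (maxn E E')) d u v.
  move=> i j i' j' hi hj hi' hj' ne k kE; apply: contra (S i j i' j' hi hj hi' hj' ne k kE).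
  by move=> /eqP h; apply/eqP/omE.
(* Separation of the monomials z1 and 1, used with k = d, forces d beyond all three bounds: d >= 3
   for the height formula, and d > E' for the finite places to be negligible. *)
have d0 := ltnW d1; have : (maxn 2 (maxn E E') < d)%N.
  rewrite ltnNge; apply/negP => dE.
  have n2 : (1 < maxn 2 n)%N by rewrite leq_max.
  have := Sd 1%N 0%N 0%N 0%N n2 (ltnW n2) (ltnW n2) (ltnW n2) isT d.
  by rewrite d0 dE !muln0 !mul0n !addn0 muln1 modnMr mod0n eqxx => /(_ isT).
rewrite !gtn_max => /and3P[d3 _ dE'].
have zP := rootN_prim R d0.
have /andP[h1 h2] := hE d3 _ zP.
have S' : separated n E d u v by apply: separatedW Sd; rewrite !leq_max leqnn !orbT.
have := H d _ u v d0 zP S'; have := E'P d dE'.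
move: h1 h2; rewrite mulNr; set a := _^-1 * _ => h1 h2 h3.
by rewrite !ler_norml => /andP[h4 h5]; apply/andP; split; lra.
Qed.

Lemma mean_chord_max_bounds d z u v : (0 < d)%N -> d.-primitive_root z ->
  z ^+ u != 1 \/ z ^+ v != 1 ->
  0 <= (totient d)%:R^-1 * usum d (fun a => ln (chord_max (z ^+ (a * u)) (z ^+ (a * v)))) <= ln 2.
Proof.
move=> d0 zP uv; have td : 0 < (totient d)%:R :> R by rewrite ltr0n totient_gt0.
have zd k : nc (z ^+ k) = 1.
  by apply: (nc_unity_root d0); rewrite exprAC (prim_expr_order zP) expr1n.
have ge1 y t : y = z ^+ t -> y != 1 ->
    (forall a, nc (1 - y ^+ a) <= chord_max (z ^+ (a * u)) (z ^+ (a * v))) ->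
    0 <= usum d (fun a => ln (chord_max (z ^+ (a * u)) (z ^+ (a * v)))).
  move=> yE yn1 hy; have yd : y ^+ d = 1 by rewrite yE exprAC (prim_expr_order zP) expr1n.
  rewrite (le_trans (usum_ln_nc_ge0 d0 yd yn1)) //; apply: usum_le => a ca.
  have p : 0 < nc (1 - y ^+ a).
    apply: nc_1sub_neq0; apply: contra yn1; rewrite yE -exprM -!(prim_order_dvd zP).
    by rewrite Gauss_dvdl // coprime_sym.
  by rewrite ler_ln ?posrE // (lt_le_trans p).
apply/andP; split.
  rewrite mulr_ge0 ?invr_ge0 ?(ltW td) //; case: uv => h; apply: (ge1 _ _ erefl h) => a.
    by rewrite -exprM [(u * a)%N]mulnC chord_max_ge.
  by rewrite -exprM [(v * a)%N]mulnC /chord_max !le_max lexx orbT.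
rewrite mulrC ler_pdivrMr // mulrC -usum_const; apply: usum_le => a _.
have h := chord_max_le2 (zd (a * u)%N) (zd (a * v)%N).
(* Otherwise the logarithm is 0 by convention, which is also at most ln 2. *)
have [p|p] := ltP 0 (chord_max (z ^+ (a * u)) (z ^+ (a * v))); first by rewrite ler_ln ?posrE.
by rewrite (ln0 p) ln_ge0 // ler1n.
Qed.

(** For d >= 3 the formula gives 5 + ln 2. For d = 2 the coordinates are 1 or - 1, and the heights
    of these finitely many points are added to B. *)
Lemma height_bounded : exists B : R, forall om, torsion_point om -> om != (1, 1) ->
  `|height_C_cap R om| <= B.
Proof.
pose l : seq (algC * algC) := [seq (a, b) | a <- [:: 1; -1], b <- [:: 1; -1]].
have ln2 : 0 <= ln 2 :> R by rewrite ln_ge0 // ler1n.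
exists (5 + ln 2 + \sum_(om <- l) `|height_C_cap R om|) => om tom om1.
have S0 : 0 <= \sum_(om <- l) `|height_C_cap R om| by apply: sumr_ge0.
have [d [u [v [d1 omE hE]]]] := height_formula R tom om1.
have d0 := ltnW d1; case: (ltnP 2 d) => d2; last first.
  have dE : d = 2%N by apply/eqP; rewrite eqn_leq d2.
  have sq1 : om.1 ^+ 2 == 1.
    by have := (omE 2 0 0 0)%N; rewrite !expr0 !mulr1 => h; apply/eqP/h; rewrite dE !mul0n addn0 modnMr mod0n.
  have sq2 : om.2 ^+ 2 == 1.
    by have := (omE 0 2 0 0)%N; rewrite !expr0 !mul1r => h; apply/eqP/h; rewrite dE !mul0n add0n modnMr mod0n.
  have oml : om \in l.
    by rewrite (surjective_pairing om); apply/allpairsP; exists om; rewrite !inE -!sqrf_eq1 sq1 sq2.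
  rewrite (le_trans _ (_ : \sum_(om <- l) `|height_C_cap R om| <= _)) ?lerDr ?addr_ge0 //.
  by rewrite (big_rem om oml) /= lerDl sumr_ge0.
have zP := rootN_prim R d0.
have /andP[h1 h2] := hE d2 _ zP.
have uv : rootN R d ^+ u != 1 \/ rootN R d ^+ v != 1.
  apply/orP; rewrite -negb_and; apply: contra om1; rewrite -!(prim_order_dvd zP) => /andP[du dv].
  rewrite (surjective_pairing om); apply/eqP; congr pair.
    by have := (omE 1 0 0 0)%N; rewrite !expr0 !mulr1 expr1 => -> //; rewrite !mul0n addn0 mul1n (eqP du) mod0n.
  by have := (omE 0 1 0 0)%N; rewrite !expr0 !mul1r expr1 => -> //; rewrite !mul0n add0n mul1n (eqP dv) mod0n.
have /andP[h3 h4] := mean_chord_max_bounds d0 zP uv.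
have h5 := ln_div_totient_le5 d0; move: h1 h2 h3 h4; rewrite mulNr.
set a := _^-1 * _ => h1 h2 h3 h4.
by rewrite ler_norml; apply/andP; split; lra.
Qed.

End HeightBounds.

(** * Strict sequences *)

Definition monomial_subgroup (a b c d : nat) : set (algC * algC) :=
  torus `&` [set z | z.1 ^+ a * z.2 ^+ b = z.1 ^+ c * z.2 ^+ d].

Lemma monomial_subgroup_algebraic a b c d : algebraic_subgroup (monomial_subgroup a b c d).
Proof.
split.
(* The coefficients carry the first coordinate and the outer variable the second. *)
- exists [set ('X^a)%:P * 'X^b - ('X^c)%:P * 'X^d]; congr (_ `&` _).
  apply/seteqP; split => z /=; last move/(_ _ erefl).
    by move=> h p ->; rewrite !hornerE /= h subrr.
  by rewrite !hornerE /= => /eqP; rewrite subr_eq0 => /eqP.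
- split; first by split; rewrite /= oner_neq0.
  by rewrite /= !expr1n.
- move=> z t [[z1 z2] /= hz] [[t1 t2] /= ht]; split; first by split; rewrite mulf_neq0.
  by rewrite /= !exprMn mulrACA hz ht mulrACA.
- move=> z [[z1 z2] /= hz]; split; first by split; rewrite invr_neq0.
  by rewrite /= !exprVn -!invfM hz.
Qed.

Lemma monomial_subgroup_proper a b c d : (a, b) != (c, d) ->
  monomial_subgroup a b c d != torus.
Proof.
apply: contra => /eqP H; have two0 : (2 : algC) != 0 by rewrite pnatr_eq0.
have inj m k : (2 : algC) ^+ m = 2 ^+ k -> m = k.
  move/eqP; rewrite -!natrX eqr_nat => /eqP h; apply/eqP.
  by rewrite -(eqn_exp2l m k (isT : (1 < 2)%N)) h.
(* The powers of 2 are distinct, so the points (2, 1) and (1, 2) recover the two exponents. *)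
have [_ /= h1] : monomial_subgroup a b c d (2, 1) by rewrite H; split; rewrite /= ?oner_neq0.
have [_ /= h2] : monomial_subgroup a b c d (1, 2) by rewrite H; split; rewrite /= ?oner_neq0.
by move: h1 h2; rewrite !expr1n !mulr1 !mul1r => /inj -> /inj ->.
Qed.

Section Strict.
Variable R : realType.
Implicit Types (A : {fset (algC * algC)}) (P : set (algC * algC)).

Lemma fractionE A P : fraction R A P = (#|` A|%:R)^-1 * \sum_(z <- A) (z \in P)%:R.
Proof.
rewrite /fraction mulrC; congr (_ * _).
by rewrite -sum1_size -big_fset_condE /= natr_sum big_mkcond; apply: eq_bigr => z _; case: ifP.
Qed.

Lemma torsion_torus z : torsion_point z -> torus z.
Proof.
have h (x : algC) n : (0 < n)%N -> x ^+ n = 1 -> x != 0.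
  by move=> n0 xn; apply/eqP => x0; move/eqP: xn; rewrite x0 expr0n -[n == _]negbK -lt0n n0 eq_sym oner_eq0.
by case=> [[n n0 z1] [m m0 z2]]; split; [apply: h z1 | apply: h z2].
Qed.

(** Union bound: a point of the torus that is not separated lies in one of finitely many proper
    monomial subgroups, a family that depends only on n and E, and strictness applies to each of
    them. *)
Lemma not_separated_fraction (W : nat -> {fset (algC * algC)}) n E :
  strict_sequence R W ->
  exists2 beta : nat -> R, beta @ \oo --> (0 : R) &
    forall l, (forall z, z \in W l -> torus z) ->
      fraction R (W l) (~` multiplicatively_separated n E) <= beta l.
Proof.
move=> sW.
pose T : finType := ('I_n * 'I_n * ('I_n * 'I_n) * 'I_E.+1)%type.
pose c (t : T) := (t.1.1 != t.1.2) && (0 < t.2)%N.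
pose H (t : T) := monomial_subgroup (t.2 * t.1.1.1) (t.2 * t.1.1.2) (t.2 * t.1.2.1) (t.2 * t.1.2.2).
exists (fun l => \sum_(t | c t) fraction R (W l) (H t)).
  have := @cvg_big R T +%R 0 c (@add_continuous _) nat \oo (index_enum T)
    (fun t l => fraction R (W l) (H t)) (fun=> 0) _.
  rewrite big1 //; apply => t /andP[ne t0].
  apply: sW; first exact: monomial_subgroup_algebraic.
  apply: monomial_subgroup_proper; apply: contra ne.
  by rewrite !xpair_eqE !eqn_pmul2l.
move=> l Wl; rewrite fractionE (eq_bigr _ (fun t _ => fractionE (W l) (H t))) -mulr_sumr.
rewrite ler_wpM2l ?invr_ge0 // exchange_big /= big_seq [leRHS]big_seq; apply: ler_sum => z zW.
case: (asboolP (z \in ~` multiplicatively_separated n E)); last by move=> /negP/negPf->; rewrite sumr_ge0.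
move=> h; rewrite h; move: h; rewrite inE /= => ns.
suff [t ct zt] : exists2 t, c t & z \in H t by rewrite (bigD1 t) //= zt lerDl sumr_ge0.
apply: contrapT => no; apply: ns => i j i' j' hi hj hi' hj' ne k /andP[k0 kE].
apply/eqP => h; apply: no.
have kE' : (k < E.+1)%N by rewrite ltnS.
exists ((Ordinal hi, Ordinal hj), (Ordinal hi', Ordinal hj'), Ordinal kE').
  by rewrite /c /= k0 andbT.
by rewrite inE; split => //; apply: Wl.
Qed.

End Strict.

Theorem theorem6p6 (R : realType) (W : nat -> {fset (algC * algC)})
  (W_nonempty : forall l, (1 <= l)%N -> W l != fset0)
  (W_torsion : forall l, (1 <= l)%N -> forall z, z \in W l ->
     torsion_point z /\ z != (1, 1))
  (W_strict : strict_sequence R W) :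
  (forall eps : R, 0 < eps ->
     (fun l => fraction R (W l) [set z | `|height_C_cap R z - eta R| < eps])
       @ \oo --> (1 : R)) /\
  (fun l => (#|` W l|%:R)^-1 * \sum_(z <- W l) height_C_cap R z)
    @ \oo --> eta R.
Proof.
have card0 l : (1 <= l)%N -> 0 < #|` W l|%:R :> R.
  by move=> l1; rewrite ltr0n cardfs_gt0 W_nonempty.
have mean1 l (s : R) : (1 <= l)%N -> (#|` W l|%:R)^-1 * \sum_(z <- W l) s = s.
  by move=> l1; rewrite big_const_seq count_predT iter_addr_0 -[s *+ _]mulr_natl mulKf // gt_eqF ?card0.
have Wtorus l : (1 <= l)%N -> forall z, z \in W l -> torus z.
  by move=> l1 z /(W_torsion l l1)[/torsion_torus].
split => [e e0|].
  have e2 : 0 < e / 2 by rewrite divr_gt0.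
  have [n [E close]] := height_close e2.
  have [beta b0 bP] := not_separated_fraction n E W_strict.
  (* Every separated point has height within e / 2 of eta, so the points that miss the interval are
     among the fraction bounded by beta. *)
  apply: (@squeeze_cvgr _ _ _ _ (fun l => 1 - beta l) (fun=> 1)); last exact: cvg_cst.
    near=> l; have l1 : (1 <= l)%N by near: l; exists 1%N.
    have := bP l (Wtorus l l1); rewrite !fractionE => hb; apply/andP; split; last first.
      rewrite -[leRHS](mean1 l 1 l1) ler_wpM2l ?invr_ge0 ?(ltW (card0 l l1)) //.
      by apply: ler_sum => z _; case: (z \in _).
    rewrite lerBlDr -[leLHS](mean1 l 1 l1) (le_trans _ (lerD (lexx _) hb)) //.
    rewrite -mulrDr -big_split /= ler_wpM2l ?invr_ge0 ?(ltW (card0 l l1)) //.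
    rewrite big_seq [leRHS]big_seq; apply: ler_sum => z zW.
    have [tz z1] := W_torsion l l1 z zW.
    case: (boolP (z \in ~` _)) => [_|]; first by rewrite lerDr.
    rewrite notin_setE /= => /contrapT S; rewrite addr0 mem_set //=.
    by rewrite (le_lt_trans (close z tz z1 S)) // ltr_pdivrMr // ltr_pMr // ltr1n.
  by rewrite -[X in _ --> X]subr0; apply: cvgB b0; exact: cvg_cst.
have [B HB] := height_bounded R.
(* C bounds the deviation from eta at every torsion point of W l; it is paid only on the fraction of
   non-separated points, while the others deviate by at most e / 2. *)
pose C := `|B| + `|eta R|.
have C0 : 0 <= C by rewrite addr_ge0.
apply/cvgrPdist_le => e e0; have e2 : 0 < e / 2 by rewrite divr_gt0.
have [n [E close]] := height_close e2.
have [beta b0 bP] := not_separated_fraction n E W_strict.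
(* C + 1 is positive even when C = 0, and C times this threshold is at most e / 2. *)
have q0 : 0 < e / 2 / (C + 1) by rewrite divr_gt0 // ltr_wpDl.
near=> l; have l1 : (1 <= l)%N by near: l; exists 1%N.
have hb := bP l (Wtorus l l1).
have bs : beta l <= e / 2 / (C + 1).
  have : `|0 - beta l| <= e / 2 / (C + 1) by near: l; move/cvgrPdist_le: b0; apply.
  by rewrite sub0r normrN => /(le_trans (ler_norm _)).
rewrite distrC -(mean1 l (eta R) l1) -mulrBr -sumrB normrM ger0_norm ?invr_ge0 ?(ltW (card0 l l1)) //.
apply: (@le_trans _ _ ((#|` W l|%:R)^-1 * \sum_(z <- W l)
    (e / 2 + C * (z \in ~` multiplicatively_separated n E)%:R))).
  rewrite ler_wpM2l ?invr_ge0 ?(ltW (card0 l l1)) // (le_trans (ler_norm_sum _ _ _)) //.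
  rewrite big_seq [leRHS]big_seq; apply: ler_sum => z zW.
  have [tz z1] := W_torsion l l1 z zW.
  case: (boolP (z \in ~` _)) => [_|]; last first.
    by rewrite notin_setE /= => /contrapT S; rewrite mulr0 addr0 close.
  rewrite mulr1 (le_trans (ler_normB _ _)) // (le_trans _ (_ : C <= _)) ?lerDr ?(ltW e2) //.
  by rewrite lerD2r (le_trans (HB z tz z1)) // ler_norm.
rewrite big_split /= mulrDr mean1 // -mulr_sumr mulrCA -fractionE.
have h : C * fraction R (W l) (~` multiplicatively_separated n E) <= C * (e / 2 / (C + 1)).
  by rewrite ler_wpM2l // (le_trans hb).
have h2 : C * (e / 2 / (C + 1)) <= e / 2.
  by rewrite mulrA ler_pdivrMr ?ltr_wpDl // mulrC ler_pM2l // lerDl.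
lra.
Unshelve. all: by end_near. Qed.
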